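(* Let $\delta>0$, $G_1(x)=x-\delta$, $G_2(x)=x+\delta$, and assume the integrability and limit conditions of the Dynkin game hold. Assume that for some $0\le\pi_I<1$, $0\le\pi_S<1$ and $r_I,r_S>0$ (with $-r_I<0<r_S$ the two roots of $\Psi(z)=r$), the infimum $I$ and supremum $S$ satisfy $$\mathbb E e^{zI}=\pi_I+(1-\pi_I)\frac{r_I}{r_I+z},\qquad \mathbb E e^{zS}=\pi_S+(1-\pi_S)\frac{r_S}{r_S-z},$$ i.e. $-I$ and $S$ have laws $\pi_I\delta_0+(1-\pi_I)\mathrm{Exp}(r_I)$ and $\pi_S\delta_0+(1-\pi_S)\mathrm{Exp}(r_S)$. Define $$E_I=\tfrac{1-\pi_I}{r_I},\ E_S=\tfrac{1-\pi_S}{r_S},\ F_I=\tfrac{r_I+r_S}{r_I+\pi_Ir_S},\ F_S=\tfrac{r_I+r_S}{\pi_Sr_I+r_S},\ G_I=F_I-1,\ G_S=F_S-1.$$ Then the equation in $u$ $$u-2\delta-E_I-E_S=\frac{-E_IF_Se^{r_Su}-E_SF_Ie^{r_Iu}+2E_SF_SG_I}{e^{(r_I+r_S)u}-G_IG_S}$$ has a unique positive solution $u$. With this $u$, set $$A_I=\frac{-E_Ie^{r_Su}+E_SG_I}{e^{(r_I+r_S)u}-G_IG_S},\qquad A_S=\frac{E_Se^{r_Iu}-E_IG_S}{e^{(r_I+r_S)u}-G_IG_S},$$ $$x_I=-\delta-E_I+F_IA_S,\qquad x_S=\delta+E_S+F_SA_I\quad(\text{so }x_S-x_I=u).$$ Then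 the Dynkin game with payoffs $G_1,G_2$ has optimal stopping times $\sigma^*=\inf\{t\ge0:X_t\le x_I\}$, $\tau^*=\inf\{t\ge0:X_t\ge x_S\}$ and value function $$V(x)=\begin{cases}x+\delta,& x\le x_I,\\ A_Ie^{-r_I(x-x_S)}+A_Se^{r_S(x-x_I)},& x_I\le x\le x_S,\\ x-\delta,& x\ge x_S,\end{cases}$$ that is, $V(x)=\inf_\sigma\sup_\tau M_x(\sigma,\tau)=\sup_\tau\inf_\sigma M_x(\sigma,\tau)=M_x(\sigma^*,\tau^* )$.
   Context: Let $X=(X_t)_{t\ge0}$ be a Lévy process with characteristic exponent $\Psi$ (so $\mathbb E e^{zX_t}=e^{t\Psi(z)}$), on a filtered probability space satisfying the usual conditions, with $X_0=x$ under $\mathbb P_x$. Stopping times take values in $[0,\infty]$. Fix $r>0$; for continuous $G_1\le G_2$ with $\mathbb E_x\sup_{t\ge0}|e^{-rt}G_i(X_t)|<\infty$ and $e^{-rt}G_i(X_t)\to0$ a.s. (the integrability and limit conditions), with convention $e^{-r\tau}G_i(X_\tau)=0$ on $\{\tau=\infty\}$, define $M_x(\sigma,\tau)=\mathbb E_x\big(e^{-r\tau}G_1(X_\tau)\mathbf 1_{\{\tau\le\sigma\}}+e^{-r\sigma}G_2(X_\sigma)\mathbf 1_{\{\sigma<\tau\}}\big)$. Let $e_r$ be exponential with parameter $r$, independent of $X$, $I=\inf_{0\le t\le e_r}X_t$, $S=\sup_{0\le t\le e_r}X_t$ under $\mathbb P=\mathbb P_0$. *)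

(* Defs.v *)
From mathcomp Require Import all_boot all_order all_algebra.
From mathcomp Require Import all_classical all_reals all_analysis.
Set Implicit Arguments.
Unset Strict Implicit.
Unset Printing Implicit Defensive.
Import Order.TTheory GRing.Theory Num.Theory.
Import numFieldNormedType.Exports.
Local Open Scope classical_set_scope.
Local Open Scope ring_scope.

Definition is_filtration d (T : measurableType d) (R : realType)
    (F : R -> set (set T)) : Prop :=
  [/\ (forall t, 0 <= t -> sigma_algebra setT (F t)),
      (forall t, 0 <= t -> F t `<=` measurable) &
      (forall s t, 0 <= s -> s <= t -> F s `<=` F t)].

Definition usual_conditions d (T : measurableType d) (R : realType)
    (P : probability T R) (F : R -> set (set T)) : Prop :=
  (forall t, 0 <= t -> forall A, (forall s, t < s -> F s A) -> F t A) /\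
  (forall N : set T, (exists M, [/\ measurable M, P M = 0%E & N `<=` M]) ->
     F 0 N).

Definition stopping_time d (T : measurableType d) (R : realType)
    (F : R -> set (set T)) (tau : T -> \bar R) : Prop :=
  (forall w, (0 <= tau w)%E) /\
  (forall t, 0 <= t -> F t [set w | (tau w <= t%:E)%E]).

(** A Levy process with respect to the filtration F under P, started at 0
    (the process started at x is x + X). Paths are cadlag. *)
Definition levy_process d (T : measurableType d) (R : realType)
    (P : probability T R) (F : R -> set (set T)) (X : R -> T -> R) : Prop :=
  [/\ (forall w, X 0 w = 0),
      (forall w t, 0 <= t -> X^~ w s @[s --> t^'+] --> X t w) &
      (forall w t, 0 < t -> cvg (X^~ w s @[s --> t^'-]))] /\
  [/\ (forall t, 0 <= t -> forall B : set R, measurable B ->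
          F t (X t @^-1` B)),
      (forall s t, 0 <= s -> s <= t -> forall (A : set T) (B : set R), F s A -> measurable B ->
          P (A `&` [set w | B (X t w - X s w)%R]) =
          (P A * P [set w | B (X t w - X s w)%R])%E) &
      (forall s t, 0 <= s -> s <= t -> forall B : set R, measurable B ->
          P [set w | B (X t w - X s w)%R] = P [set w | B (X (t - s)%R w)])].

Definition exp_indep d (T : measurableType d) (R : realType)
    (P : probability T R) (X : R -> T -> R) (r : R) (e : T -> R) : Prop :=
  [/\ measurable_fun setT e,
      (forall t, 0 <= t -> P [set w | t < e w] = (expR (- (r * t)))%:E) &
      (forall (n : nat) (ts : 'I_n -> R) (Bs : 'I_n -> set R) (C : set R),
          (forall i, measurable (Bs i)) -> measurable C ->
          P ([set w | C (e w)] `&` [set w | forall i, Bs i (X (ts i) w)]) =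
          (P [set w | C (e w)] * P [set w | forall i, Bs i (X (ts i) w)])%E)].

Definition run_inf (R : realType) (T : Type) (X : R -> T -> R) (e : T -> R)
  (w : T) : R := inf [set X t w | t in `[0, e w]%classic].
Definition run_sup (R : realType) (T : Type) (X : R -> T -> R) (e : T -> R)
  (w : T) : R := sup [set X t w | t in `[0, e w]%classic].

(** Integrand of M_x(sigma, tau), started at x, with the convention that the
    payoff is 0 on {tau = +oo} (resp. {sigma = +oo}). *)
Definition dynkin_payoff (R : realType) (T : Type) (X : R -> T -> R) (r : R)
    (G1 G2 : R -> R) (x : R) (sigma tau : T -> \bar R) (w : T) : R :=
  (if (tau w != +oo%E) && (tau w <= sigma w)%E then
     expR (- (r * fine (tau w))) * G1 (x + X (fine (tau w)) w) else 0) +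
  (if (sigma w < tau w)%E then
     expR (- (r * fine (sigma w))) * G2 (x + X (fine (sigma w)) w) else 0).

Definition dynkin_M d (T : measurableType d) (R : realType)
    (P : probability T R) (X : R -> T -> R) (r : R) (G1 G2 : R -> R)
    (x : R) (sigma tau : T -> \bar R) : \bar R :=
  (\int[P]_w (dynkin_payoff X r G1 G2 x sigma tau w)%:E)%E.

Definition upper_value d (T : measurableType d) (R : realType)
    (P : probability T R) (F : R -> set (set T)) (X : R -> T -> R) (r : R)
    (G1 G2 : R -> R) (x : R) : \bar R :=
  ereal_inf [set ereal_sup [set dynkin_M P X r G1 G2 x sigma tau
                             | tau in stopping_time F]
            | sigma in stopping_time F].

Definition lower_value d (T : measurableType d) (R : realType)
    (P : probability T R) (F : R -> set (set T)) (X : R -> T -> R) (r : R)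
    (G1 G2 : R -> R) (x : R) : \bar R :=
  ereal_sup [set ereal_inf [set dynkin_M P X r G1 G2 x sigma tau
                             | sigma in stopping_time F]
            | tau in stopping_time F].

Definition integrability_limit d (T : measurableType d) (R : realType)
    (P : probability T R) (X : R -> T -> R) (r : R) (G : R -> R) : Prop :=
  forall x : R,
    (\int[P]_w ereal_sup [set ((`| expR (- (r * t)) * G (x + X t w) |)%R)%:E
                          | t in [set t : R | (0 <= t)%R]] < +oo)%E /\
    {ae P, forall w, expR (- (r * t)) * G (x + X t w) @[t --> +oo%R] --> 0}.

(** Hitting times inf{t >= 0 : x + X_t <= a} and inf{t >= 0 : x + X_t >= b}
    (inf of the empty set is +oo). *)
Definition hit_below (R : realType) (T : Type) (X : R -> T -> R) (x a : R)
  (w : T) : \bar R :=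
  ereal_inf [set t%:E | t in [set t | 0 <= t /\ x + X t w <= a]].
Definition hit_above (R : realType) (T : Type) (X : R -> T -> R) (x b : R)
  (w : T) : \bar R :=
  ereal_inf [set t%:E | t in [set t | 0 <= t /\ b <= x + X t w]].

Section Consts.
Context {R : realType}.
Definition cE (p q : R) : R := (1 - p) / q.
Definition cF_I (piI rI rS : R) : R := (rI + rS) / (rI + piI * rS).
Definition cF_S (piS rI rS : R) : R := (rI + rS) / (piS * rI + rS).

Definition game_equation (delta piI piS rI rS u : R) : Prop :=
  let EI := cE piI rI in let ES := cE piS rS in
  let FI := cF_I piI rI rS in let FS := cF_S piS rI rS in
  let GI := FI - 1 in let GS := FS - 1 in
  u - 2 * delta - EI - ES =
  (- (EI * FS * expR (rS * u)) - ES * FI * expR (rI * u) + 2 * ES * FS * GI) /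
  (expR ((rI + rS) * u) - GI * GS).

Definition coef_AI (piI piS rI rS u : R) : R :=
  let EI := cE piI rI in let ES := cE piS rS in
  let GI := cF_I piI rI rS - 1 in let GS := cF_S piS rI rS - 1 in
  (- (EI * expR (rS * u)) + ES * GI) / (expR ((rI + rS) * u) - GI * GS).

Definition coef_AS (piI piS rI rS u : R) : R :=
  let EI := cE piI rI in let ES := cE piS rS in
  let GI := cF_I piI rI rS - 1 in let GS := cF_S piS rI rS - 1 in
  (ES * expR (rI * u) - EI * GS) / (expR ((rI + rS) * u) - GI * GS).

Definition level_xI (delta piI piS rI rS u : R) : R :=
  - delta - cE piI rI + cF_I piI rI rS * coef_AS piI piS rI rS u.
Definition level_xS (delta piI piS rI rS u : R) : R :=
  delta + cE piS rS + cF_S piS rI rS * coef_AI piI piS rI rS u.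

Definition value_fun (delta piI piS rI rS u x : R) : R :=
  let xI := level_xI delta piI piS rI rS u in
  let xS := level_xS delta piI piS rI rS u in
  if x <= xI then x + delta
  else if x <= xS then
    coef_AI piI piS rI rS u * expR (- (rI * (x - xS))) +
    coef_AS piI piS rI rS u * expR (rS * (x - xI))
  else x - delta.
End Consts.

(* Main.v *)
(** Let [qS y = (y - xS) + FS AI (1 - e^{-rI (y - xS)})] for [y >= xS] and [qS y = 0] for
    [y <= xS], and let [qI] be the analogue for the process [-X] started at [-x] with
    barrier [-xI].  The laws of [S] and [-I] give [V x = gS x - gI (- x)], where
    [gS x = E qS (x + S)] and [gI x = E qI (x - I)].  For any choice of [u > 0] the function
    [qS] is nonnegative, nondecreasing and zero below [xS]; splitting the supremum over
    [[0, e_r]] at a stopping time and using the lack of memory of [e_r] shows that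
    [e^{-rt} gS (X_t)] is a supermartingale, and a martingale up to [tau*].  The same holds for
    [gI], [-X] and [sigma*], so [e^{-rt} V (X_t)] is a supermartingale up to [sigma*] and a
    submartingale up to [tau*].  With [G1 <= V <= G2], [V = G2] on [(-oo, xI]] and [V = G1] on
    [[xS, +oo)], this is the saddle point property.

    The horizon [e_r] need not be independent of the filtration, so the splitting is done at
    deterministic times: on the grid [h N] it only needs independence of the one-step
    increments, and [h -> 0] is handled by Fatou's lemma and dominated convergence.

    The equation for [u] reads [xS - xI = u]; it has a solution by the intermediate value
    theorem, and only one because the value [V] of the game determines [xI] and [xS] as the
    ends of [{V = G2}] and [{V = G1}]. *)
Require Import Defs.
From HB Require Import structures.
From mathcomp Require Import all_boot all_order all_algebra.
From mathcomp Require Import all_classical all_reals all_analysis.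
From mathcomp Require Import measurable_realfun ring lra.
Import Order.TTheory GRing.Theory Num.Theory.
Import numFieldNormedType.Exports.
Local Open Scope classical_set_scope.
Local Open Scope ring_scope.
Set Implicit Arguments.
Unset Strict Implicit.
Unset Printing Implicit Defensive.

(** * The constants of the game *)

Section elementary.
Context {R : realType}.
Implicit Types (delta p q a b u x : R).

(** In the arithmetic part [p], [q], [a], [b] stand for [pi_I], [pi_S], [r_I], [r_S]. The reflection
    [x -> -x] swaps the players and the pairs [(p, a)], [(q, b)]; thus [coef_AS q p b a u] is
    [- A_I], and each estimate is proved on one side only. The inequality [F_I A_S <= E_S]
    ([coef_AS_le]) carries most of the arithmetic: it gives the lower end of the bracket for the
    root, makes the one-sided payoffs nondecreasing, and bounds the slope of [V] at both ends of
    [[x_I, x_S]] by 1, from which [V <= G2] follows.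

    The laws of [S] and [-I] are known only through their transforms. The values at nonpositive
    integers suffice: for [S] they are the moments of [e^{-S}], which lies in [(0, 1]], and
    Bernstein polynomials turn them into means of continuous functions.

    The hitting times of closed half-lines have to be shown to be stopping times. Right-continuity
    of the filtration only settles open half-lines; the difference is a null event because [S] and
    [-I] have no atom on [(0, +oo)]. *)

Definition game_den p q a b u : R :=
  expR ((a + b) * u) - (cF_I p a b - 1) * (cF_S q a b - 1).

(** Convexity of the exponential between [0] and [(a + b) u], at the point [a u]: the tangent bounds
    at [a u] for the two ends are added with weights [a] and [b]. *)
Lemma expR_tangent a b u : 0 < a -> 0 < b ->
  (a + b) * expR (a * u) <= a * (expR (a * u) * expR (b * u)) + b.
Proof.
move=> a0 b0.
have h1 := expR_ge1Dx (b * u).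
have h2 := expR_ge1Dx (- (a * u)).
have e0 := expR_gt0 (a * u).
have eN : expR (a * u) * expR (- (a * u)) = 1 by rewrite -expRD subrr expR0.
move: h1 h2 e0 eN.
set y := expR (a * u); set z := expR (b * u); set w := expR (- (a * u)).
move=> h1 h2 e0 eN.
rewrite -subr_ge0 (_ : _ - _ = y * (a * (z - (1 + b * u)) + b * (w - (1 - a * u)))); last first.
  transitivity (a * (y * z) + b * (y * w) - (a + b) * y); first by rewrite eN; ring.
  by ring.
by rewrite mulr_ge0 ?(ltW e0)// addr_ge0// mulr_ge0 ?(ltW a0) ?(ltW b0)// subr_ge0.
Qed.

Lemma cF_I_den_gt0 p a b : 0 <= p < 1 -> 0 < a -> 0 < b -> 0 < a + p * b.
Proof. by move=> /andP[p0 _] a0 b0; rewrite ltr_wpDr ?mulr_ge0// ltW. Qed.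

Lemma cF_S_den_gt0 q a b : 0 <= q < 1 -> 0 < a -> 0 < b -> 0 < q * a + b.
Proof. by move=> /andP[p0 _] a0 b0; rewrite ltr_wpDl ?mulr_ge0// ltW. Qed.

Lemma cF_I_subr1 p a b : 0 <= p < 1 -> 0 < a -> 0 < b ->
  cF_I p a b - 1 = b * (1 - p) / (a + p * b).
Proof.
move=> p01 a0 b0; have := cF_I_den_gt0 p01 a0 b0 => d0.
by rewrite /cF_I; field; rewrite gt_eqF.
Qed.

Lemma cF_S_subr1 q a b : 0 <= q < 1 -> 0 < a -> 0 < b ->
  cF_S q a b - 1 = a * (1 - q) / (q * a + b).
Proof.
move=> p01 a0 b0; have := cF_S_den_gt0 p01 a0 b0 => d0.
by rewrite /cF_S; field; rewrite gt_eqF.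
Qed.

Lemma expR_mul_gt1 a u : 0 < a -> 0 < u -> 1 < expR (a * u).
Proof. by move=> a0 u0; rewrite expR_gt1 mulr_gt0. Qed.

(** This keeps the denominator of [A_I] and [A_S] positive for every [u > 0]. Equality occurs for
    [p = q = 0], so the strictness has to come from [u > 0]. *)
Lemma cF_subr1_le1 p q a b : 0 <= p < 1 -> 0 <= q < 1 -> 0 < a -> 0 < b ->
  (cF_I p a b - 1) * (cF_S q a b - 1) <= 1.
Proof.
move=> hp hq a0 b0; have dI := cF_I_den_gt0 hp a0 b0; have dS := cF_S_den_gt0 hq a0 b0.
rewrite cF_I_subr1// cF_S_subr1//.
rewrite mulrACA -invfM ler_pdivrMr ?mulr_gt0// mul1r.
move: hp hq => /andP[p0 p1] /andP[q0 q1].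
have pq : 0 <= p * q by rewrite mulr_ge0.
have h1 : 0 <= q * a * a by rewrite !mulr_ge0 // ltW.
have h2 : 0 <= p * b * b by rewrite !mulr_ge0 // ltW.
have h3 : 0 <= p * (a * b) by rewrite !mulr_ge0 // ltW.
have h4 : 0 <= q * (a * b) by rewrite !mulr_ge0 // ltW.
rewrite -subr_ge0 (_ : _ - _ = q * a * a + p * b * b + p * (a * b) + q * (a * b))//.
  by rewrite !addr_ge0.
by ring.
Qed.

Lemma game_den_gt0 p q a b u : 0 <= p < 1 -> 0 <= q < 1 -> 0 < a -> 0 < b ->
  0 < u -> 0 < game_den p q a b u.
Proof.
move=> hp hq a0 b0 u0; rewrite subr_gt0.
by apply: (le_lt_trans (cF_subr1_le1 hp hq a0 b0)); rewrite expR_mul_gt1 ?addr_gt0.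
Qed.

(** The numerator is positive because [E_I G_S = (1 - p) (1 - q) / (q a + b) <= E_S] while
    [e^{a u} > 1]. *)
Lemma coef_AS_gt0 p q a b u : 0 <= p < 1 -> 0 <= q < 1 -> 0 < a -> 0 < b ->
  0 < u -> 0 < coef_AS p q a b u.
Proof.
move=> hp hq a0 b0 u0.
rewrite /coef_AS divr_gt0//; last exact: game_den_gt0.
have dS := cF_S_den_gt0 hq a0 b0.
rewrite cF_S_subr1// /cE.
have -> : (1 - p) / a * (a * (1 - q) / (q * a + b)) = (1 - p) * ((1 - q) / (q * a + b)).
  by field; rewrite !gt_eqF.
move: hp hq => /andP[p0 p1] /andP[q0 q1].
rewrite subr_gt0 (@le_lt_trans _ _ ((1 - q) / b))//; last first.
  by rewrite ltr_pMr ?expR_mul_gt1 // divr_gt0// subr_gt0.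
rewrite (@le_trans _ _ ((1 - q) / (q * a + b)))//.
  rewrite ler_piMl//; last by lra.
  by rewrite divr_ge0 ?(ltW dS)// subr_ge0 ltW.
by rewrite ler_pM2l ?subr_gt0// lef_pV2 ?posrE// lerDr mulr_ge0// ltW.
Qed.

(** Once denominators are cleared, [E_S - F_I A_S] is a nonnegative combination of the convexity gap
    of [expR_tangent] and of [e^{(a + b) u} - 1]. *)
Lemma coef_AS_le p q a b u : 0 <= p < 1 -> 0 <= q < 1 -> 0 < a -> 0 < b ->
  0 < u -> cF_I p a b * coef_AS p q a b u <= cE q b.
Proof.
move=> hp hq a0 b0 u0.
have dS := cF_S_den_gt0 hq a0 b0; have dI := cF_I_den_gt0 hp a0 b0.
have D0 := game_den_gt0 hp hq a0 b0 u0.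
rewrite /coef_AS mulrA ler_pdivrMr//.
have t := expR_tangent u a0 b0.
have y1 : 1 <= expR (a * u) * expR (b * u).
  by rewrite -expRD -mulrDl ltW// expR_mul_gt1 // addr_gt0.
move: D0; rewrite /game_den cF_S_subr1// cF_I_subr1// mulrDl expRD /cE /cF_I => _.
move: hp hq => /andP[p0 p1] /andP[q0 q1].
set y := expR (a * u) in t y1 *; set z := expR (b * u) in t y1 *.
rewrite -subr_ge0.
rewrite (_ : _ - _ = (1 - q) / (b * (a + p * b) * (q * a + b)) *
  ((q * a + b) * (a * (y * z) + b - (a + b) * y) +
   p * b * (q * a + b) * (y * z - 1))); last first.
  by field; rewrite ?gt_eqF.
rewrite mulr_ge0//.
  by rewrite divr_ge0 ?subr_ge0 ?(ltW q1)// !mulr_ge0// ltW.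
by rewrite addr_ge0// !mulr_ge0// ?subr_ge0// ltW.
Qed.

Lemma coef_AI_swap p q a b u : coef_AI p q a b u = - coef_AS q p b a u.
Proof.
rewrite /coef_AI /coef_AS /cF_I /cF_S.
rewrite (addrC b a) (addrC b (q * a)) (addrC (p * b) a).
rewrite (mulrC ((a + b) / (q * a + b) - 1)).
by rewrite -[RHS]mulNr; congr (_ / _); ring.
Qed.

Lemma cF_swap p a b : cF_I p a b = cF_S p b a.
Proof. by rewrite /cF_I /cF_S addrC [a + p * b]addrC. Qed.

Lemma level_swap d p q a b u : level_xS d p q a b u = - level_xI d q p b a u.
Proof. by rewrite /level_xS /level_xI coef_AI_swap cF_swap; ring. Qed.

(** This is continuity of [V] at [x_S]: it rewrites [x_S - delta = A_I + A_S e^{r_S u}] with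
    [x_S = delta + E_S + F_S A_I]. *)
Lemma coef_match p q a b u : 0 <= p < 1 -> 0 <= q < 1 -> 0 < a -> 0 < b ->
  0 < u ->
  cE q b + coef_AI p q a b u * (cF_S q a b - 1) =
  coef_AS p q a b u * expR (b * u).
Proof.
move=> hp hq a0 b0 u0.
have := game_den_gt0 hp hq a0 b0 u0.
rewrite /game_den /coef_AI /coef_AS mulrDl expRD => D0.
by field; rewrite gt_eqF.
Qed.

Lemma game_equationE delta p q a b u :
  0 <= p < 1 -> 0 <= q < 1 -> 0 < a -> 0 < b ->
  game_equation delta p q a b u <->
  level_xS delta p q a b u - level_xI delta p q a b u = u.
Proof.
move=> hp hq a0 b0.
have dS := cF_S_den_gt0 hq a0 b0; have dI := cF_I_den_gt0 hp a0 b0.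
rewrite /game_equation /level_xS /level_xI /coef_AS /coef_AI.
set D := (_ - _ : R)^-1; set yS := expR (b * u); set yI := expR (a * u).
have E : (- (cE p a * cF_S q a b * yS) - cE q b * cF_I p a b * yI +
   2 * cE q b * cF_S q a b * (cF_I p a b - 1)) * D =
   cF_S q a b * ((- (cE p a * yS) + cE q b * (cF_I p a b - 1)) * D) -
   cF_I p a b * ((cE q b * yI - cE p a * (cF_S q a b - 1)) * D).
  (* The factor 2 in the equation rests on [E_S F_S G_I = E_I F_I G_S]; expressing [E_S] and [E_I]
     through [G_S] and [G_I] reduces this to an identity of fractions. *)
  have -> : cE q b = (q * a + b) * (cF_S q a b - 1) / (a * b).
    by rewrite cF_S_subr1// /cE; field; rewrite ?gt_eqF.
  have -> : cE p a = (a + p * b) * (cF_I p a b - 1) / (a * b).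
    by rewrite cF_I_subr1// /cE; field; rewrite ?gt_eqF.
  by rewrite /cF_S /cF_I; field; rewrite ?gt_eqF.
by rewrite E; split => h; lra.
Qed.

End elementary.

(** * Existence of [u], and the split of [V] into two one-sided functions *)

Section value_shape.
Context {R : realType}.
Implicit Types (delta p q a b u x : R).

Lemma game_equation_solvable delta p q a b : 0 < delta ->
  0 <= p < 1 -> 0 <= q < 1 -> 0 < a -> 0 < b ->
  exists2 u, 0 < u & game_equation delta p q a b u.
Proof.
move=> d0 hp hq a0 b0.
pose f u : R := u - (level_xS delta p q a b u - level_xI delta p q a b u).
(* For [u > 0] the two brackets lie in [[0, E_I]] and [[0, E_S]]. Hence [f] is nonpositive at
   [2 delta] and nonnegative at [u1 = 2 delta + E_I + E_S]. *)
have fE u : f u = u - 2 * delta - (cE p a - cF_S q a b * coef_AS q p b a u)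
                   - (cE q b - cF_I p a b * coef_AS p q a b u).
  by rewrite /f /level_xS /level_xI coef_AI_swap; ring.
pose u1 : R := 2 * delta + cE p a + cE q b.
have E1 : 0 <= cE p a by rewrite divr_ge0 ?(ltW a0)// subr_ge0; lra.
have E2 : 0 <= cE q b by rewrite divr_ge0 ?(ltW b0)// subr_ge0; lra.
have l2 : 0 < 2 * delta by lra.
have FS0 : 0 < cF_S q a b by rewrite divr_gt0 ?(cF_S_den_gt0 hq)// addr_gt0.
have FI0 : 0 < cF_I p a b by rewrite divr_gt0 ?(cF_I_den_gt0 hp)// addr_gt0.
have f1 : f (2 * delta) <= 0.
  have := coef_AS_le hp hq a0 b0 l2; have := coef_AS_le hq hp b0 a0 l2.
  by rewrite fE (cF_swap q b a); lra.
have f2 : 0 <= f u1.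
  have u10 : 0 < u1 by rewrite /u1; lra.
  have := mulr_gt0 FI0 (coef_AS_gt0 hp hq a0 b0 u10).
  have := mulr_gt0 FS0 (coef_AS_gt0 hq hp b0 a0 u10).
  by rewrite fE => h1 h2; rewrite {1}/u1; lra.
have le1 : 2 * delta <= u1 by rewrite /u1; lra.
have cf : {within `[2 * delta, u1], continuous f}.
  apply: continuous_in_subspaceT => u; rewrite inE/= in_itv/= => /andP[u0 _].
  have {}u0 : 0 < u by lra.
  have D0 : expR ((a + b) * u) - (cF_I p a b - 1) * (cF_S q a b - 1) != 0.
    by rewrite gt_eqF// game_den_gt0.
  have ce (k : R) : {for u, continuous (fun v : R => expR (k * v))}.
    apply: continuous_comp; last exact: continuous_expR.
    by apply: cvgM; [exact: cvg_cst|exact: cvg_id].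
  have cD : (expR ((a + b) * v) - (cF_I p a b - 1) * (cF_S q a b - 1))^-1 @[v --> u]
     --> (expR ((a + b) * u) - (cF_I p a b - 1) * (cF_S q a b - 1))^-1.
    by apply: cvgV => //; apply: cvgB; [exact: ce|exact: cvg_cst].
  rewrite /f /level_xS /level_xI /coef_AS /coef_AI.
  apply: cvgB; first exact: cvg_id.
  apply: cvgB; apply: cvgD; try exact: cvg_cst.
  - apply: cvgM; first exact: cvg_cst.
    apply: cvgM => //; apply: cvgD; last exact: cvg_cst.
    by apply: cvgN; apply: cvgM; [exact: cvg_cst|exact: ce].
  - apply: cvgM; first exact: cvg_cst.
    apply: cvgM => //; apply: cvgB; last exact: cvg_cst.
    by apply: cvgM; [exact: cvg_cst|exact: ce].
have : Num.min (f (2 * delta)) (f u1) <= 0 <= Num.max (f (2 * delta)) (f u1).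
  by rewrite ge_min f1 le_max f2 orbT.
move=> /(IVT le1 cf)[u]; rewrite in_itv/= => /andP[u0 _] fu.
exists u; first by lra.
by apply/(game_equationE _ _ hp hq a0 b0); move: fu; rewrite /f; lra.
Qed.

(** The strict form matters: it yields [V < G2] to the right of [x_I], which is how [V] later
    determines [x_I]. *)
Lemma expR_strict_convex (v l : R) : v != 0 -> 0 < l < 1 ->
  expR (l * v) < 1 - l + l * expR v.
Proof.
move=> v0 /andP[l0 l1].
have e0 := expR_gt0 (l * v).
have h1 : 1 - l * v < expR (- (l * v)).
  by apply: expR_gt1Dx; rewrite oppr_eq0 mulf_neq0// gt_eqF.
have h2 : 1 + (1 - l) * v < expR ((1 - l) * v).
  by apply: expR_gt1Dx; rewrite mulf_neq0// gt_eqF// subr_gt0.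
have eN : expR (l * v) * expR (- (l * v)) = 1 by rewrite -expRD subrr expR0.
have eD : expR v = expR (l * v) * expR ((1 - l) * v) by rewrite -expRD; congr expR; ring.
rewrite eD; move: h1 h2 eN e0.
set y := expR (l * v); set w := expR (- (l * v)); set z := expR ((1 - l) * v).
move=> h1 h2 eN e0.
rewrite -subr_gt0 (_ : _ - _ =
  y * ((1 - l) * (w - (1 - l * v)) + l * (z - (1 + (1 - l) * v)))); last first.
  transitivity ((1 - l) * (y * w) + l * (y * z) - y); first by rewrite eN; ring.
  by ring.
by rewrite mulr_gt0// addr_gt0// mulr_gt0 ?subr_gt0.
Qed.

(* [psi] below vanishes at [0]; its derivative is concave and nonnegative at both ends
   of [[0, u]]. *)
Lemma affine_gap_gt0 a b u (A B t : R) : 0 < a -> 0 < b -> 0 < A -> 0 < B ->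
  a * A + b * B <= 1 -> a * A * expR (a * u) + b * B * expR (- (b * u)) <= 1 ->
  0 < t <= u -> 0 < t - A * (expR (a * t) - 1) - B * (1 - expR (- (b * t))).
Proof.
move=> a0 b0 A0 B0 h0 hu /andP[t0 tu].
pose psi (s : R) := s - A * (expR (a * s) - 1) - B * (1 - expR (- (b * s))).
pose dpsi (s : R) : R := 1 - A * (a * expR (a * s)) - B * (b * expR (- (b * s))).
have d (s : R) : is_derive s (1 : R) psi (dpsi s).
  rewrite /psi /dpsi; apply: is_derive_eq.
  by rewrite /GRing.scale/=; ring.
have c : {within `[0, t], continuous psi}.
  apply: derivable_within_continuous => s _.
  by have [] := d s.
have [s] := MVT t0 (fun s _ => d s) c.
rewrite in_itv/= => /andP[s0 st].
have -> : psi 0 = 0 by rewrite /psi !mulr0 oppr0 expR0; ring.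
rewrite !subr0 -/(psi t) => ->.
rewrite mulr_gt0// /dpsi.
have u0 : 0 < u by apply: lt_le_trans tu.
have l01 : 0 < s / u < 1.
  by rewrite divr_gt0//= ltr_pdivrMr// mul1r (lt_le_trans st).
have e1 : expR (a * s) < 1 - s / u + s / u * expR (a * u).
  have := @expR_strict_convex (a * u) _ _ l01.
  rewrite (_ : s / u * (a * u) = a * s); last by field; rewrite gt_eqF.
  by apply; rewrite mulf_neq0// gt_eqF.
have e2 : expR (- (b * s)) < 1 - s / u + s / u * expR (- (b * u)).
  have := @expR_strict_convex (- (b * u)) _ _ l01.
  rewrite (_ : s / u * (- (b * u)) = - (b * s)); last by field; rewrite gt_eqF.
  by apply; rewrite oppr_eq0 mulf_neq0// gt_eqF.
move: l01 e1 e2 hu; set l := s / u.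
set e1 := expR _; set e1' := expR _; set e2 := expR _; set e2' := expR _.
move=> /andP[l0 l1] h1 h2 hu.
have := ltr_pM2l (mulr_gt0 a0 A0) e1 (1 - l + l * e1'); rewrite h1 => k1.
have := ltr_pM2l (mulr_gt0 b0 B0) e2 (1 - l + l * e2'); rewrite h2 => k2.
have k3 : l * (a * A * e1' + b * B * e2') <= l * 1 by rewrite ler_pM2l.
have k4 : (1 - l) * (a * A + b * B) <= (1 - l) * 1 by rewrite ler_pM2l// subr_gt0.
have -> : 1 - A * (a * e1) - B * (b * e2) = 1 - (a * A * e1 + b * B * e2) by ring.
rewrite subr_gt0; apply: (@lt_le_trans _ _ (l * 1 + (1 - l) * 1)); last by lra.
apply: lt_le_trans (lerD k3 k4).
apply: lt_le_trans (ltrD k1 k2) _.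
by rewrite le_eqVlt; apply/orP; left; apply/eqP; ring.
Qed.

(* Smooth pasting up to the atom of the supremum: this says [V' <= 1] at [x_S-]. *)
Lemma slope_match p q a b u : 0 <= p < 1 -> 0 <= q < 1 -> 0 < a -> 0 < b -> 0 < u ->
  a * coef_AS q p b a u + b * (coef_AS p q a b u * expR (b * u)) <= 1.
Proof.
move=> hp hq a0 b0 u0.
have dS := cF_S_den_gt0 hq a0 b0.
rewrite -coef_match// coef_AI_swap cF_S_subr1//.
have := coef_AS_le hq hp b0 a0 u0; rewrite (cF_swap q b a) /cE ler_pdivlMr//.
rewrite /cF_S; set C := coef_AS q p b a u => h.
have -> : a * C + b * ((1 - q) / b + - C * (a * (1 - q) / (q * a + b))) =
  1 - q + q * ((a + b) / (q * a + b) * C * a).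
  by field; rewrite !gt_eqF.
have q0 : 0 <= q by case/andP: hq.
have : q * ((a + b) / (q * a + b) * C * a) <= q * (1 - p) by rewrite ler_wpM2l.
have : 0 <= q * p by rewrite mulr_ge0//; case/andP: hp.
lra.
Qed.

(* [E q (x + S)] as a function of [y = x - b], for the payoff
   [q x = y + c (1 - e^{-rho y})] on [y >= 0] (and [0] on [y <= 0]) and
   [S ~ p delta_0 + (1 - p) Exp(s)]. *)
Definition excessive_fun p (s rho c y : R) : R :=
  if y <= 0 then (1 - p) * (s^-1 + c * rho / (s + rho)) * expR (s * y)
  else y + cE p s + c - c * ((p * rho + s) / (rho + s)) * expR (- (rho * y)).

(** The constant [c = F_S A_I] of the first term is chosen so that above [x_S] its exponential has
    coefficient [- A_I] and cancels against the second term, leaving [x - delta]; below [x_S] the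
    first term is [A_S e^{r_S (x - x_I)}]. The second term is the mirror image. *)
Lemma value_fun_split delta p q a b u x :
  0 <= p < 1 -> 0 <= q < 1 -> 0 < a -> 0 < b -> 0 < u ->
  game_equation delta p q a b u ->
  value_fun delta p q a b u x =
  excessive_fun q b a (- (cF_S q a b * coef_AS q p b a u)) (x - level_xS delta p q a b u)
  - excessive_fun p a b (- (cF_I p a b * coef_AS p q a b u))
     (level_xI delta p q a b u - x).
Proof.
move=> hp hq a0 b0 u0 /(game_equationE _ _ hp hq a0 b0) Eu.
have dS := cF_S_den_gt0 hq a0 b0; have dI := cF_I_den_gt0 hp a0 b0.
have Econst : (1 - q) * (b^-1 + - (cF_S q a b * coef_AS q p b a u) * a / (b + a)) =
   coef_AS p q a b u * expR (b * u).
  rewrite -coef_match// coef_AI_swap cF_S_subr1// /cE /cF_S.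
  by field; rewrite !gt_eqF// addr_gt0.
have Econst' : (1 - p) * (a^-1 + - (cF_I p a b * coef_AS p q a b u) * b / (a + b)) =
   coef_AS q p b a u * expR (a * u).
  rewrite -[RHS]coef_match// coef_AI_swap cF_S_subr1// /cE /cF_I.
  have dI' : 0 < p * b + a by rewrite addrC.
  by field; rewrite !gt_eqF// addr_gt0.
have E1 : - (cF_S q a b * coef_AS q p b a u) * ((q * a + b) / (a + b)) =
   - coef_AS q p b a u.
  by rewrite /cF_S; field; rewrite !gt_eqF// addr_gt0.
have E2 : - (cF_I p a b * coef_AS p q a b u) * ((p * b + a) / (b + a)) =
   - coef_AS p q a b u.
  by rewrite /cF_I; field; rewrite !gt_eqF// addr_gt0.
rewrite /value_fun /excessive_fun Econst Econst' E1 E2 coef_AI_swap.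
rewrite -!(mulrA _ (expR _) (expR _)) -!expRD.
move: Eu; set xS := level_xS _ _ _ _ _ _; set xI := level_xI _ _ _ _ _ _ => Eu.
have Eb : b * u = b * (xS - xI) by rewrite Eu.
have Ea : a * u = a * (xS - xI) by rewrite Eu.
rewrite !subr_le0.
have E3 : coef_AS q p b a u * expR (a * u) =
    cE p a - coef_AS p q a b u * (cF_I p a b - 1).
  by rewrite -[LHS]coef_match// coef_AI_swap -(cF_swap p a b) mulNr.
have F1 : b * u + b * (x - xS) = b * (x - xI) by rewrite Eb; ring.
have F2 : a * u + a * (xI - x) = - (a * (x - xS)) by rewrite Ea; ring.
have F3 : - (b * (xI - x)) = b * (x - xI) by ring.
rewrite F1 F2 F3.
have [xxI|xIx] := leP x xI.
  rewrite (_ : x <= xS); last by lra.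
  (* At [x = x_I] the two sides are given by different branches; [E3], the continuity of [V] there,
     reconciles them. *)
  have -> : (xI <= x) = (x == xI) by rewrite eq_le xxI.
  case: eqVneq => [xE|xne]; last first.
    by rewrite /xI /level_xI; ring.
  rewrite xE subrr mulr0 expR0 mulr1.
  have -> : - (a * (xI - xS)) = a * u by rewrite Ea; ring.
  by rewrite [coef_AS q p b a u * _]E3 /xI /level_xI; ring.
rewrite (ltW xIx).
have [xxS|xSx] := leP x xS; first by ring.
by rewrite /xS /level_xS coef_AI_swap; ring.
Qed.

End value_shape.

(** * The bounds [G1 <= V <= G2], strict away from the stopping regions *)

Section value_bounds.
Context {R : realType}.
Implicit Types (delta p q a b u x : R).

(** On [(x_I, x_S]] the gap [x + delta - V x] is the function of [affine_gap_gt0] at [t = x - x_I],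
    with [A_S] for [A] and [- A_I e^{r_I u}] for [B]. Its two slope conditions are [V' <= 1] at
    [x_I+] and at [x_S-], that is [slope_match] for the reflected and the original data. *)
Lemma value_fun_lt_G2 delta p q a b u x : 0 < delta ->
  0 <= p < 1 -> 0 <= q < 1 -> 0 < a -> 0 < b -> 0 < u ->
  game_equation delta p q a b u -> level_xI delta p q a b u < x ->
  value_fun delta p q a b u x < x + delta.
Proof.
move=> d0 hp hq a0 b0 u0 Hu; rewrite /value_fun/=.
set xI := level_xI _ _ _ _ _ _; set xS := level_xS _ _ _ _ _ _ => xIx.
rewrite leNgt xIx/=; have [xxS|xSx] := leP x xS; last by lra.
have Eu : xS - xI = u by apply/(game_equationE _ _ hp hq a0 b0).
have A0 := coef_AS_gt0 hp hq a0 b0 u0.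
have B0 := mulr_gt0 (coef_AS_gt0 hq hp b0 a0 u0) (expR_gt0 (a * u)).
have eN : expR (a * u) * expR (- (a * u)) = 1 by rewrite -expRD subrr expR0.
have := @affine_gap_gt0 _ b a u _ _ (x - xI) b0 a0 A0 B0.
rewrite (slope_match hq hp b0 a0 u0).
have -> : b * coef_AS p q a b u * expR (b * u) +
   a * (coef_AS q p b a u * expR (a * u)) * expR (- (a * u)) <= 1.
  have := slope_match hp hq a0 b0 u0.
  rewrite (_ : a * (_ * _) * _ = a * coef_AS q p b a u * (expR (a * u) * expR (- (a * u)))).
    by rewrite eN; lra.
  by ring.
have -> : 0 < x - xI <= u by rewrite subr_gt0 xIx/= -Eu lerB.
move=> /(_ isT isT isT).
have m : coef_AS q p b a u * expR (a * u) =
    cE p a - coef_AS p q a b u * (cF_I p a b - 1).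
  by rewrite -[LHS]coef_match// coef_AI_swap -(cF_swap p a b) mulNr.
have e1 : expR (- (a * (x - xS))) = expR (a * u) * expR (- (a * (x - xI))).
  by rewrite -expRD -Eu; congr expR; ring.
rewrite e1 coef_AI_swap => h.
have ex : xI = - delta - cE p a + cF_I p a b * coef_AS p q a b u by [].
move: h m; set C := coef_AS q p b a u; set D := coef_AS p q a b u in ex *.
set y := expR (a * u); set z := expR (- _); set w := expR (b * _).
by move=> h m; lra.
Qed.

End value_bounds.

Section value_bounds_reflect.
Context {R : realType}.
Implicit Types (delta p q a b u x : R).

Lemma game_equation_swap delta p q a b u :
  0 <= p < 1 -> 0 <= q < 1 -> 0 < a -> 0 < b -> 0 < u ->
  game_equation delta p q a b u ->
  game_equation delta q p b a u.
Proof.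
move=> hp hq a0 b0 u0 Hu; apply/(game_equationE _ _ hq hp b0 a0).
move: Hu => /(game_equationE _ _ hp hq a0 b0).
by rewrite [level_xS _ p _ _ _ _]level_swap [level_xS _ q _ _ _ _]level_swap; lra.
Qed.

(** In the split form the reflection merely exchanges the two one-sided terms. *)
Lemma value_fun_reflect delta p q a b u x :
  0 <= p < 1 -> 0 <= q < 1 -> 0 < a -> 0 < b -> 0 < u ->
  game_equation delta p q a b u ->
  value_fun delta p q a b u x = - value_fun delta q p b a u (- x).
Proof.
move=> hp hq a0 b0 u0 Hu; rewrite !value_fun_split//; last exact: game_equation_swap.
rewrite !cF_swap [level_xS _ p _ _ _ _]level_swap [level_xS _ q _ _ _ _]level_swap.
rewrite !opprK opprB; congr (excessive_fun _ _ _ _ _ - excessive_fun _ _ _ _ _).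
  by rewrite addrC.
by rewrite addrC.
Qed.

Lemma value_fun_gt_G1 delta p q a b u x : 0 < delta ->
  0 <= p < 1 -> 0 <= q < 1 -> 0 < a -> 0 < b -> 0 < u ->
  game_equation delta p q a b u ->
  x < level_xS delta p q a b u ->
  x - delta < value_fun delta p q a b u x.
Proof.
move=> d0 hp hq a0 b0 u0 Hu; rewrite level_swap => h; rewrite value_fun_reflect//.
have Hu' := game_equation_swap hp hq a0 b0 u0 Hu.
have := @value_fun_lt_G2 _ delta q p b a u (- x) d0 hq hp b0 a0 u0 Hu'.
by rewrite ltrNr => /(_ h); lra.
Qed.

Lemma value_fun_le delta p q a b u x : x <= level_xI delta p q a b u ->
  value_fun delta p q a b u x = x + delta.
Proof. by rewrite /value_fun/= => ->. Qed.

Lemma value_fun_ge delta p q a b u x :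
  0 <= p < 1 -> 0 <= q < 1 -> 0 < a -> 0 < b -> 0 < u ->
  game_equation delta p q a b u -> level_xS delta p q a b u <= x ->
  value_fun delta p q a b u x = x - delta.
Proof.
move=> hp hq a0 b0 u0 Hu; rewrite level_swap => h.
rewrite value_fun_reflect// value_fun_le; first by ring.
by rewrite lerNl.
Qed.

Lemma value_fun_leG2 delta p q a b u x : 0 < delta ->
  0 <= p < 1 -> 0 <= q < 1 -> 0 < a -> 0 < b -> 0 < u ->
  game_equation delta p q a b u ->
  value_fun delta p q a b u x <= x + delta.
Proof.
move=> d0 hp hq a0 b0 u0 Hu.
have [h|h] := leP x (level_xI delta p q a b u); first by rewrite value_fun_le.
exact/ltW/value_fun_lt_G2.
Qed.

Lemma value_fun_geG1 delta p q a b u x : 0 < delta ->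
  0 <= p < 1 -> 0 <= q < 1 -> 0 < a -> 0 < b -> 0 < u ->
  game_equation delta p q a b u ->
  x - delta <= value_fun delta p q a b u x.
Proof.
move=> d0 hp hq a0 b0 u0 Hu.
have [h|h] := ltP x (level_xS delta p q a b u); last by rewrite value_fun_ge.
exact/ltW/value_fun_gt_G1.
Qed.

End value_bounds_reflect.

Lemma value_fun_inj (R : realType) (delta p q a b u v : R) :
  0 < delta -> 0 <= p < 1 -> 0 <= q < 1 -> 0 < a -> 0 < b -> 0 < u -> 0 < v ->
  game_equation delta p q a b u -> game_equation delta p q a b v ->
  value_fun delta p q a b u =1 value_fun delta p q a b v -> u = v.
Proof.
move=> d0 hp hq a0 b0 u0 v0 Hu Hv e.
have EI : level_xI delta p q a b u = level_xI delta p q a b v.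
  apply/eqP; rewrite eq_le; apply/andP; split; rewrite leNgt; apply/negP => h.
    by have := value_fun_lt_G2 d0 hp hq a0 b0 v0 Hv h; rewrite -e value_fun_le// ltxx.
  by have := value_fun_lt_G2 d0 hp hq a0 b0 u0 Hu h; rewrite e value_fun_le// ltxx.
have ES : level_xS delta p q a b u = level_xS delta p q a b v.
  apply/eqP; rewrite eq_le; apply/andP; split; rewrite leNgt; apply/negP => h.
    have := value_fun_gt_G1 d0 hp hq a0 b0 u0 Hu h.
    by rewrite e (value_fun_ge hp hq a0 b0 v0 Hv)// ltxx.
  have := value_fun_gt_G1 d0 hp hq a0 b0 v0 Hv h.
  by rewrite -e (value_fun_ge hp hq a0 b0 u0 Hu)// ltxx.
move: Hu Hv => /(game_equationE _ _ hp hq a0 b0) <- /(game_equationE _ _ hp hq a0 b0) <-.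
by rewrite EI ES.
Qed.

(** * Laplace transforms and the law of the supremum *)

Section bernstein.
Context {R : realType}.

(* The Bernstein polynomial [\sum_k 'C(n, k) z^k (1 - z)^(n - k) phi k], defined by
   conditioning on the first of [n] Bernoulli trials. *)
Fixpoint bernstein (n : nat) (phi : nat -> R) : {poly R} :=
  if n is m.+1 then 'X * bernstein m (phi \o S) + (1 - 'X) * bernstein m phi
  else (phi 0%N)%:P.

Lemma bernsteinS n (phi : nat -> R) z : (bernstein n.+1 phi).[z] =
  z * (bernstein n (phi \o S)).[z] + (1 - z) * (bernstein n phi).[z].
Proof. by rewrite /= !hornerE. Qed.

Lemma eq_bernstein n (phi psi : nat -> R) : phi =1 psi ->
  bernstein n phi = bernstein n psi.
Proof. by move=> /funext ->. Qed.

Lemma bernstein_lin n (phi psi : nat -> R) a z :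
  (bernstein n (fun k => a * phi k + psi k)).[z] =
  a * (bernstein n phi).[z] + (bernstein n psi).[z].
Proof.
elim: n phi psi => [|n ih] phi psi; first by rewrite /= !hornerC.
by rewrite !bernsteinS (ih (phi \o S) (psi \o S)) ih; ring.
Qed.

Lemma bernstein_le n (phi psi : nat -> R) z : 0 <= z <= 1 ->
  (forall k, phi k <= psi k) -> (bernstein n phi).[z] <= (bernstein n psi).[z].
Proof.
move=> /andP[z0 z1]; elim: n phi psi => [|n ih] phi psi h; first by rewrite /= !hornerC.
rewrite !bernsteinS lerD// ler_wpM2l ?subr_ge0//; last exact: ih.
by apply: ih => k /=.
Qed.

Lemma bernstein_cst n c z : (bernstein n (fun=> c)).[z] = c.
Proof.
elim: n => [|n ih]; first by rewrite /= hornerC.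
rewrite bernsteinS (@eq_bernstein n ((fun=> c) \o S) (fun=> c))// ih; ring.
Qed.

Lemma bernstein_id n z : (bernstein n (fun k => k%:R)).[z] = n%:R * z.
Proof.
elim: n => [|n ih]; first by rewrite /= hornerC mul0r.
rewrite bernsteinS.
rewrite (@eq_bernstein n _ (fun k => 1 * k%:R + 1)); last first.
  by move=> k /=; rewrite -[in LHS]addn1 natrD mul1r.
rewrite (bernstein_lin n (fun k => k%:R) (fun=> 1)) bernstein_cst ih -natr1.
by ring.
Qed.

Lemma bernstein_sqr n z : (bernstein n (fun k => k%:R ^+ 2)).[z] =
  n%:R * z * (1 - z) + (n%:R * z) ^+ 2.
Proof.
elim: n => [|n ih]; first by rewrite /= hornerC !mul0r expr0n mulr0n addr0.
rewrite bernsteinS.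
rewrite (@eq_bernstein n _ (fun k => 1 * k%:R ^+ 2 + (2 * k%:R + 1))); last first.
  by move=> k /=; rewrite -[in LHS]addn1 natrD; ring.
rewrite (bernstein_lin n (fun k => k%:R ^+ 2) (fun k => 2 * k%:R + 1)).
rewrite (bernstein_lin n (fun k => k%:R) (fun=> 1)) bernstein_cst bernstein_id ih -natr1.
by ring.
Qed.

Lemma bernstein_var n z : (0 < n)%N ->
  (bernstein n (fun k => (k%:R / n%:R - z) ^+ 2)).[z] = z * (1 - z) / n%:R.
Proof.
move=> n0; have n0' : n%:R != 0 :> R by rewrite pnatr_eq0 -lt0n.
rewrite (@eq_bernstein n _ (fun k => (n%:R ^- 2) * k%:R ^+ 2 +
   ((- (2 * z / n%:R)) * k%:R + z ^+ 2))); last by move=> k; field.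
rewrite (bernstein_lin n (fun k => k%:R ^+ 2) (fun k => (- (2 * z / n%:R)) * k%:R + z ^+ 2)).
rewrite (bernstein_lin n (fun k => k%:R) (fun=> z ^+ 2)).
rewrite bernstein_cst bernstein_id bernstein_sqr.
by field.
Qed.

(** Chebyshev's argument, for which continuity at the single point [z] is enough. This matters
    because it is applied to [q (- ln z)], which need not have a limit at 0. *)
Lemma bernstein_cvg (f : R -> R) (N z : R) : (forall y, 0 <= f y <= N) ->
  0 <= z <= 1 -> {for z, continuous f} ->
  (bernstein n (fun k => f (k%:R / n%:R))).[z] @[n --> \oo] --> f z.
Proof.
move=> fN z01 cf; apply/cvgrPdist_le => e e0.
have e20 : 0 < e / 2 by rewrite divr_gt0.
have /cvgrPdist_le/(_ _ e20)[eta /= eta0 Heta] := cf.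
have N0 : 0 <= N by have /andP[h1 h2] := fN 0; exact: le_trans h2.
(* Within [eta] of [z] the first term suffices by continuity; elsewhere [(y - z)^2 / eta^2 >= 1] and
   [f] oscillates by at most [N]. Applying the positive operator [bernstein n] turns the square into
   the variance [z (1 - z) / n]. *)
have key y : `|f z - f y| <= e / 2 + N / eta ^+ 2 * (y - z) ^+ 2.
  have [zy|zy] := ltP `|z - y| eta.
    apply: le_trans (Heta _ zy) _.
    by rewrite lerDl mulr_ge0 ?sqr_ge0// divr_ge0// sqr_ge0.
  apply: (@le_trans _ _ N).
    have /andP[h1 h2] := fN z; have /andP[h3 h4] := fN y.
    by rewrite ler_norml; apply/andP; split; lra.
  rewrite ler_wpDl ?(ltW e20)// mulrAC ler_pdivlMr ?exprn_gt0//.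
  rewrite ler_wpM2l// -[leRHS]real_normK ?num_real// distrC.
  by rewrite ler_sqr ?nnegrE ?(ltW eta0).
near=> n.
have n0 : (0 < n)%N by near: n; exact: nbhs_infty_gt.
have nr0 : 0 < n%:R :> R by rewrite ltr0n.
set B := (bernstein _ _).[_].
have -> : f z - B = - (bernstein n (fun k => 1 * f (k%:R / n%:R) + - f z)).[z].
  by rewrite (bernstein_lin n (fun k => f (k%:R / n%:R)) (fun=> - f z)) bernstein_cst -/B; ring.
rewrite normrN.
have v : N / eta ^+ 2 * (z * (1 - z) / n%:R) <= e / 2.
  rewrite mulrA ler_pdivrMr//.
  near: n; move: (N / eta ^+ 2 * (z * (1 - z))) => C.
  exists (Num.truncn (C / (e / 2))).+1 => // n /= hn.
  rewrite mulrC -ler_pdivrMr// ltW// (lt_le_trans (truncnS_gt _))// ler_nat//.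
have b : (bernstein n (fun k => N / eta ^+ 2 * (k%:R / n%:R - z) ^+ 2 + e / 2)).[z] <= e.
  rewrite (bernstein_lin n (fun k => (k%:R / n%:R - z) ^+ 2) (fun=> e / 2)).
  by rewrite bernstein_cst bernstein_var//; lra.
rewrite ler_norml; apply/andP; split.
  rewrite lerNl; apply: le_trans b.
  rewrite -[- _]mulN1r -[_ * _]addr0 -[X in _ + X](bernstein_cst n 0 z) -bernstein_lin.
  apply: bernstein_le => // k.
  have := key (k%:R / n%:R); rewrite ler_norml => /andP[h1 h2]; lra.
apply: le_trans b.
apply: bernstein_le => // k.
have := key (k%:R / n%:R); rewrite ler_norml => /andP[h1 h2]; lra.
Unshelve. all: by end_near.
Qed.

Lemma bernstein_bound n (phi : nat -> R) (N z : R) : 0 <= z <= 1 ->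
  (forall k, 0 <= phi k <= N) -> `|(bernstein n phi).[z]| <= N.
Proof.
move=> z01 h; have h0 : 0 <= (bernstein n phi).[z].
  rewrite -(bernstein_cst n 0 z); apply: bernstein_le => // k.
  by case/andP: (h k).
rewrite ger0_norm// -[leRHS](bernstein_cst n N z); apply: bernstein_le => // k.
by case/andP: (h k).
Qed.

End bernstein.

(** * From integer moments on [(0, 1]] to means of continuous functions *)

Section moments.
Context {R : realType}.

Lemma bounded_weight_integrable d (T : measurableType d) (mu : measure T R)
    (f w : T -> R) (N : R) :
  measurable_fun setT f -> (forall x, `|f x| <= N) ->
  mu.-integrable setT (EFin \o w) ->
  mu.-integrable setT (EFin \o (fun x => f x * w x)).
Proof.
move=> mf fN iw; apply: (@le_integrable _ _ _ _ _ measurableT _ (fun x => (N * w x)%:E)).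
- apply/measurable_EFinP; apply: measurable_funM => //.
  by apply/measurable_EFinP; exact: measurable_int iw.
- move=> x _; rewrite lee_fin !normrM ler_wpM2r//.
  by rewrite (le_trans (fN x))// ler_norm.
- by have := @integrableZl _ _ _ mu _ measurableT N _ iw.
Qed.

Lemma measurable_horner d (T : measurableType d) (Z : T -> R) (Q : {poly R}) :
  measurable_fun setT Z -> measurable_fun setT (fun w => Q.[Z w]).
Proof.
move=> mZ; apply: (measurableT_comp (f := fun x => Q.[x])) mZ.
by apply: continuous_measurable_fun; exact: continuous_horner.
Qed.

Variables (d1 d2 : measure_display) (T1 : measurableType d1) (T2 : measurableType d2).
Variables (m1 : measure T1 R) (m2 : measure T2 R).
Variables (Z1 w1 : T1 -> R) (Z2 w2 : T2 -> R) (p : R).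
Hypotheses (mZ1 : measurable_fun setT Z1) (mZ2 : measurable_fun setT Z2).
Hypotheses (Z1_01 : forall w, 0 < Z1 w <= 1) (Z2_01 : forall w, 0 < Z2 w <= 1).
Hypotheses (iw1 : m1.-integrable setT (EFin \o w1))
  (iw2 : m2.-integrable setT (EFin \o w2)).
Hypothesis moments_eq : forall k : nat,
  (\int[m1]_x (Z1 x ^+ k * w1 x) = p + (1 - p) * \int[m2]_x (Z2 x ^+ k * w2 x))%R.

(** In the application [Z1 = e^{-Y}] has weight 1 under [P], and [Z2 = e^{- max(y, 0)}] has the
    exponential density as weight; the weights thus allow [m2] to be Lebesgue measure. *)
Lemma polynomial_moments_eq (Q : {poly R}) :
  (\int[m1]_x (Q.[Z1 x] * w1 x) =
   p * Q.[1] + (1 - p) * \int[m2]_x (Q.[Z2 x] * w2 x))%R.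
Proof.
(* The extra factor [Z ^+ k] closes the Horner induction: the step [Q * 'X + c] raises the exponent
   by one. *)
suff h k : (\int[m1]_x (Z1 x ^+ k * Q.[Z1 x] * w1 x) =
    p * Q.[1] + (1 - p) * \int[m2]_x (Z2 x ^+ k * Q.[Z2 x] * w2 x))%R.
  have := h 0%N.
  under eq_Rintegral do rewrite expr0 mul1r.
  by under [in X in _ = X -> _]eq_Rintegral do rewrite expr0 mul1r.
have iX d (T : measurableType d) (mu : measure T R) (Z w : T -> R) (j : nat) (S : {poly R}) :
    measurable_fun setT Z -> (forall x, 0 < Z x <= 1) -> mu.-integrable setT (EFin \o w) ->
    mu.-integrable setT (EFin \o (fun x => Z x ^+ j * S.[Z x] * w x)).
  move=> mZ Z01 iw.
  have [N hN] : exists N, forall z : R, 0 < z <= 1 -> `|z ^+ j * S.[z]| <= N.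
    exists (\sum_(i < size S) `|S`_i|) => z /andP[z0 z1].
    rewrite normrM horner_coef ger0_norm ?exprn_ge0 ?(ltW z0)//.
    apply: le_trans (_ : `|\sum_(i < size S) S`_i * z ^+ i| <= _).
      by rewrite ler_piMl// exprn_ile1// ltW.
    apply: le_trans (ler_norm_sum _ _ _) _; apply: ler_sum => i _.
    by rewrite normrM ler_piMr// ger0_norm ?exprn_ile1 ?exprn_ge0// ltW.
  apply: (@bounded_weight_integrable _ _ _ (fun x => Z x ^+ j * S.[Z x]) w N) => //.
    by apply: measurable_funM; [exact: measurable_funX|exact: measurable_horner].
  by move=> x; exact: hN.
elim/poly_ind: Q k => [|Q c ih] k.
  under eq_Rintegral do rewrite horner0 mulr0 mul0r.
  under [in X in _ = X]eq_Rintegral do rewrite horner0 mulr0 mul0r.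
  by rewrite !Rintegral_cst// !horner0; ring.
have e d (T : measurableType d) (mu : measure T R) (Z w : T -> R) :
    measurable_fun setT Z -> (forall x, 0 < Z x <= 1) -> mu.-integrable setT (EFin \o w) ->
    (\int[mu]_x (Z x ^+ k * (Q * 'X + c%:P).[Z x] * w x) =
     \int[mu]_x (Z x ^+ k.+1 * Q.[Z x] * w x) + c * \int[mu]_x (Z x ^+ k * w x))%R.
  move=> mZ Z01 iw.
  rewrite -RintegralZl//; last first.
    by have := iX _ _ mu Z w k 1 mZ Z01 iw; under eq_fun do rewrite hornerC mulr1.
  rewrite -RintegralD//; last 2 first.
  - exact: iX.
  - have := iX _ _ mu Z w k c%:P mZ Z01 iw.
    rewrite (_ : (fun x => _) = (fun x => c * (Z x ^+ k * w x)))//.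
    by apply/funext => x; rewrite hornerC; ring.
  by apply: eq_Rintegral => x _; rewrite hornerMXaddC exprS; ring.
by rewrite !e// ih moments_eq hornerMXaddC; ring.
Qed.

(** Bernstein polynomials of [f] converge pointwise on [(0, 1]] and stay bounded by [N], so
    dominated convergence replaces uniform approximation, which could fail near 0. *)
Lemma continuous_moments_eq (f : R -> R) (N : R) : measurable_fun setT f ->
  (forall z, 0 <= f z <= N) -> (forall z, 0 < z <= 1 -> {for z, continuous f}) ->
  (\int[m1]_x (f (Z1 x) * w1 x) =
   p * f 1 + (1 - p) * \int[m2]_x (f (Z2 x) * w2 x))%R.
Proof.
move=> mf fN cf.
pose B n := bernstein n (fun k => f (k%:R / n%:R)).
have cB z : 0 < z <= 1 -> (B n).[z] @[n --> \oo] --> f z.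
  move=> z01; apply: (@bernstein_cvg _ f N) => //; last exact: cf.
  by case/andP: z01 => /ltW -> ->.
have cI d (T : measurableType d) (mu : measure T R) (Z w : T -> R) :
    measurable_fun setT Z -> (forall x, 0 < Z x <= 1) -> mu.-integrable setT (EFin \o w) ->
    (\int[mu]_x ((B n).[Z x] * w x))%R @[n --> \oo] --> (\int[mu]_x (f (Z x) * w x))%R.
  move=> mZ Z01 iw.
  have mw : measurable_fun setT w by apply/measurable_EFinP; exact: measurable_int iw.
  apply: fine_cvg; rewrite fineK; last first.
    apply: integrable_fin_num => //.
    apply: (@bounded_weight_integrable _ _ _ (f \o Z) w N) => //.
      exact: measurableT_comp.
    by move=> x; have /andP[? ?] := fN (Z x); rewrite ger0_norm.
  apply: (@dominated_cvg _ _ _ _ _ _ _ _ (fun x => (N%:E * `|(w x)%:E|)%E)) => //.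
  - move=> n; apply/measurable_EFinP; apply: measurable_funM => //.
    exact: measurable_horner.
  - move=> x _; apply: cvg_EFin; first exact: nearW.
    by apply: cvgM; [exact: cB|exact: cvg_cst].
  - by apply: integrableZl => //; exact: integrable_abse.
  - move=> n x _; rewrite lee_fin normrM ler_wpM2r//; apply: bernstein_bound => //.
    by case/andP: (Z01 x) => /ltW -> ->.
have c1 := cI _ _ m1 Z1 w1 mZ1 Z1_01 iw1.
have c2 : (\int[m1]_x ((B n).[Z1 x] * w1 x))%R @[n --> \oo] -->
    (p * f 1 + (1 - p) * \int[m2]_x (f (Z2 x) * w2 x))%R.
  under eq_fun do rewrite polynomial_moments_eq.
  apply: cvgD; apply: cvgMr; last exact: cI.
  by apply: cB; rewrite ltr01 lexx.
exact: cvg_unique c1 c2.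
Qed.

End moments.

(** * A law with an atom at 0 and an exponential part, identified from its transform *)

Section exponential_mixture.
Context {R : realType}.
Notation mu := (@lebesgue_measure R).

Lemma exponential_moment (s : R) (k : nat) : 0 < s ->
  (\int[mu]_y (expR (- Num.max y 0) ^+ k * exponential_pdf s y) = s / (s + k%:R))%R.
Proof.
move=> s0; have sk0 : 0 < s + k%:R by rewrite ltr_wpDr// ler0n.
have -> : s / (s + k%:R) = (s / (s + k%:R) * \int[mu]_y exponential_pdf (s + k%:R) y)%R.
  by rewrite /Rintegral integral_exponential_pdf// mulr1.
rewrite -RintegralZl//; last exact: integrable_exponential_pdf.
apply: eq_Rintegral => y _.
have [y0|y0] := ltP y 0.
  by rewrite !lt0_exponential_pdf// !mulr0.
rewrite !exponential_pdfE// -expRM_natl.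
rewrite mulrCA -expRD mulrA divfK ?gt_eqF//.
by congr (_ * expR _); ring.
Qed.

Variables (d : measure_display) (T : measurableType d) (P : probability T R).
Variables (Y : T -> R) (p s : R).
Hypotheses (mY : measurable_fun setT Y) (Y0 : forall w, 0 <= Y w).
Hypotheses (p01 : 0 <= p < 1) (s0 : 0 < s).
Hypothesis laplaceY : forall k : nat,
  (\int[P]_w (expR (- (k%:R * Y w)))%:E)%E = (p + (1 - p) * (s / (s + k%:R)))%:E.

(** The change of variable [z = e^{-y}] makes [q (- ln z)] a bounded function, continuous on
    [(0, 1]]; the atom of [Y] at 0 becomes the value at [z = 1]. *)
Lemma bounded_exponential_mixture (q : R -> R) (N : R) :
  continuous q -> (forall y, 0 <= q y <= N) ->
  (\int[P]_w q (Y w) = p * q 0 + (1 - p) * \int[mu]_y (q y * exponential_pdf s y))%R.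
Proof.
move=> cq qN.
have mln : measurable_fun setT (fun z : R => q (- ln z)).
  apply: measurableT_comp; first exact: continuous_measurable_fun.
  by apply: measurable_funN; exact: measurable_ln.
have H : (\int[P]_w (q (- ln (expR (- Y w))) * cst 1 w) = p * q (- ln 1) +
    (1 - p) * \int[mu]_y (q (- ln (expR (- Num.max y 0))) * exponential_pdf s y))%R.
  apply: (@continuous_moments_eq R _ _ _ _ P mu (fun w => expR (- Y w)) (cst 1)
    (fun y => expR (- Num.max y 0)) (exponential_pdf s) p _ _ _ _ _ _ _
    (fun z => q (- ln z)) N mln) => //.
  - by apply: (measurableT_comp (@measurable_expR R)); exact: measurable_funN.
  - apply: (measurableT_comp (@measurable_expR R)); apply: measurable_funN.
    by apply: measurable_maxr => //; exact: measurable_id.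
  - move=> w; rewrite expR_gt0 -[leRHS]expR0 ler_expR lerNl oppr0/=; exact: Y0.
  - by move=> y; rewrite expR_gt0 -[leRHS]expR0 ler_expR lerNl oppr0 le_max lexx orbT.
  - exact: finite_measure_integrable_cst.
  - exact: integrable_exponential_pdf.
  - move=> k; rewrite exponential_moment// /Rintegral.
    under eq_integral do rewrite mulr1 -expRM_natl mulrN.
    by rewrite laplaceY.
  - move=> z /andP[z0 _]; apply: continuous_comp; last exact: cq.
    by apply: cvgN; exact: continuous_ln.
move: H; rewrite ln1 oppr0.
under eq_Rintegral do rewrite expRK opprK mulr1.
move=> ->; congr (_ + _ * _); apply: eq_Rintegral => y _; rewrite expRK opprK.
have [y0|y0] := ltP y 0 => //.
by rewrite lt0_exponential_pdf// !mulr0.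
Qed.

(** The payoffs grow linearly, so the bounded case is extended by truncation at [n] and monotone
    convergence. *)
Lemma exponential_mixture (q : R -> R) : continuous q -> (forall y, 0 <= q y) ->
  (\int[P]_w (q (Y w))%:E =
   (p * q 0)%:E + (1 - p)%:E * \int[mu]_y (q y * exponential_pdf s y)%:E)%E.
Proof.
move=> cq q0.
pose qn (n : nat) y := Num.min (q y) n%:R.
have cqn n : continuous (qn n) 
  by apply: (@min_fun_continuous _ _ _ q (cst n%:R)); [exact: cq|exact: cst_continuous].
have qnN n y : 0 <= qn n y <= n%:R by rewrite le_min q0 ler0n ge_min lexx orbT.
have qn_cvg y : (qn n y)%:E @[n --> \oo] --> (q y)%:E.
  apply: cvg_EFin; first exact: nearW.
  apply: cvg_near_cst; exists (Num.truncn (q y)).+1 => // n /= hn.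
  by apply/min_idPl; rewrite ltW// (lt_le_trans (truncnS_gt _))// ler_nat.
have qn_nd y : {homo (fun n => (qn n y)%:E) : n m / (n <= m)%N >-> (n <= m)%E}.
  move=> n m nm; rewrite lee_fin le_min ge_min lexx/= ge_min ler_nat nm orbT//.
have mqn n d' (T' : measurableType d') (Z : T' -> R) : measurable_fun setT Z ->
    measurable_fun setT (fun w => qn n (Z w)).
  by move=> mZ; apply: measurableT_comp mZ; exact: continuous_measurable_fun.
have pdf0 y : 0 <= exponential_pdf s y by exact/exponential_pdf_ge0/ltW.
have c1 : (\int[P]_w (qn n (Y w))%:E)%E @[n --> \oo] --> (\int[P]_w (q (Y w))%:E)%E.
  rewrite (_ : (\int[P]_w _)%E = (\int[P]_w (limn (fun n => (qn n (Y w))%:E)))%E); last first.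
    by apply: eq_integral => w _; apply/esym/cvg_lim.
  apply: cvg_monotone_convergence => //.
  - by move=> n; apply/measurable_EFinP; exact: mqn.
  - by move=> n w _; rewrite lee_fin; case/andP: (qnN n (Y w)).
have c2 : (\int[mu]_y (qn n y * exponential_pdf s y)%:E)%E @[n --> \oo] -->
    (\int[mu]_y (q y * exponential_pdf s y)%:E)%E.
  rewrite (_ : (\int[mu]_y (q y * _)%:E)%E =
    (\int[mu]_y (limn (fun n => (qn n y * exponential_pdf s y)%:E)))%E); last first.
    apply: eq_integral => y _; apply/esym/cvg_lim => //.
    under eq_fun do rewrite EFinM.
    by rewrite EFinM; apply: cvgeZr.
  apply: cvg_monotone_convergence => //.
  - move=> n; apply/measurable_EFinP; apply: measurable_funM; first exact: mqn.
    exact: measurable_exponential_pdf.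
  - by move=> n y _; rewrite lee_fin mulr_ge0//; case/andP: (qnN n y).
  - move=> y _ n m nm; rewrite lee_fin ler_wpM2r//.
    by have := qn_nd y n m nm; rewrite lee_fin.
have c3 : ((p * qn n 0)%:E + (1 - p)%:E * \int[mu]_y (qn n y * exponential_pdf s y)%:E)%E
   @[n --> \oo] --> ((p * q 0)%:E + (1 - p)%:E * \int[mu]_y (q y * exponential_pdf s y)%:E)%E.
  apply: cvgeD; last exact: cvgeZl.
    by rewrite fin_num_adde_defr.
  under eq_fun do rewrite EFinM.
  by rewrite EFinM; exact: cvgeZl.
have eqn n : (\int[P]_w (qn n (Y w))%:E =
    (p * qn n 0)%:E + (1 - p)%:E * \int[mu]_y (qn n y * exponential_pdf s y)%:E)%E.
  have := bounded_exponential_mixture (cqn n) (qnN n).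
  have i1 : P.-integrable setT (EFin \o (fun w => qn n (Y w) * 1)).
    apply: (@bounded_weight_integrable _ _ _ _ _ _ n%:R) => //; first exact: mqn.
      by move=> w; rewrite ger0_norm; case/andP: (qnN n (Y w)).
    exact: finite_measure_integrable_cst.
  have i2 : mu.-integrable setT (EFin \o (fun y => qn n y * exponential_pdf s y)).
    apply: (@bounded_weight_integrable _ _ _ _ _ _ n%:R) => //; first exact: mqn.
      by move=> w; rewrite ger0_norm; case/andP: (qnN n w).
    exact: integrable_exponential_pdf.
  have f1 := integrable_fin_num measurableT i1.
  have f2 := integrable_fin_num measurableT i2.
  rewrite /Rintegral => H.
  have {}f1 : (\int[P]_w (qn n (Y w))%:E)%E \is a fin_num.
    by move: f1; under eq_integral do rewrite /= mulr1.
  by rewrite -(fineK f1) H EFinD [X in (_ + X)%E]EFinM fineK.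
move: c1; under eq_fun do rewrite eqn.
by move=> c1; exact: cvg_unique c1 c3.
Qed.

(** A tent of height 1 and half-width [1 / (n + 1)] at [c] dominates the indicator of [{c}], and its
    mean under a density bounded by [s] is at most [2 s / (n + 1)]. *)
Lemma exponential_mixture_no_atom (c : R) : 0 < c -> P [set w | Y w = c] = 0%E.
Proof.
move=> c0.
have mA : measurable [set w | Y w = c].
  by rewrite -[X in measurable X]setTI; exact: (mY measurableT (measurable_set1 c)).
suff h n : (P [set w | Y w = c] <= (2 * s / n.+1%:R)%:E)%E.
  apply/eqP; rewrite eq_le measure_ge0 andbT; apply/lee_addgt0Pr => e e0; rewrite add0e.
  pose n := Num.truncn (2 * s / e).
  apply: le_trans (h n) _; rewrite lee_fin.
  by rewrite ler_pdivrMr ?ltr0n// [e * _]mulrC -ler_pdivrMr//; exact/ltW/truncnS_gt.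
(* The tent has to vanish at 0, so as not to see the atom there; the bound for a larger [n] implies
   the one for [n]. *)
wlog nc : n / n.+1%:R^-1 <= c.
  move=> H; pose m := maxn n (Num.truncn c^-1).
  apply: le_trans (H m _) _.
    rewrite -[leRHS]invrK lef_pV2 ?posrE ?invr_gt0 ?ltr0n//.
    by rewrite ltW// (lt_le_trans (truncnS_gt _))// ler_nat ltnS leq_maxr.
  rewrite lee_fin ler_pM2l ?mulr_gt0// lef_pV2 ?posrE ?ltr0n// ler_nat ltnS leq_maxl.
  by [].
pose q (y : R) : R := Num.max 0 (1 - n.+1%:R * `|y - c|).
have cq : continuous q.
  apply: (@max_fun_continuous _ R R (cst (0 : R)) (fun y : R => 1 - n.+1%:R * `|y - c|)).
    exact: cst_continuous.
  move=> y; apply: cvgB; first exact: cvg_cst.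
  apply: cvgM; first exact: cvg_cst.
  by apply: cvg_norm; apply: cvgB; [exact: cvg_id|exact: cvg_cst].
have q0 y : 0 <= q y by rewrite le_max lexx.
apply: (@le_trans _ _ (\int[P]_w (q (Y w))%:E)%E).
  have -> : P [set w | Y w = c] = (\int[P]_w (\1_[set w | Y w = c] w)%:E)%E.
    by rewrite integral_indic// setIT.
  apply: ge0_le_integral => //=.
  - exact/measurable_EFinP/measurable_indic.
  - apply/measurable_EFinP; apply: measurableT_comp => //.
    exact: continuous_measurable_fun.
  - move=> w _; rewrite lee_fin indicE; case: (boolP (_ \in _)) => [/set_mem/= Yw|_//].
    by rewrite /q Yw subrr normr0 mulr0 subr0 le_max lexx orbT.
rewrite exponential_mixture//.
have -> : q 0 = 0.
  rewrite /q sub0r normrN gtr0_norm//; apply/max_idPl.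
  by rewrite subr_le0 -ler_pdivrMl ?ltr0n// mulr1.
rewrite mulr0 add0e.
have mI : measurable (`[c - n.+1%:R^-1, c + n.+1%:R^-1]%classic : set R) by [].
set I := `[c - n.+1%:R^-1, c + n.+1%:R^-1]%classic in mI.
apply: (@le_trans _ _ (\int[mu]_y (s%:E * (\1_I y)%:E))%E).
  rewrite -[leRHS]mul1e; apply: lee_pmul => //.
  - by rewrite lee_fin subr_ge0; case/andP: p01 => _ /ltW.
  - by apply: integral_ge0 => y _; rewrite lee_fin mulr_ge0// exponential_pdf_ge0// ltW.
  - by rewrite lee_fin; case/andP: p01 => *; lra.
  apply: ge0_le_integral => //=.
  - by move=> y _; rewrite lee_fin mulr_ge0// exponential_pdf_ge0// ltW.
  - apply/measurable_EFinP; apply: measurable_funM; first exact: continuous_measurable_fun.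
    exact: measurable_exponential_pdf.
  - apply: emeasurable_funM; first exact: measurable_cst.
    by apply/measurable_EFinP; exact: measurable_indic.
  - move=> y _; rewrite -EFinM lee_fin indicE.
    have pdf_le : exponential_pdf s y <= s.
      have [y0|y0] := ltP y 0; first by rewrite lt0_exponential_pdf// ltW.
      rewrite exponential_pdfE// ler_piMr ?(ltW s0)// -[leRHS]expR0 ler_expR mulNr.
      by rewrite oppr_le0 mulr_ge0// ltW.
    case: (boolP (y \in I)) => [_|yI].
      have q1 : q y <= 1 by rewrite /q ge_max ler01 gerBl mulr_ge0.
      rewrite mulr1 (le_trans _ pdf_le)// ler_piMl//.
      exact/exponential_pdf_ge0/ltW.
    rewrite (_ : q y = 0) ?mul0r ?mulr0//; apply/max_idPl.
    rewrite subr_le0 -ler_pdivrMl ?ltr0n// mulr1 leNgt; apply: contra yI => h.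
    rewrite inE /I/= in_itv/=; move: h; rewrite ltr_norml.
    by move: (n.+1%:R^-1) => v /andP[h1 h2]; apply/andP; split; lra.
rewrite ge0_integralZl//=; last 2 first.
- by apply/measurable_EFinP; exact: measurable_indic.
- by rewrite lee_fin ltW.
rewrite integral_indic// setIT /I /= lebesgue_measure_itv/= lte_fin.
rewrite ltrD2l gtrN ?invr_gt0 ?ltr0n// -EFinD -EFinM lee_fin.
by move: (n.+1%:R^-1) => v; rewrite le_eqVlt; apply/orP; left; apply/eqP; ring.
Qed.

End exponential_mixture.

(** * The one-sided payoff and its mean under the mixture *)

Section game_payoff.
Context {R : realType}.
Implicit Types (p s rho c x y : R).
Notation mu := (@lebesgue_measure R).

Definition game_payoff rho c y : R :=
  Num.max y 0 + c * (1 - expR (- (rho * Num.max y 0))).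

Lemma game_payoff_le0 rho c y : y <= 0 -> game_payoff rho c y = 0.
Proof.
by move=> y0; rewrite /game_payoff (max_idPr y0) mulr0 oppr0 expR0 subrr mulr0 addr0.
Qed.

Lemma game_payoff_ge0E rho c y : 0 <= y ->
  game_payoff rho c y = y + c * (1 - expR (- (rho * y))).
Proof. by move=> y0; rewrite /game_payoff (max_idPl y0). Qed.

(** On [y >= 0] the slope is [1 + c rho e^{- rho y}], which is at least [1 + c rho] because
    [c <= 0]. *)
Lemma game_payoff_nd rho c : 0 < rho -> c <= 0 -> 0 <= 1 + c * rho ->
  {homo game_payoff rho c : x y / x <= y}.
Proof.
move=> r0 c0 crho x y xy; rewrite /game_payoff.
have : Num.max x 0 <= Num.max y 0 by rewrite ge_max !le_max xy lexx orbT.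
have : 0 <= Num.max x 0 by rewrite le_max lexx orbT.
move: (Num.max x 0) (Num.max y 0) => {xy}x {}y x0 xy.
have e1 : expR (- (rho * y)) = expR (- (rho * x)) * expR (- (rho * (y - x))).
  by rewrite -expRD; congr expR; ring.
have h1 := expR_ge1Dx (- (rho * (y - x))).
have h0 : 0 <= expR (- (rho * x)) <= 1.
  by rewrite expR_ge0 -[leRHS]expR0 ler_expR oppr_le0 mulr_ge0// ltW.
have h2 : expR (- (rho * x)) * (1 - expR (- (rho * (y - x)))) <= rho * (y - x).
  case/andP: h0 => h0 h0'.
  have [h3|h3] := leP 0 (1 - expR (- (rho * (y - x)))).
    by apply: le_trans (ler_piMl h3 h0') _; lra.
  apply: (@le_trans _ _ 0); first by rewrite mulr_ge0_le0// ltW.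
  by rewrite mulr_ge0 ?(ltW r0)// subr_ge0.
rewrite e1 -subr_ge0.
set A := expR _ in h2 *; set B := expR _ in h2 *.
have -> : y + c * (1 - A * B) - (x + c * (1 - A)) = (y - x) + c * (A * (1 - B)) by ring.
have h4 : c * (rho * (y - x)) <= c * (A * (1 - B)) by rewrite ler_wnM2l.
apply: (@le_trans _ _ ((1 + c * rho) * (y - x))); first by rewrite mulr_ge0// subr_ge0.
by rewrite mulrDl mul1r lerD2l -mulrA.
Qed.

Lemma game_payoff_ge0 rho c y : 0 < rho -> c <= 0 -> 0 <= 1 + c * rho ->
  0 <= game_payoff rho c y.
Proof.
move=> r0 c0 cr; have [y0|/ltW y0] := leP y 0; first by rewrite game_payoff_le0.
by rewrite -(@game_payoff_le0 rho c 0 (lexx 0)); apply: game_payoff_nd.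
Qed.

Lemma continuous_game_payoff rho c : continuous (game_payoff rho c).
Proof.
have cmax : continuous (fun y : R => Num.max y 0).
  apply: (@max_fun_continuous _ R R id (cst (0 : R))); first by move=> y; exact: cvg_id.
  exact: cst_continuous.
move=> y; apply: cvgD; first exact: cmax.
apply: cvgM; first exact: cvg_cst.
apply: cvgB; first exact: cvg_cst.
apply: continuous_comp; last exact: continuous_expR.
by apply: cvgN; apply: cvgM; [exact: cvg_cst|exact: cmax].
Qed.

Lemma cvgy_expRN s : 0 < s -> expR (- (s * y)) @[y --> +oo] --> (0 : R).
Proof.
move=> s0; apply: (@cvg_comp _ _ _ ( *%R s) (fun z : R => expR (- z)) _ (pinfty_nbhs R)).
  exact: gt0_cvgMry.
exact: cvgr_expR.
Qed.

Lemma cvgy_expRNM s : 0 < s -> expR (- (s * y)) * y @[y --> +oo] --> (0 : R).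
Proof.
move=> s0; have s20 : 0 < s / 2 by rewrite divr_gt0.
apply: (@squeeze_cvgr _ _ _ _ (cst 0) (fun y => (s / 2)^-1 * expR (- (s / 2 * y)))); last 2 first.
- exact: cvg_cst.
- rewrite -[X in _ --> X](mulr0 (s / 2)^-1); apply: cvgMr.
  exact: cvgy_expRN.
near=> y; have y0 : 0 < y by near: y; exact: nbhs_pinfty_gt.
rewrite mulr_ge0 ?expR_ge0 ?(ltW y0)//=.
have -> : expR (- (s * y)) = expR (- (s / 2 * y)) * expR (- (s / 2 * y)).
  by rewrite -expRD; congr expR; field.
rewrite -mulrA mulrC ler_pM2r ?expR_gt0//.
rewrite -[leRHS]mul1r ler_pdivlMr// expRN -[leLHS]mulrA ler_pdivrMl ?expR_gt0// mulr1.
rewrite [y * _]mulrC.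
by apply: le_trans (expR_ge1Dx _); rewrite lerDr.
Unshelve. all: by end_near.
Qed.

(** The hypotheses force [a = max(0, -x)], where the integration effectively starts; one formula
    then serves both branches of [excessive_fun]. *)
Lemma integral_game_payoff_tail s rho c x a : 0 < s -> 0 < rho -> c <= 0 ->
  0 <= 1 + c * rho -> 0 <= a -> 0 <= x + a ->
  (forall y, 0 <= y -> y < a -> x + y <= 0) ->
  (\int[mu]_y (game_payoff rho c (x + y) * exponential_pdf s y)%:E =
   (expR (- (s * a)) * (x + a + c + s^-1) -
    c * s / (rho + s) * expR (- (rho * (x + a))) * expR (- (s * a)))%:E)%E.
Proof.
move=> s0 r0 c0 cr a0 xa0 lta.
have rs0 : 0 < rho + s by rewrite addr_gt0.
pose f (y : R) : R := (x + y + c * (1 - expR (- (rho * (x + y))))) * (s * expR (- (s * y))).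
(* An antiderivative of [f] that tends to 0 at infinity, so the integral is [- F a]. *)
pose F (y : R) : R := c * s / (rho + s) * expR (- (rho * (x + y))) * expR (- (s * y))
   - expR (- (s * y)) * (x + y + c + s^-1).
have dF (y : R) : is_derive y (1 : R) F (f y).
  rewrite /F /f; apply: is_derive_eq.
  by rewrite /GRing.scale/=; field; rewrite !gt_eqF.
transitivity (\int[mu]_(y in `[a, +oo[) (f y)%:E)%E.
  rewrite [RHS]integral_mkcond; apply: eq_integral => y _.
  rewrite patchE; case: ifPn => [|]; rewrite ?inE ?notin_setE/= in_itv/= andbT => ay.
    have y0 : 0 <= y := le_trans a0 ay.
    have xy0 : 0 <= x + y by rewrite (le_trans xa0)// lerD2l.
    by rewrite game_payoff_ge0E// exponential_pdfE// mulNr.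
  have [y0|y0] := ltP y 0; first by rewrite lt0_exponential_pdf// mulr0.
  by rewrite game_payoff_le0 ?mul0r// lta// ltNge; apply/negP.
rewrite (@ge0_continuous_FTC2y _ f F a 0).
- by rewrite -EFinB sub0r /F opprB.
- move=> y ay; rewrite /f -game_payoff_ge0E; last by rewrite (le_trans xa0)// lerD2l.
  by rewrite mulr_ge0 ?game_payoff_ge0// mulr_ge0 ?expR_ge0 ?ltW.
- apply: continuous_subspaceT => y.
  have ce (k : R) (g : R -> R) : {for y, continuous g} ->
      {for y, continuous (fun y => expR (- (k * g y)))}.
    move=> cg; apply: continuous_comp; last exact: continuous_expR.
    by apply: cvgN; apply: cvgM; [exact: cvg_cst|exact: cg].
  have cx : {for y, continuous (fun y => x + y)} by apply: cvgD; [exact: cvg_cst|exact: cvg_id].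
  rewrite /f; apply: cvgM.
    apply: cvgD; first exact: cx.
    by apply: cvgM; [exact: cvg_cst|apply: cvgB; [exact: cvg_cst|exact: ce cx]].
  by apply: cvgM; [exact: cvg_cst|apply: (ce s id); exact: cvg_id].
- rewrite /F.
  have -> : (fun y => c * s / (rho + s) * expR (- (rho * (x + y))) * expR (- (s * y)) -
    expR (- (s * y)) * (x + y + c + s^-1)) = (fun y =>
      c * s / (rho + s) * expR (- (rho * x)) * expR (- ((rho + s) * y)) -
      (expR (- (s * y)) * (x + c + s^-1) + expR (- (s * y)) * y)).
    apply/funext => y; rewrite -!(mulrA (c * s / _)) -!expRD.
    have -> : - (rho * (x + y)) - s * y = - (rho * x) - (rho + s) * y by ring.
    by ring.
  have -> : (0 : R) = c * s / (rho + s) * expR (- (rho * x)) * 0 - (0 * (x + c + s^-1) + 0) by ring.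
  apply: cvgB; first by apply: cvgMr; exact: cvgy_expRN.
  by apply: cvgD; [apply: cvgMl; exact: cvgy_expRN|exact: cvgy_expRNM].
- by move=> y _; have [] := dF y.
- have cF : {for a, continuous F}.
    by apply: differentiable_continuous; apply/derivable1_diffP; have [] := dF a.
  by apply: cvg_at_right_filter; exact: cF.
- by move=> y _; rewrite derive1E; have [_ ->] := dF y.
Qed.

Lemma game_payoff_mixture p s rho c x : 0 <= p < 1 -> 0 < s -> 0 < rho -> c <= 0 ->
  0 <= 1 + c * rho ->
  ((p * game_payoff rho c x)%:E +
   (1 - p)%:E * \int[mu]_y (game_payoff rho c (x + y) * exponential_pdf s y)%:E)%E =
  (excessive_fun p s rho c x)%:E.
Proof.
move=> p01 s0 r0 c0 cr; have rs0 : 0 < rho + s by rewrite addr_gt0.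
rewrite /excessive_fun; case: ifPn => [x0|]; last rewrite -ltNge => /ltW x0.
  rewrite (@integral_game_payoff_tail s rho c x (- x))// ?oppr_ge0 ?subrr//; last first.
    by move=> y y0; rewrite ltrNr => yx; lra.
  rewrite game_payoff_le0// mulr0 add0r mulr0 oppr0 expR0 mulrN opprK -EFinM.
  by congr EFin; field; rewrite !gt_eqF// addrC.
rewrite (@integral_game_payoff_tail s rho c x 0)// ?addr0//; last first.
  by move=> y y0 /(le_lt_trans y0); rewrite ltxx.
rewrite game_payoff_ge0E// mulr0 oppr0 expR0 -EFinM -EFinD; congr EFin.
by rewrite /cE; field; rewrite !gt_eqF// addrC.
Qed.

(** Linear growth is what later allows domination by the running supremum of the discounted
    payoff. *)
Lemma excessive_fun_bound p s rho c : 0 < s -> 0 < rho ->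
  exists C, forall y, excessive_fun p s rho c y <= C + `|y|.
Proof.
move=> s0 r0.
exists (`|(1 - p) * (s^-1 + c * rho / (s + rho))| + `|cE p s| + `|c|
   + `|c * ((p * rho + s) / (rho + s))|) => y.
rewrite /excessive_fun; case: ifPn => [y0|]; last rewrite -ltNge => y0.
  apply: (@le_trans _ _ (`|(1 - p) * (s^-1 + c * rho / (s + rho))|)).
    apply: le_trans (ler_norm _) _; rewrite normrM ler_piMr//.
    rewrite ger0_norm ?expR_ge0// -[leRHS]expR0 ler_expR.
    by rewrite mulr_ge0_le0// ltW.
  by rewrite -!addrA lerDl !addr_ge0.
have : - (c * ((p * rho + s) / (rho + s)) * expR (- (rho * y))) <=
    `|c * ((p * rho + s) / (rho + s))|.
  apply: le_trans (ler_norm _) _; rewrite normrN normrM ler_piMr//.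
  rewrite ger0_norm ?expR_ge0// -[leRHS]expR0 ler_expR oppr_le0.
  by rewrite mulr_ge0// ltW.
have := ler_norm (cE p s); have := ler_norm c; rewrite (gtr0_norm y0).
by have := normr_ge0 ((1 - p) * (s^-1 + c * rho / (s + rho))); lra.
Qed.

End game_payoff.

(** * Cadlag paths on a grid *)

Section cadlag_paths.
Context {R : realType}.

Definition cadlag (xi : R -> R) : Prop :=
  (forall t, 0 <= t -> xi s @[s --> t^'+] --> xi t) /\
  (forall t, 0 < t -> cvg (xi s @[s --> t^'-])).

Lemma cadlag_locally_bounded (xi : R -> R) (t : R) : cadlag xi -> 0 <= t ->
  exists K, \forall s \near t, 0 <= s -> `|xi s| <= K.
Proof.
move=> [rc ll] t0.
have [K1 h1] : exists K, \forall s \near t, t < s -> `|xi s| <= K.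
  exists (`|xi t| + 1); have /cvgrPdist_le/(_ 1 ltr01) := rc t t0.
  rewrite near_withinE => H; near=> s => ts.
  have h : `|xi t - xi s| <= 1 by move: ts; near: s.
  rewrite -[xi s](subKr (xi t)) (le_trans (ler_normB _ _))// lerD2l//.
have [K2 h2] : exists K, \forall s \near t, s < t -> 0 <= s -> `|xi s| <= K.
  move: t0; rewrite le_eqVlt => /predU1P[<-|t0].
    by exists 0; near=> s => k1 k2; have := lt_le_trans k1 k2; rewrite ltxx.
  have lP := ll t t0; set l := lim _ in lP.
  exists (`|l| + 1); have /cvgrPdist_le/(_ 1 ltr01) := lP.
  rewrite near_withinE => H; near=> s => st _.
  have h : `|l - xi s| <= 1 by move: st; near: s.
  rewrite -[xi s](subKr l) (le_trans (ler_normB _ _))// lerD2l//.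
exists (Num.max (`|xi t|) (Num.max K1 K2)); near=> s => s0.
rewrite !le_max; have [st|st|->] := ltgtP s t; last by rewrite lexx.
  by rewrite (near h2 s)// !orbT.
by rewrite (near h1 s)// !orbT.
Unshelve. all: by end_near.
Qed.

Lemma cadlag_bounded (xi : R -> R) (t : R) : cadlag xi ->
  exists K, forall s, 0 <= s <= t -> `|xi s| <= K.
Proof.
move=> cl.
have /compact_near_coveringP/(_ _ (pinfty_nbhs R) (fun K s => 0 <= s -> `|xi s| <= K) _) cov :=
  @segment_compact R 0 t.
have h s : `[0, t]%classic s ->
    \forall x \near s & M \near +oo, (0 <= x -> `|xi x| <= M).
  rewrite /= in_itv/= => /andP[s0 _].
  have [K hK] := cadlag_locally_bounded cl s0.
  exists ([set x | 0 <= x -> `|xi x| <= K], [set M | K <= M]).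
    by split => //=; exact: (nbhs_pinfty_ge (num_real K)).
  by move=> [x M] [/= h1 h2] x0; exact: le_trans (h1 x0) h2.
have [K [_ HK]] := cov h; exists (K + 1) => s /andP[s0 st].
by apply: (HK (K + 1)) => //; [rewrite ltrDl|rewrite /= in_itv/= s0 st].
Qed.

Lemma cvg_right_seq (xi : R -> R) (t : R) (u : nat -> R) :
  xi s @[s --> t^'+] --> xi t -> (forall n, t <= u n) ->
  u n @[n --> \oo] --> t -> xi (u n) @[n --> \oo] --> xi t.
Proof.
move=> rc tu ut; apply/cvgrPdist_le => e e0.
have /cvgrPdist_le/(_ e e0) := rc; rewrite near_withinE => near_t.
have : \forall n \near \oo, t < u n -> `|xi t - xi (u n)| <= e by exact: ut near_t.
apply: filterS => n h; have := tu n; rewrite le_eqVlt => /predU1P[<-|/h//].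
by rewrite subrr normr0 ltW.
Qed.

Definition ceiln (x : R) : nat := `|Num.ceil x|%N.

Lemma ceiln_ler (x : R) k : 0 <= x -> (ceiln x <= k)%N = (x <= k%:R).
Proof.
move=> x0; rewrite pmulrn -ceil_le_int /ceiln -lez_nat gez0_abs//.
by rewrite -(ler_int R) (le_trans x0)// ceil_ge.
Qed.

Lemma ceiln_ge (x : R) : 0 <= x -> x <= (ceiln x)%:R.
Proof. by move=> x0; rewrite -ceiln_ler. Qed.

Lemma ceiln_lt (x : R) k : 0 <= x -> (k < ceiln x)%N = (k%:R < x).
Proof. by move=> x0; rewrite ltnNge ceiln_ler// -ltNge. Qed.

Lemma ceiln_lt1 (x : R) : 0 <= x -> (ceiln x)%:R < x + 1.
Proof.
move=> x0; case: (posnP (ceiln x)) => [->|]; first by rewrite ltr_wpDl.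
move=> c0; have : ((ceiln x).-1 < ceiln x)%N by rewrite prednK.
by rewrite ceiln_lt// -[X in _ -> X%:R < _](prednK c0) -natr1 ltrD2r.
Qed.

(** Rounding goes upwards for two reasons: right-continuity applies as [h -> 0], and a stopping time
    stays one, since whether it is at most [k h] is not changed. *)
Definition grid_ceil (h t : R) : R := (ceiln (t / h))%:R * h.

Lemma grid_ceil_ge h t : 0 < h -> 0 <= t -> t <= grid_ceil h t.
Proof.
by move=> h0 t0; rewrite -ler_pdivrMr// ceiln_ge// divr_ge0// ltW.
Qed.

Lemma grid_ceil_lt h t : 0 < h -> 0 <= t -> grid_ceil h t < t + h.
Proof.
move=> h0 t0; rewrite -ltr_pdivlMr// mulrDl divff ?gt_eqF//.
by rewrite ceiln_lt1// divr_ge0// ltW.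
Qed.

Lemma grid_ceil0 h : grid_ceil h 0 = 0.
Proof.
rewrite /grid_ceil mul0r (_ : ceiln 0 = 0%N) ?mul0r//.
by apply/eqP; rewrite -leqn0 ceiln_ler.
Qed.

Definition mesh (n : nat) : R := n.+1%:R^-1.

Lemma mesh_gt0 n : 0 < mesh n. Proof. by rewrite invr_gt0 ltr0n. Qed.

Lemma cvg_mesh : mesh n @[n --> \oo] --> (0 : R).
Proof. exact: cvg_harmonic. Qed.

Lemma mesh_lt eps : 0 < eps -> exists n, mesh n < eps.
Proof.
move=> e0; exists (Num.truncn eps^-1).
by rewrite /mesh invf_plt ?posrE ?ltr0n//; exact: truncnS_gt.
Qed.

Lemma cvg_grid_ceil t : 0 <= t -> grid_ceil (mesh n) t @[n --> \oo] --> t.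
Proof.
move=> t0; apply: (@squeeze_cvgr _ _ _ _ (cst t) (fun n => t + mesh n)).
- by apply: nearW => n; rewrite grid_ceil_ge ?mesh_gt0//= ltW// grid_ceil_lt ?mesh_gt0.
- exact: cvg_cst.
- by rewrite -[X in _ --> X]addr0; apply: cvgD; [exact: cvg_cst|exact: cvg_mesh].
Qed.

Lemma cvg_cadlag_grid (xi : R -> R) t : cadlag xi -> 0 <= t ->
  xi (grid_ceil (mesh n) t) @[n --> \oo] --> xi t.
Proof.
move=> [rc _] t0; apply: cvg_right_seq; first exact: rc.
- by move=> n; rewrite grid_ceil_ge ?mesh_gt0.
- exact: cvg_grid_ceil.
Qed.

(** The initial value 0 stands for [xi 0], as the paths considered start at 0. *)
Fixpoint grid_max (xi : R -> R) (h : R) (k : nat) : R :=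
  if k is j.+1 then Num.max (grid_max xi h j) (xi (j.+1%:R * h)) else 0.

Lemma grid_max_le (xi : R -> R) h k c : 0 <= c ->
  (forall j, (0 < j <= k)%N -> xi (j%:R * h) <= c) -> grid_max xi h k <= c.
Proof.
move=> c0; elim: k => [//|k ih] H /=; rewrite ge_max H ?leqnn// andbT.
by apply: ih => j /andP[j0 jk]; rewrite H// j0 ltnW.
Qed.

Lemma le_grid_max (xi : R -> R) h k j : xi 0 = 0 -> (j <= k)%N ->
  xi (j%:R * h) <= grid_max xi h k.
Proof.
move=> x0; elim: k => [|k ih]; first by rewrite leqn0 => /eqP ->; rewrite mul0r x0.
rewrite leq_eqVlt ltnS => /predU1P[->|/ih jk]; rewrite /= le_max ?lexx ?orbT//.
by rewrite jk.
Qed.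

Definition path_sup (xi : R -> R) (t : R) : R := sup [set xi s | s in `[0, t]%classic].

Lemma path_sup_ge (xi : R -> R) t s : cadlag xi -> 0 <= s <= t -> xi s <= path_sup xi t.
Proof.
move=> cl st; have [K HK] := cadlag_bounded t cl.
apply: ub_le_sup; last by exists s => //=; rewrite in_itv/=.
exists K => _ [u /= + <-]; rewrite in_itv/= => /HK; exact: le_trans (ler_norm _).
Qed.

Lemma path_sup_ge0 (xi : R -> R) t : cadlag xi -> xi 0 = 0 -> 0 <= path_sup xi t.
Proof.
move=> cl x0; have [t0|t0] := leP 0 t.
  by rewrite -x0 path_sup_ge// lexx.
(* For [t < 0] the interval is empty and [sup] takes its default value 0. *)
rewrite /path_sup set_itv_ge ?image_set0 ?sup0//.
by rewrite -leNgt bnd_simp.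
Qed.

Lemma path_sup_le (xi : R -> R) t c : 0 <= t ->
  (forall s, 0 <= s <= t -> xi s <= c) -> path_sup xi t <= c.
Proof.
move=> t0 H; apply: ge_sup; first by exists (xi 0), 0 => //=; rewrite in_itv/= lexx.
by move=> _ [u /= + <-]; rewrite in_itv/= => /H.
Qed.

Lemma path_sup_adherent (xi : R -> R) t e : cadlag xi -> 0 <= t -> 0 < e ->
  exists2 s, 0 <= s <= t & path_sup xi t - e < xi s.
Proof.
move=> cl t0 e0; have [K HK] := cadlag_bounded t cl.
have hs : has_sup [set xi s | s in `[0, t]%classic].
  split; first by exists (xi 0), 0 => //=; rewrite in_itv/= lexx.
  exists K => _ [u /= + <-]; rewrite in_itv/= => /HK; exact: le_trans (ler_norm _).
have [_ [s /= + <-] h] := sup_adherent e0 hs.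
by rewrite in_itv/= => st; exists s.
Qed.

Lemma grid_max_pred_le_path_sup (xi : R -> R) h k t : cadlag xi -> xi 0 = 0 ->
  0 < h -> 0 <= t -> k%:R * h <= t -> grid_max xi h k <= path_sup xi t.
Proof.
move=> cl x0 h0 t0 kt; apply: grid_max_le; first exact: path_sup_ge0.
move=> j /andP[j0 jk]; apply: path_sup_ge => //.
by rewrite mulr_ge0 ?(ltW h0)//= (le_trans _ kt)// ler_pM2r// ler_nat.
Qed.

(** From below, a near-maximiser [s] is approached by its rounded-up grid points. From above, only
    the last grid point can exceed [t], and right-continuity at [t] controls it. *)
Lemma cvg_grid_max (xi : R -> R) t : cadlag xi -> xi 0 = 0 -> 0 <= t ->
  grid_max xi (mesh n) (ceiln (t / mesh n)) @[n --> \oo] --> path_sup xi t.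
Proof.
move=> cl x0 t0; apply/cvgrPdist_le => e e0.
have e20 : 0 < e / 2 by rewrite divr_gt0.
have [s s0t hs] := path_sup_adherent cl t0 e20.
have /andP[s0 st] := s0t.
have /cvgrPdist_le/(_ _ e20) cs := cvg_cadlag_grid cl s0.
have /cvgrPdist_le/(_ _ e0) ct := cvg_cadlag_grid cl t0.
near=> n.
have cs' : `|xi s - xi (grid_ceil (mesh n) s)| <= e / 2 by near: n.
have ct' : `|xi t - xi (grid_ceil (mesh n) t)| <= e by near: n.
have m0 := mesh_gt0 n.
have le1 : xi (grid_ceil (mesh n) s) <= grid_max xi (mesh n) (ceiln (t / mesh n)).
  apply: le_grid_max => //; rewrite ceiln_ler ?divr_ge0 ?(ltW m0)//.
  apply: (@le_trans _ _ (t / mesh n)); first by rewrite ler_pM2r ?invr_gt0.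
  by rewrite ceiln_ge// divr_ge0// ltW.
have le2 : grid_max xi (mesh n) (ceiln (t / mesh n)) <= path_sup xi t + e.
  have pt := path_sup_ge0 t cl x0.
  apply: grid_max_le; first by rewrite addr_ge0// ltW.
  move=> j /andP[j0]; rewrite leq_eqVlt => /predU1P[->|].
    rewrite -/(grid_ceil _ _).
    have : xi t <= path_sup xi t by rewrite path_sup_ge// t0 lexx.
    by move: ct'; rewrite ler_norml => /andP[]; lra.
  rewrite ceiln_lt ?divr_ge0 ?(ltW m0)// ltr_pdivlMr// => /ltW jt.
  apply: le_trans (_ : path_sup xi t <= _); last by rewrite lerDl ltW.
  by rewrite path_sup_ge// jt mulr_ge0// ltW.
rewrite ler_norml; move: cs'; rewrite ler_norml => /andP[a1 a2].
by apply/andP; split; lra.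
Unshelve. all: by end_near.
Qed.

End cadlag_paths.

(** * One-step Markov property and discrete optional stopping *)

Section independent_pair.
Context d d1 d2 (T : measurableType d) (U : measurableType d1) (V : measurableType d2)
  (R : realType) (P : probability T R).

(** The hypothesis says that [(Z, D)] has the product law of [Z] and [D'], so Tonelli applies.
    Allowing [D'] to differ from [D] merges independence and stationarity of increments into one
    condition. *)
Lemma independent_pair_integral (Z : T -> U) (D D' : T -> V) (phi : U * V -> \bar R) :
  measurable_fun setT Z -> measurable_fun setT D -> measurable_fun setT D' ->
  (forall A B, measurable A -> measurable B ->
     P (Z @^-1` A `&` D @^-1` B) = (P (Z @^-1` A) * P (D' @^-1` B))%E) ->
  measurable_fun setT phi -> (forall z, (0 <= phi z)%E) ->
  (\int[P]_w phi (Z w, D w) = \int[P]_w \int[P]_w' phi (Z w, D' w'))%E.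
Proof.
move=> mZ mD mD' indep mphi phi0.
pose Z1 : {mfun T >-> U} := HB.pack Z (isMeasurableFun.Build _ _ _ _ Z mZ).
pose D1 : {mfun T >-> V} := HB.pack D' (isMeasurableFun.Build _ _ _ _ D' mD').
have mZD : measurable_fun setT (fun w => (Z w, D w)) by exact: measurable_fun_pair.
pose ZD : {mfun T >-> (U * V)%type} := HB.pack (fun w => (Z w, D w))
  (isMeasurableFun.Build _ _ _ _ (fun w => (Z w, D w)) mZD).
transitivity (\int[distribution P ZD]_z phi z)%E.
  by rewrite ge0_integral_distribution.
transitivity (\int[distribution P Z1 \x distribution P D1]_z phi z)%E.
  apply: eq_measure_integral => A mA _.
  apply/esym/product_measure_unique; last exact: mA.
  move=> B C mB mC.
  exact: indep.
rewrite fubini_tonelli1// ge0_integral_distribution//=; last 2 first.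
- exact: measurable_fun_fubini_tonelli_F.
- by move=> z; apply: integral_ge0.
apply: eq_integral => w _; rewrite /fubini_F/= ge0_integral_distribution//.
exact: measurableT_comp.
Qed.

End independent_pair.

Section fatou_bound.
Context d (T : measurableType d) (R : realType) (mu : measure T R).

Lemma limn_einf_le (u : (\bar R)^nat) c : (forall n, u n <= c)%E -> (limn_einf u <= c)%E.
Proof.
move=> uc; rewrite limn_einf_lim; apply: lime_le; first exact: is_cvg_einfs.
apply: nearW => n; apply: le_trans (uc n).
by apply: ereal_inf_lbound; exists n => /=.
Qed.

Lemma limn_einf_ge (u : (\bar R)^nat) c : (\forall n \near \oo, c <= u n)%E ->
  (c <= limn_einf u)%E.
Proof.
move=> uc; rewrite limn_einf_lim; apply: lime_ge; first exact: is_cvg_einfs.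
case: uc => N _ HN; exists N => // n /= Nn; apply: le_ereal_inf_tmp => _ [m /= nm <-].
by apply: HN => /=; exact: leq_trans nm.
Qed.

Lemma le_limn_einf (u v : (\bar R)^nat) : (forall n, u n <= v n)%E ->
  (limn_einf u <= limn_einf v)%E.
Proof.
move=> uv; rewrite !limn_einf_lim; apply: lee_lim; [exact: is_cvg_einfs..|].
apply: nearW => n; apply: le_ereal_inf_tmp => _ [m /= nm <-].
by apply: le_trans (uv m); apply: ereal_inf_lbound; exists m.
Qed.

Lemma measurable_fun_limn_einf (f : nat -> T -> \bar R) :
  (forall n, measurable_fun setT (f n)) ->
  measurable_fun setT (fun w => limn_einf (f^~ w)).
Proof.
move=> mf; apply: (@emeasurable_fun_cvg _ _ _ _ (fun n w => einfs (f^~ w) n)).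
  by move=> n; exact: measurable_fun_einfs.
by move=> w _; rewrite limn_einf_lim; exact: is_cvg_einfs.
Qed.

Lemma fatou_le (f : nat -> T -> \bar R) (g : T -> \bar R) (c : \bar R) :
  (forall n, measurable_fun setT (f n)) -> (forall n w, 0 <= f n w)%E ->
  measurable_fun setT g -> (forall w, 0 <= g w)%E ->
  (forall w, g w <= limn_einf (f^~ w))%E ->
  (forall n, \int[mu]_w f n w <= c)%E -> (\int[mu]_w g w <= c)%E.
Proof.
move=> mf f0 mg g0 gf fc.
apply: (@le_trans _ _ (\int[mu]_w limn_einf (f^~ w))%E).
  by apply: ge0_le_integral => //; exact: measurable_fun_limn_einf.
by apply: le_trans (limn_einf_le fc); apply: fatou.
Qed.

End fatou_bound.

Section levy.
Context d (T : measurableType d) (R : realType) (P : probability T R)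
  (F : R -> set (set T)) (X : R -> T -> R).
Hypotheses (fF : is_filtration F) (lX : levy_process P F X).

Lemma levy_X0 w : X 0 w = 0. Proof. by case: lX => -[]. Qed.

Lemma levy_cadlag w : cadlag (X^~ w).
Proof. by case: lX => -[_ rc ll] _; split=> t t0; [exact: rc|exact: ll]. Qed.

(** The filtration is a bare family of sets; [adapted_atP] translates to [measurable_fun] on the
    type generated by [F s], where the closure properties are available. *)
Definition adapted_at d' (U : measurableType d') (s : R) (Z : T -> U) : Prop :=
  forall B, measurable B -> F s (Z @^-1` B).

Lemma adapted_atP d' (U : measurableType d') (s : R) (Z : T -> U) : 0 <= s ->
  adapted_at s Z <-> @measurable_fun _ _ (g_sigma_algebraType (F s)) U setT Z.
Proof.
move=> s0; case: fF => /(_ s s0) sF _ _; split => [aZ _ B mB|mZ B mB].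
  by rewrite setTI; apply: sub_sigma_algebra; exact: aZ.
by have := mZ measurableT B mB; rewrite setTI /measurable/= sigma_algebra_id.
Qed.

Lemma adapted_measurable d' (U : measurableType d') (s : R) (Z : T -> U) : 0 <= s ->
  adapted_at s Z -> measurable_fun setT Z.
Proof.
move=> s0 aZ _ B mB; rewrite setTI; case: fF => _ /(_ s s0) sF _.
by apply: sF; exact: aZ.
Qed.

Lemma adapted_le d' (U : measurableType d') (s t : R) (Z : T -> U) : 0 <= s -> s <= t ->
  adapted_at s Z -> adapted_at t Z.
Proof. by move=> s0 st aZ B mB; case: fF => _ _ /(_ s t s0 st); apply; exact: aZ. Qed.

Lemma levy_adapted t : 0 <= t -> adapted_at t (X t).
Proof. by move=> t0 B mB; case: lX => _ [aX _ _]; exact: aX. Qed.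

Lemma levy_measurable t : 0 <= t -> measurable_fun setT (X t).
Proof. by move=> t0; apply: (adapted_measurable t0); exact: levy_adapted. Qed.

Lemma levy_markov d' (U : measurableType d') (s h : R) (Z : T -> U) (phi : U * R -> \bar R) :
  0 <= s -> 0 <= h -> adapted_at s Z -> measurable_fun setT phi ->
  (forall z, (0 <= phi z)%E) ->
  (\int[P]_w phi (Z w, (X (s + h) w - X s w)%R) = \int[P]_w \int[P]_w' phi (Z w, X h w'))%E.
Proof.
move=> s0 h0 aZ mphi phi0; have sh0 : 0 <= s + h by rewrite addr_ge0.
have ssh : s <= s + h by rewrite lerDl.
apply: independent_pair_integral => //.
- exact: adapted_measurable aZ.
- by apply: measurable_funB; exact: levy_measurable.
- exact: levy_measurable.
move=> A B mA mB; case: lX => _ [_ indep stat].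
have := indep s (s + h) s0 ssh (Z @^-1` A) B (aZ _ mA) mB.
by have := stat s (s + h) s0 ssh B mB; rewrite [s + h - s]addrAC subrr add0r => <- <-.
Qed.

Lemma grid_max_adapted h k : 0 < h -> adapted_at (k%:R * h) (fun w => grid_max (X^~ w) h k).
Proof.
move=> h0; have kh0 j : 0 <= j%:R * h by rewrite mulr_ge0// ltW.
elim: k => [|k ih].
  by apply/adapted_atP => //; exact: measurable_cst.
apply/adapted_atP => //=; apply: measurable_maxr.
  apply/adapted_atP => //; apply: adapted_le ih => //.
  by rewrite ler_pM2r// ler_nat.
by apply/adapted_atP => //; exact: levy_adapted.
Qed.

Lemma grid_max_measurable h k : 0 < h -> measurable_fun setT (fun w => grid_max (X^~ w) h k).
Proof.
move=> h0; apply: (@adapted_measurable _ _ (k%:R * h)); last exact: grid_max_adapted.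
by rewrite mulr_ge0// ltW.
Qed.

Variable q : R -> R.
Hypotheses (cq : continuous q) (q0 : forall y, 0 <= q y)
  (ndq : {homo q : x y / x <= y}).

(* The value of [E q (max z.1 (z.2 + max_(j <= k) X_(j h)))], computed backwards. *)
Fixpoint run_value (h : R) (k : nat) (z : R * R) : \bar R :=
  if k is j.+1 then (\int[P]_w run_value h j (Num.max z.1 z.2, z.2 + X h w)%R)%E
  else (q (Num.max z.1 z.2))%:E.

Lemma run_value_ge0 h k z : (0 <= run_value h k z)%E.
Proof.
by elim: k z => [z|k ih z]; rewrite /= ?lee_fin//; apply: integral_ge0.
Qed.

Lemma measurable_run_value h k : 0 <= h -> measurable_fun setT (run_value h k).
Proof.
move=> h0.
have mmax : measurable_fun setT (fun z : R * R => Num.max z.1 z.2).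
  by apply: measurable_maxr; [exact: measurable_fst|exact: measurable_snd].
elim: k => [|k ih] /=.
  apply/measurable_EFinP; apply: measurableT_comp mmax.
  exact: continuous_measurable_fun.
pose f (zw : (R * R) * T) := run_value h k (Num.max zw.1.1 zw.1.2, zw.1.2 + X h zw.2)%R.
apply: (@measurable_fun_fubini_tonelli_F _ _ _ _ _ P f).
  apply: measurableT_comp ih _; apply: measurable_fun_pair.
    exact: measurableT_comp mmax measurable_fst.
  apply: measurable_funD.
    exact: (measurableT_comp measurable_snd measurable_fst).
  exact: measurableT_comp (levy_measurable h0) measurable_snd.
by move=> z; exact: run_value_ge0.
Qed.

Lemma run_value_max h k m y : run_value h k (Num.max m y, y) = run_value h k (m, y).
Proof. by case: k => [|k] /=; rewrite -maxA maxxx. Qed.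

Lemma measurable_run_value_sect h k m y : 0 <= h ->
  measurable_fun setT (fun w => run_value h k (m, y + X h w)).
Proof.
move=> h0; apply: measurableT_comp; first exact: measurable_run_value.
apply: measurable_fun_pair; first exact: measurable_cst.
by apply: measurable_funD; [exact: measurable_cst|exact: levy_measurable].
Qed.

Lemma run_value_le h k m m' y : 0 <= h -> m <= m' ->
  (run_value h k (m, y) <= run_value h k (m', y))%E.
Proof.
move=> h0; elim: k m m' y => [|k ih] m m' y mm' /=.
  by rewrite lee_fin ndq// ge_max !le_max mm' lexx orbT.
apply: ge0_le_integral => //.
- by move=> w _; exact: run_value_ge0.
- exact: measurable_run_value_sect.
- exact: measurable_run_value_sect.
- by move=> w _; apply: ih; rewrite ge_max !le_max mm' lexx orbT.
Qed.

(** A nonnegative nondecreasing [q] with [q m = 0] vanishes on everything below [m], so a past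
    maximum [m] never contributes. *)
Lemma run_value_inactive h k m m' y : q m = 0 ->
  run_value h k (Num.max m m', y) = run_value h k (m', y).
Proof.
move=> qm; elim: k m' y => [|k ih] m' y /=.
  congr EFin; rewrite -maxA; have [//|h'] := leP m (Num.max m' y).
  by rewrite qm; apply/eqP; rewrite eq_le q0 -qm ndq// ltW.
by apply: eq_integral => w _; rewrite -maxA ih.
Qed.

Lemma run_position_adapted h k x : 0 < h -> adapted_at (k%:R * h)
  (fun w => (x + grid_max (X^~ w) h k, x + X (k%:R * h) w)).
Proof.
move=> h0; have kh0 : 0 <= k%:R * h by rewrite mulr_ge0// ltW.
apply/adapted_atP => //; apply: measurable_fun_pair.
  apply: measurable_funD; first exact: measurable_cst.
  by apply/adapted_atP => //; exact: grid_max_adapted.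
apply: measurable_funD; first exact: measurable_cst.
by apply/adapted_atP => //; exact: levy_adapted.
Qed.

(** The Markov property at time [i h] replaces the fresh increment inside [run_value] by the true
    increment of the path. *)
Lemma run_value_step h k i x : 0 < h ->
  (\int[P]_w run_value h k.+1 (x + grid_max (X^~ w) h i, x + X (i%:R * h) w)%R =
   \int[P]_w run_value h k (x + grid_max (X^~ w) h i.+1, x + X (i.+1%:R * h) w)%R)%E.
Proof.
move=> h0; have ih0 : 0 <= i%:R * h by rewrite mulr_ge0// ltW.
pose phi (z : (R * R) * R) := run_value h k (Num.max z.1.1 z.1.2, z.1.2 + z.2)%R.
have mphi : measurable_fun setT phi.
  apply: measurableT_comp; first exact: measurable_run_value (ltW h0).
  apply: measurable_fun_pair.
    apply: measurable_maxr.
      exact: (measurableT_comp measurable_fst measurable_fst).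
    exact: (measurableT_comp measurable_snd measurable_fst).
  apply: measurable_funD; last exact: measurable_snd.
  exact: (measurableT_comp measurable_snd measurable_fst).
have := @levy_markov _ _ (i%:R * h) h _ phi ih0 (ltW h0) (@run_position_adapted h i x h0) mphi
  (fun z => run_value_ge0 _ _ _).
rewrite /phi/= => <-; apply: eq_integral => w _.
have -> : i%:R * h + h = i.+1%:R * h by rewrite -natr1 mulrDl mul1r.
have -> : x + X (i%:R * h) w + (X (i.+1%:R * h) w - X (i%:R * h) w) = x + X (i.+1%:R * h) w.
  by ring.
rewrite (max_idPl _) ?lerD2l ?le_grid_max ?levy_X0//.
by rewrite /= addr_maxr run_value_max.
Qed.

Lemma run_valueE h k x : 0 < h ->
  run_value h k (x, x) = (\int[P]_w (q (x + grid_max (X^~ w) h k)%R)%:E)%E.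
Proof.
move=> h0.
(* Generalised to a path already run for [i] steps, so that the induction on [k] hands one step at a
   time from the recursion to the path. *)
suff H i : (\int[P]_w run_value h k (x + grid_max (X^~ w) h i, x + X (i%:R * h) w)%R =
   \int[P]_w (q (x + grid_max (X^~ w) h (i + k)%N)%R)%:E)%E.
  rewrite -[k in RHS]add0n -H; under eq_integral do rewrite /= mul0r levy_X0 addr0.
  by rewrite integral_cst//= probability_setT mule1.
elim: k i => [|k ih] i; last by rewrite run_value_step// ih addSnnS.
apply: eq_integral => w _; rewrite addn0 /=.
by rewrite (max_idPl _)// lerD2l le_grid_max// levy_X0.
Qed.

Variable r : R.
Hypothesis r0 : 0 < r.

(** The probability that an exponential time of parameter [r] falls in [(k h, (k + 1) h]]. *)
Definition geom_weight (h : R) (k : nat) : R := (1 - expR (- (r * h))) * expR (- (r * h)) ^+ k.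

Lemma geom_weight_ge0 h k : 0 <= h -> 0 <= geom_weight h k.
Proof.
move=> h0; rewrite mulr_ge0 ?exprn_ge0 ?expR_ge0// subr_ge0 -[leRHS]expR0 ler_expR.
by rewrite oppr_le0 mulr_ge0// ltW.
Qed.

(* [E q (x + M_N)] for [N] geometric, the grid approximation of [E q (x + S)]. *)
Definition grid_value (h x : R) : \bar R :=
  (\sum_(0 <= k <oo) (geom_weight h k)%:E * run_value h k (x, x))%E.

Let term_ge0 h k x : 0 <= h -> (0 <= (geom_weight h k)%:E * run_value h k (x, x))%E.
Proof. by move=> h0; rewrite mule_ge0 ?lee_fin ?geom_weight_ge0// run_value_ge0. Qed.

Lemma grid_value_ge0 h x : 0 <= h -> (0 <= grid_value h x)%E.
Proof. by move=> h0; apply: nneseries_ge0 => k _ _; exact: term_ge0. Qed.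

Let mterm h k : 0 <= h ->
  measurable_fun setT (fun x => ((geom_weight h k)%:E * run_value h k (x, x))%E).
Proof.
move=> h0; apply: emeasurable_funM; first exact: measurable_cst.
apply: measurableT_comp; first exact: measurable_run_value.
exact: measurable_fun_pair.
Qed.

Lemma measurable_grid_value h : 0 <= h -> measurable_fun setT (grid_value h).
Proof.
move=> h0; apply: ge0_emeasurable_sum => [k x _ _|k _]; first exact: term_ge0.
exact: mterm.
Qed.

Lemma run_value_shift_le h k x : 0 < h ->
  (\int[P]_w run_value h k (x + X h w, x + X h w)%R <= run_value h k.+1 (x, x))%E.
Proof.
move=> h0 /=; have m1 : measurable_fun setT (fun w => run_value h k (x + X h w, x + X h w)).
  apply: measurableT_comp; first exact: measurable_run_value (ltW h0).
  by apply: measurable_fun_pair; apply: measurable_funD => //; exact: levy_measurable (ltW h0).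
apply: ge0_le_integral => //.
- by move=> w _; exact: run_value_ge0.
- exact: measurable_run_value_sect (ltW h0).
- move=> w _; rewrite maxxx -[leRHS]run_value_max; apply: run_value_le (ltW h0) _.
  by rewrite le_max lexx orbT.
Qed.

Lemma run_value_shift_eq h k x : 0 < h -> q x = 0 ->
  (\int[P]_w run_value h k (x + X h w, x + X h w)%R = run_value h k.+1 (x, x))%E.
Proof.
move=> h0 qx /=; apply: eq_integral => w _.
by rewrite maxxx -[RHS]run_value_max run_value_inactive.
Qed.

(** Lack of memory in discrete form: the factor [e^{- r h}] turns the weight of [k] into that of
    [k + 1]. *)
Lemma grid_value_shift h x : 0 < h ->
  ((expR (- (r * h)))%:E * \int[P]_w grid_value h (x + X h w)%R =
   \sum_(0 <= k <oo) (geom_weight h k.+1)%:E *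
     \int[P]_w run_value h k (x + X h w, x + X h w)%R)%E.
Proof.
move=> h0; have h0' := ltW h0.
have mX : measurable_fun setT (fun w => x + X h w).
  by apply: measurable_funD => //; exact: levy_measurable.
rewrite /grid_value integral_nneseries//; last 2 first.
- by move=> k; exact: (measurableT_comp (mterm k h0') mX).
- by move=> k w _; exact: term_ge0.
rewrite -nneseriesZl; last by move=> k _; apply: integral_ge0 => w _; exact: term_ge0.
apply: eq_eseriesr => k _; rewrite ge0_integralZl//; last 3 first.
- apply: measurableT_comp; first exact: measurable_run_value.
  exact: measurable_fun_pair.
- by move=> w _; exact: run_value_ge0.
- by rewrite lee_fin geom_weight_ge0.
by rewrite muleA -EFinM /geom_weight mulrCA -exprS.
Qed.

Lemma grid_value_recl h x : 0 < h -> grid_value h x =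
  ((geom_weight h 0)%:E * (q x)%:E +
   \sum_(0 <= k <oo) (geom_weight h k.+1)%:E * run_value h k.+1 (x, x))%E.
Proof.
move=> h0; rewrite /grid_value nneseries_recl//; last first.
  by move=> k _; exact: (@term_ge0 h k x (ltW h0)).
rewrite [run_value h 0 _]/= maxxx; congr (_ + _)%E.
rewrite -(@nneseries_addn _ (fun k => ((geom_weight h k)%:E * run_value h k (x, x))%E) 1)%N.
  by apply: eq_eseriesr => k _; rewrite addn1.
by move=> k; exact: (@term_ge0 h k x (ltW h0)).
Qed.

(** Two things are lost in a step: the term [k = 0], and the starting point [x] in every later
    maximum. Both losses vanish when [q x = 0], which gives [grid_value_harmonic]. *)
Lemma grid_value_excessive h x : 0 < h ->
  ((expR (- (r * h)))%:E * \int[P]_w grid_value h (x + X h w)%R <= grid_value h x)%E.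
Proof.
move=> h0; rewrite grid_value_shift// grid_value_recl// -[leLHS]add0e.
apply: leeD; first by rewrite mule_ge0 ?lee_fin ?geom_weight_ge0 ?q0 ?(ltW h0)//.
apply: lee_nneseries => [k _ _|k _].
  rewrite mule_ge0 ?lee_fin ?geom_weight_ge0 ?(ltW h0)//.
  by apply: integral_ge0 => w _; exact: run_value_ge0.
by rewrite lee_wpmul2l ?lee_fin ?geom_weight_ge0 ?(ltW h0)// run_value_shift_le.
Qed.

Lemma grid_value_harmonic h x : 0 < h -> q x = 0 ->
  ((expR (- (r * h)))%:E * \int[P]_w grid_value h (x + X h w)%R = grid_value h x)%E.
Proof.
move=> h0 qx; rewrite grid_value_shift// grid_value_recl// qx mule0 add0e.
by apply: eq_eseriesr => k _; rewrite run_value_shift_eq.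
Qed.

End levy.

Section integral_ite.
Context d (T : measurableType d) (R : realType) (mu : measure T R).

Lemma measurable_fun_ite d' (T' : measurableType d') (b : T -> bool) (f g : T -> T') :
  measurable [set w | b w] -> measurable_fun setT f -> measurable_fun setT g ->
  measurable_fun setT (fun w => if b w then f w else g w).
Proof.
move=> mb mf mg; apply: measurable_fun_ifT => //.
by apply: (measurable_fun_bool true); rewrite setTI.
Qed.

Lemma integral_ite (b : T -> bool) (f g : T -> \bar R) :
  measurable [set w | b w] -> measurable_fun setT f -> measurable_fun setT g ->
  (forall w, 0 <= f w)%E -> (forall w, 0 <= g w)%E ->
  (\int[mu]_w (if b w then f w else g w) =
   \int[mu]_(w in [set w | b w]) f w + \int[mu]_(w in ~` [set w | b w]) g w)%E.
Proof.
move=> mb mf mg f0 g0.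
rewrite -[X in integral _ X](setUv [set w | b w]) ge0_integral_setU//; last 4 first.
- exact: measurableC.
- by rewrite setUv; exact: measurable_fun_ite.
- by move=> w _; case: ifP.
- exact/disj_setPCl.
congr (_ + _)%E; apply: eq_integral => w; rewrite inE/= => h; first by rewrite h.
by move/negP/negbTE: h => ->.
Qed.

End integral_ite.

(** * Optional stopping along a fixed grid *)

Section optional_stopping.
Context d (T : measurableType d) (R : realType) (P : probability T R)
  (F : R -> set (set T)) (X : R -> T -> R).
Hypotheses (fF : is_filtration F) (lX : levy_process P F X).

Lemma stopping_time_measurable_le (theta : T -> \bar R) t : stopping_time F theta ->
  0 <= t -> measurable [set w | (theta w <= t%:E)%E].
Proof. by move=> [_ h] t0; case: fF => _ /(_ t t0) sF _; apply: sF; exact: h. Qed.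

Variables (r h x : R) (g : R -> \bar R) (theta : T -> \bar R).
Hypotheses (r0 : 0 < r) (h0 : 0 < h) (mg : measurable_fun setT g)
  (g0 : forall y, (0 <= g y)%E) (sth : stopping_time F theta).

Definition grid_stopped (w : T) : \bar R :=
  if theta w is t%:E then
    ((expR (- (r * grid_ceil h t)))%:E * g (x + X (grid_ceil h t) w)%R)%E
  else 0%E.

(** The discounted value at the smaller of [k h] and [theta] rounded up to the grid. The recursion
    freezes on [theta <= j h], an event of [F (j h)], so consecutive terms differ by one Markov
    step. *)
Fixpoint grid_stopped_upto (k : nat) (w : T) : \bar R :=
  if k is j.+1 then
    if (theta w <= (j%:R * h)%:E)%E then grid_stopped_upto j w
    else ((expR (- (r * (j.+1%:R * h))))%:E * g (x + X (j.+1%:R * h) w)%R)%E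
  else g x.

Let kh0 k : 0 <= k%:R * h. Proof. by rewrite mulr_ge0// ltW. Qed.

Let mb k : measurable [set w | (theta w <= (k%:R * h)%:E)%E].
Proof. exact: stopping_time_measurable_le. Qed.

Let mshift t : 0 <= t -> measurable_fun setT (fun w => g (x + X t w)).
Proof.
move=> t0; apply: measurableT_comp => //; apply: measurable_funD => //.
exact: (levy_measurable fF lX).
Qed.

Let mterm k : measurable_fun setT
  (fun w => ((expR (- (r * (k%:R * h))))%:E * g (x + X (k%:R * h) w)%R)%E).
Proof. by apply: emeasurable_funM; [exact: measurable_cst|exact: mshift]. Qed.

Lemma grid_stopped_ge0 w : (0 <= grid_stopped w)%E.
Proof.
by rewrite /grid_stopped; case: (theta w) => // t; rewrite mule_ge0// lee_fin expR_ge0.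
Qed.

Lemma grid_stopped_upto_ge0 k w : (0 <= grid_stopped_upto k w)%E.
Proof. by elim: k => //= k ih; case: ifP => // _; rewrite mule_ge0// lee_fin expR_ge0. Qed.

Lemma measurable_grid_stopped_upto k : measurable_fun setT (grid_stopped_upto k).
Proof.
elim: k => [|k ih]; first exact: measurable_cst.
exact: measurable_fun_ite.
Qed.

Lemma grid_stopped_upto_gt k w : ((k%:R * h)%:E < theta w)%E ->
  grid_stopped_upto k w = ((expR (- (r * (k%:R * h))))%:E * g (x + X (k%:R * h) w)%R)%E.
Proof.
case: k => [|k] hk /=.
  by rewrite mul0r mulr0 oppr0 expR0 mul1e (levy_X0 lX) addr0.
rewrite ifF//; apply/negbTE; rewrite -ltNge; apply: le_lt_trans hk.
by rewrite lee_fin ler_pM2r// ler_nat.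
Qed.

Lemma grid_stopped_upto_le k w : (theta w <= (k%:R * h)%:E)%E ->
  grid_stopped_upto k w = grid_stopped w.
Proof.
elim: k => [|k ih] hk /=; last first.
  case: ifPn => [/ih//|]; rewrite -ltNge.
  have := sth.1 w; move: hk; rewrite /grid_stopped; case: (theta w) => //= t.
  rewrite !lee_fin lte_fin => tk t0 kt.
  have -> : grid_ceil h t = k.+1%:R * h.
    rewrite /grid_ceil; congr (_%:R * h); apply/eqP; rewrite eqn_leq.
    have th0 : 0 <= t / h by rewrite divr_ge0// ltW.
    by rewrite ceiln_ler// ler_pdivrMr// tk ceiln_lt// ltr_pdivlMr.
  by [].
have := sth.1 w; move: hk; rewrite mul0r => h1 h2.
have t0 : theta w = 0%:E by apply/eqP; rewrite eq_le h1 h2.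
by rewrite /grid_stopped t0 grid_ceil0 mulr0 oppr0 expR0 mul1e (levy_X0 lX) addr0.
Qed.

Lemma measurable_step_mean : measurable_fun setT (fun y : R => \int[P]_w g (y + X h w)%R)%E.
Proof.
pose f (yw : R * T) := g (yw.1 + X h yw.2).
apply: (@measurable_fun_fubini_tonelli_F _ _ _ _ _ P f); last by move=> z; exact: g0.
apply: measurableT_comp => //; apply: measurable_funD; first exact: measurable_fst.
by apply: measurableT_comp measurable_snd; apply: (levy_measurable fF lX); exact: ltW.
Qed.

(** The event [theta > k h] belongs to [F (k h)]; carried as a boolean coordinate beside the
    position, it lets [levy_markov] act under the restriction. *)
Lemma markov_before_stopping k :
  (\int[P]_(w in ~` [set w | theta w <= (k%:R * h)%:E]) g (x + X (k.+1%:R * h) w)%R =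
   \int[P]_(w in ~` [set w | theta w <= (k%:R * h)%:E])
     \int[P]_w' g (x + X (k%:R * h) w + X h w')%R)%E.
Proof.
pose b w := ~~ (theta w <= (k%:R * h)%:E)%E.
have bE : ~` [set w | (theta w <= (k%:R * h)%:E)%E] = [set w | b w].
  by apply/seteqP; split=> w /= /negP.
have mbb : measurable [set w | b w] by rewrite -bE; exact: measurableC.
have toif (G : T -> \bar R) : (\int[P]_(w in [set w | b w]) G w =
    \int[P]_w (if b w then G w else 0))%E.
  rewrite integral_mkcond; apply: eq_integral => w _; rewrite patchE.
  case: ifPn; rewrite ?inE ?notin_setE/= => hb; first by rewrite hb.
  by move/negP/negbTE: hb => ->.
rewrite bE !toif.
pose phi (z : (bool * R) * R) : \bar R := if z.1.1 then g (z.1.2 + z.2) else 0%E.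
have mphi : measurable_fun setT phi.
  apply: (@measurable_fun_ite _ _ _ _ (fun z : (bool * R) * R => z.1.1)).
  - have mff : measurable_fun setT (fun z : (bool * R) * R => z.1.1).
      exact: (measurableT_comp measurable_fst measurable_fst).
    have := mff measurableT [set true] I; rewrite setTI.
    by congr measurable; apply/seteqP; split.
  - apply: measurableT_comp => //; apply: measurable_funD; last exact: measurable_snd.
    exact: (measurableT_comp measurable_snd measurable_fst).
  - exact: measurable_cst.
have phi0 z : (0 <= phi z)%E by rewrite /phi; case: ifP.
have aZ : adapted_at F (k%:R * h) (fun w => (b w, x + X (k%:R * h) w)).
  apply/(adapted_atP fF) => //; apply: measurable_fun_pair.
    apply: (measurable_fun_bool true); rewrite setTI.
    apply: sub_sigma_algebra.
    have -> : b @^-1` [set true] = ~` [set w | (theta w <= (k%:R * h)%:E)%E].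
      by rewrite bE.
    have := sth.2 _ (kh0 k); case: fF => /(_ _ (kh0 k))[_ FC _] _ _ /FC.
    by rewrite setTD.
  apply: measurable_funD; first exact: measurable_cst.
  by apply/(adapted_atP fF) => //; exact: (levy_adapted lX).
have := levy_markov fF lX (kh0 k) (ltW h0) aZ mphi phi0; rewrite /phi/=.
have e : k%:R * h + h = k.+1%:R * h by rewrite -natr1 mulrDl mul1r.
rewrite e => H.
transitivity (\int[P]_w (if b w then
  g (x + X (k%:R * h) w + (X (k.+1%:R * h) w - X (k%:R * h) w)) else 0))%E.
  apply: eq_integral => w _; case: ifP => // _; congr g; ring.
rewrite H; apply: eq_integral => w _; case: ifP => // _.
by rewrite integral0.
Qed.

Let A k := [set w | (theta w <= (k%:R * h)%:E)%E].

Let uptoS k : (\int[P]_w grid_stopped_upto k.+1 w = \int[P]_(w in A k) grid_stopped_upto k w +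
  \int[P]_(w in ~` A k) ((expR (- (r * (k%:R * h))))%:E *
     ((expR (- (r * h)))%:E * \int[P]_w' g (x + X (k%:R * h) w + X h w')%R)))%E.
Proof.
rewrite /= integral_ite//; last 3 first.
- exact: measurable_grid_stopped_upto.
- exact: grid_stopped_upto_ge0.
- by move=> w; rewrite mule_ge0// lee_fin expR_ge0.
congr (_ + _)%E.
rewrite ge0_integralZl//; last 2 first.
- by apply: measurableC; exact: mb.
- exact/measurable_funTS/mshift.
rewrite markov_before_stopping.
have mK : measurable_fun (~` A k) (fun w => \int[P]_w' g (x + X (k%:R * h) w + X h w')%R)%E.
  apply: measurable_funTS.
  apply: (measurableT_comp measurable_step_mean); apply: measurable_funD => //.
  by apply: (levy_measurable fF lX).
rewrite -ge0_integralZl//; last 2 first.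
- by apply: measurableC; exact: mb.
- by move=> w _; apply: integral_ge0.
apply: eq_integral => w _; rewrite muleA -EFinM -expRD; congr (_%:E * _)%E.
by congr expR; rewrite -natr1; ring.
Qed.

(** Written in the shape of [uptoS]: the integrals over [A k] coincide, and off [A k] it remains to
    compare [g] with its discounted one-step mean. *)
Let uptoE k : (\int[P]_w grid_stopped_upto k w = \int[P]_(w in A k) grid_stopped_upto k w +
  \int[P]_(w in ~` A k) ((expR (- (r * (k%:R * h))))%:E * g (x + X (k%:R * h) w)%R))%E.
Proof.
rewrite -integral_ite//; last 3 first.
- exact: measurable_grid_stopped_upto.
- exact: grid_stopped_upto_ge0.
- by move=> w; rewrite mule_ge0// lee_fin expR_ge0.
apply: eq_integral => w _; case: ifPn => //; rewrite -ltNge => /grid_stopped_upto_gt ->.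
by [].
Qed.

Let mK k : measurable_fun (~` A k) (fun w => (expR (- (r * (k%:R * h))))%:E *
  ((expR (- (r * h)))%:E * \int[P]_w' g (x + X (k%:R * h) w + X h w')%R))%E.
Proof.
apply: measurable_funTS; apply: emeasurable_funM; first exact: measurable_cst.
apply: emeasurable_funM; first exact: measurable_cst.
apply: (measurableT_comp measurable_step_mean); apply: measurable_funD => //.
by apply: (levy_measurable fF lX).
Qed.

Let int_g0 : (\int[P]_w grid_stopped_upto 0 w = g x)%E.
Proof. by rewrite /= integral_cst//= probability_setT mule1. Qed.

Lemma measurable_grid_stopped : measurable_fun setT grid_stopped.
Proof.
pose f k w := if (theta w <= (k%:R * h)%:E)%E then grid_stopped_upto k w else 0%E.
apply: (@emeasurable_fun_cvg _ _ _ _ f).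
  by move=> k; apply: measurable_fun_ite => //; exact: measurable_grid_stopped_upto.
move=> w _; case Et : (theta w) => [t| |].
- apply: cvg_near_cst; exists (ceiln (t / h)) => // k /= hk.
  have t0 : 0 <= t by have := sth.1 w; rewrite Et lee_fin.
  have tk : (theta w <= (k%:R * h)%:E)%E.
    rewrite Et lee_fin -ler_pdivrMr// -ceiln_ler// divr_ge0// ltW//.
  by rewrite /f tk grid_stopped_upto_le.
- apply: cvg_near_cst; apply: nearW => k.
  by rewrite /f Et/= /grid_stopped Et.
- by have := sth.1 w; rewrite Et.
Qed.

Let stop_eventually w : theta w != +oo%E ->
  \forall k \near \oo, grid_stopped_upto k w = grid_stopped w.
Proof.
case Et : (theta w) => [t| |] // _; last by have := sth.1 w; rewrite Et.
exists (ceiln (t / h)) => // k /= hk; apply: grid_stopped_upto_le.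
have t0 : 0 <= t by have := sth.1 w; rewrite Et lee_fin.
by rewrite Et lee_fin -ler_pdivrMr// -ceiln_ler// divr_ge0// ltW.
Qed.

(** The means of [grid_stopped_upto k] decrease from [g x]. Fatou's lemma passes to the limit; on
    [theta = +oo] the target is 0 and nonnegativity suffices. *)
Lemma grid_stopped_le : 
  (forall y : R, (expR (- (r * h)))%:E * \int[P]_w g (y + X h w)%R <= g y)%E ->
  (\int[P]_w grid_stopped w <= g x)%E.
Proof.
move=> gexc.
have dec k : (\int[P]_w grid_stopped_upto k w <= g x)%E.
  elim: k => [|k ih]; first by rewrite int_g0.
  apply: le_trans ih; rewrite uptoS uptoE leeD2l//.
  apply: ge0_le_integral => //.
  - by apply: measurableC; exact: mb.
  - move=> w _; rewrite !mule_ge0 ?lee_fin ?expR_ge0//.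
    by apply: integral_ge0.
  - exact/measurable_funTS/mterm.
  - by move=> w _; rewrite lee_wpmul2l// lee_fin expR_ge0.
apply: (@fatou_le _ _ _ P grid_stopped_upto) => //.
- exact: measurable_grid_stopped_upto.
- by move=> k w; exact: grid_stopped_upto_ge0.
- exact: measurable_grid_stopped.
- exact: grid_stopped_ge0.
- move=> w; have [too|tfin] := eqVneq (theta w) +oo%E.
    rewrite /grid_stopped too; apply: limn_einf_ge.
    by apply: nearW => k; exact: grid_stopped_upto_ge0.
  apply: limn_einf_ge.
  by apply: filterS (stop_eventually tfin) => k ->.
Qed.

(* Before [theta] the process sits below [b], where [g] is bounded, so discounting kills
   the contribution of [theta > k h]. *)
Lemma grid_stopped_ge (b K : R) :
  (forall y : R, y < b -> ((expR (- (r * h)))%:E * \int[P]_w g (y + X h w)%R = g y)%E) ->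
  (forall y : R, y < b -> (g y <= K%:E)%E) ->
  (forall w (t : R), 0 <= t -> (t%:E < theta w)%E -> x + X t w < b) ->
  (g x <= \int[P]_w grid_stopped w)%E.
Proof.
move=> gh gK thb; set rho := expR (- (r * h)).
have rho1 : rho < 1 by rewrite -[ltRHS]expR0 ltr_expR oppr_lt0 mulr_gt0.
have inc k : (\int[P]_w grid_stopped_upto k w = g x)%E.
  elim: k => [|k ih]; first by rewrite int_g0.
  rewrite -ih uptoS [RHS]uptoE; congr (_ + _)%E; apply: eq_integral => w.
  by rewrite inE/= => /negP; rewrite -ltNge => kt; rewrite gh// thb.
have K0 : (0 <= K%:E)%E by apply: le_trans (g0 (b - 1)) (gK _ _); rewrite ltrBlDr ltrDl.
have bd k : (g x <= \int[P]_w grid_stopped w + (rho ^+ k * K)%:E)%E.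
  rewrite -(inc k).
  apply: (@le_trans _ _ (\int[P]_w (grid_stopped w + ((rho ^+ k * K)%:E)))%E).
    apply: ge0_le_integral => //.
    - by move=> w _; exact: grid_stopped_upto_ge0.
    - exact: measurable_grid_stopped_upto.
    - apply: emeasurable_funD; first exact: measurable_grid_stopped.
      exact: measurable_cst.
    - move=> w _; have rK : (0 <= (rho ^+ k * K)%:E)%E.
        by rewrite lee_fin mulr_ge0 ?exprn_ge0 ?expR_ge0.
      have [tk|tk] := leP (theta w) (k%:R * h)%:E.
        by rewrite grid_stopped_upto_le// leeDl.
      rewrite grid_stopped_upto_gt// -[leLHS]add0e; apply: leeD.
        exact: grid_stopped_ge0.
      rewrite EFinM lee_pmul ?lee_fin ?expR_ge0//.
        by rewrite /rho -expRM_natl mulrN mulrCA lexx.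
      by rewrite gK// thb.
  rewrite ge0_integralD//; last 3 first.
  - by move=> w _; exact: grid_stopped_ge0.
  - exact: measurable_grid_stopped.
  - by move=> w _; rewrite lee_fin mulr_ge0 ?exprn_ge0 ?expR_ge0.
  by rewrite integral_cst//= probability_setT mule1.
apply/lee_addgt0Pr => e e0.
have : rho ^+ k * K @[k --> \oo] --> 0 * K.
  by apply: cvgMl; apply: cvg_expr; rewrite ger0_norm ?expR_ge0.
rewrite mul0r => /cvgrPdist_le/(_ _ e0)[k _ /(_ k (leqnn k))] /=.
rewrite sub0r normrN => /(le_trans (ler_norm _)) ke.
by apply: le_trans (bd k) _; rewrite leeD2l// lee_fin.
Qed.

End optional_stopping.

(** * The exponential horizon *)

Section exponential_horizon.
Context d (T : measurableType d) (R : realType) (P : probability T R)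
  (F : R -> set (set T)) (X : R -> T -> R).
Hypotheses (fF : is_filtration F) (lX : levy_process P F X).
Variables (r : R) (e : T -> R).
Hypotheses (r0 : 0 < r) (eX : exp_indep P X r e).

(** The restriction to nonnegative times is what makes these events measurable. *)
Definition path_rectangle : set (set T) :=
  [set A | exists (n : nat) (ts : 'I_n -> R) (Bs : 'I_n -> set R),
     [/\ forall i, 0 <= ts i, forall i, measurable (Bs i) &
         A = [set w | forall i, Bs i (X (ts i) w)]]].

Lemma measurable_exp_horizon : measurable_fun setT e.
Proof. by case: eX. Qed.

Lemma path_rectangle_measurable : path_rectangle `<=` measurable.
Proof.
move=> _ [n [ts [Bs [ts0 mBs ->]]]].
rewrite (_ : [set w | _] = \bigcap_(i in [set: 'I_n]) (X (ts i) @^-1` Bs i)).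
  apply: fin_bigcap_measurable => // i _; rewrite -[X in measurable X]setTI.
  exact: (levy_measurable fF lX).
by apply/seteqP; split => [w h i _|w h i]; exact: h.
Qed.

Lemma path_rectangle_setI : setI_closed path_rectangle.
Proof.
move=> _ _ [n [ts [Bs [ts0 mBs ->]]]] [m [us [Cs [us0 mCs ->]]]].
exists (n + m)%N,
  (fun i : 'I_(n + m) => match fintype.split i with inl j => ts j | inr j => us j end),
  (fun i : 'I_(n + m) => match fintype.split i with inl j => Bs j | inr j => Cs j end); split.
- by move=> i; case: fintype.split.
- by move=> i; case: fintype.split.
apply/seteqP; split => [w [h1 h2] i|w h]; first by case: fintype.split.
split => i.
  have := h (lshift m i); case: fintype.splitP => j /= ij.
    by rewrite (_ : j = i)//; apply: val_inj.
  by have := ltn_ord i; rewrite ij ltnNge leq_addr.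
have := h (rshift n i); case: fintype.splitP => j /= ij.
  by have := ltn_ord j; rewrite -ij ltnNge leq_addr.
by rewrite (_ : j = i)//; apply: val_inj; apply: (@addnI n).
Qed.

Lemma path_rectangle1 t B : 0 <= t -> measurable B -> path_rectangle (X t @^-1` B).
Proof.
move=> t0 mB; exists 1%N, (fun=> t), (fun=> B); split => //.
by apply/seteqP; split => [w ? _//|w /(_ ord0)].
Qed.

(** Uniqueness of measures on a pi-system: the finite measures [P (e in C, .)] and
    [P (e in C) P (.)] agree on [path_rectangle]. *)
Lemma exp_horizon_indep A C : <<s path_rectangle >> A -> measurable C ->
  P (e @^-1` C `&` A) = (P (e @^-1` C) * P A)%E.
Proof.
move=> sA mC.
have mE : measurable (e @^-1` C).
  by rewrite -[X in measurable X]setTI; exact: measurable_exp_horizon.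
have fE : P (e @^-1` C) \is a fin_num by rewrite fin_num_measure.
have E0 : 0 <= fine (P (e @^-1` C)) by rewrite fine_ge0.
have rT : path_rectangle setT.
  exists 0%N, (fun=> 0), (fun=> setT); split => //.
  by apply/seteqP; split.
pose m1 : measure T R := mrestr P mE.
pose m2 : measure T R := mscale (NngNum E0) P.
have m1E B : m1 B = P (e @^-1` C `&` B) by rewrite setIC.
have m2E B : m2 B = (P (e @^-1` C) * P B)%E.
  by rewrite -[in RHS](fineK fE).
rewrite -m1E -m2E.
apply: (@g_sigma_algebra_measure_unique _ _ _ path_rectangle path_rectangle_measurable
  (fun=> setT) (fun=> rT) _ m1 m2 path_rectangle_setI) => //.
- by apply/seteqP; split => // w _; exists 0%N.
- move=> _ [n [ts [Bs [ts0 mBs ->]]]]; rewrite m1E m2E.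
  by case: eX => _ _ /(_ n ts Bs C mBs mC).
- by move=> _; rewrite m1E setIT -ge0_fin_numE.
Qed.

Lemma grid_max_path_measurable h k : 0 < h ->
  @measurable_fun _ _ (g_sigma_algebraType path_rectangle) R setT
    (fun w => grid_max (X^~ w) h k).
Proof.
move=> h0; elim: k => [|k ih] /=; first exact: measurable_cst.
apply: measurable_maxr => // _ B mB; rewrite setTI.
by apply: sub_sigma_algebra; apply: path_rectangle1 => //; rewrite mulr_ge0// ltW.
Qed.

Lemma exp_horizon_tail t : 0 <= t -> P [set w | t < e w] = (expR (- (r * t)))%:E.
Proof. by case: eX => _ + _; exact. Qed.

(** Open on the left, so that [ceiln (e / h)] is [k + 1] on the slice; the slices miss only the null
    event [e <= 0]. *)
Definition slice (h : R) (k : nat) : set T :=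
  [set w | k%:R * h < e w <= k.+1%:R * h].

Let measurable_tail t : measurable [set w | t < e w].
Proof.
rewrite (_ : [set w | _] = setT `&` e @^-1` `]t, +oo[%classic).
  by apply: measurable_exp_horizon.
by apply/seteqP; split => w /=; rewrite in_itv/= andbT; [split|case].
Qed.

Lemma sliceE h k : slice h k = e @^-1` `]k%:R * h, k.+1%:R * h]%classic.
Proof. by apply/seteqP; split => w /=; rewrite in_itv. Qed.

Lemma measurable_slice h k : measurable (slice h k).
Proof. by rewrite sliceE -[X in measurable X]setTI; exact: measurable_exp_horizon. Qed.

Lemma probability_slice h k : 0 < h -> P (slice h k) = (geom_weight r h k)%:E.
Proof.
move=> h0; have kh : k%:R * h <= k.+1%:R * h by rewrite ler_pM2r// ler_nat.
rewrite (_ : slice h k = [set w | k%:R * h < e w] `\` [set w | k.+1%:R * h < e w]); last first.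
  apply/seteqP; split => w /=.
    by move=> /andP[h1 h2]; split => //; apply/negP; rewrite -leNgt.
  by move=> [h1 /negP]; rewrite -leNgt => h2; apply/andP.
rewrite measureD//; last by rewrite -ge0_fin_numE// fin_num_measure.
rewrite (_ : _ `&` _ = [set w | k.+1%:R * h < e w]); last first.
  by apply/seteqP; split => w /=; [case|move=> h1; split => //; exact: le_lt_trans h1].
rewrite /= !exp_horizon_tail ?mulr_ge0 ?(ltW h0)// -EFinB /geom_weight; congr EFin.
rewrite mulrBl mul1r -exprS -!expRM_natl; congr (expR _ - expR _); ring.
Qed.

Lemma trivIset_slice h : 0 < h -> trivIset setT (slice h).
Proof.
move=> h0; apply/trivIsetP => i j _ _ ij; apply/seteqP; split => // w /= [].
have key (k : nat) : k%:R * h < e w <= k.+1%:R * h -> k.+1 = ceiln (e w / h).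
  move=> /andP[h1 h2]; have e0 : 0 <= e w / h.
    by rewrite divr_ge0 ?(ltW h0)// (le_trans _ (ltW h1))// mulr_ge0// ltW.
  apply/eqP; rewrite eqn_leq ceiln_lt// ceiln_ler// ltr_pdivlMr// h1.
  by rewrite ler_pdivrMr.
by move=> /key Ei /key; rewrite -Ei => -[] /eqP; rewrite eq_sym (negbTE ij).
Qed.

Lemma slice_ceiln h k w : 0 < h -> slice h k w -> ceiln (e w / h) = k.+1.
Proof.
move=> h0 /= /andP[h1 h2]; have e0 : 0 <= e w / h.
  by rewrite divr_ge0 ?(ltW h0)// (le_trans _ (ltW h1))// mulr_ge0// ltW.
apply/eqP; rewrite eqn_leq ceiln_lt// ceiln_ler// ltr_pdivlMr// h1.
by rewrite ler_pdivrMr// h2.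
Qed.

Lemma bigcup_slice h : 0 < h -> \bigcup_k slice h k = [set w | 0 < e w].
Proof.
move=> h0; apply/seteqP; split => w /=.
  move=> [k _ /andP[h1 _]]; apply: le_lt_trans h1.
  by rewrite mulr_ge0// ltW.
move=> ew; have eh : 0 < e w / h by rewrite divr_gt0.
have c0 : (0 < ceiln (e w / h))%N by rewrite ceiln_lt// ltW.
exists (ceiln (e w / h)).-1 => //; rewrite /slice prednK//=.
apply/andP; split; last by rewrite -ler_pdivrMr// ceiln_ge// ltW.
by rewrite -ltr_pdivlMr// -ceiln_lt ?(ltW eh)// prednK.
Qed.

Lemma exp_horizon_gt0 : P (~` [set w | 0 < e w]) = 0%E.
Proof.
rewrite probability_setC// exp_horizon_tail// mulr0 oppr0 expR0.
by rewrite subee.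
Qed.

Lemma slice_integral h k j (f : R -> \bar R) : 0 < h -> measurable_fun setT f ->
  (forall y, (0 <= f y)%E) ->
  (\int[P]_(w in slice h k) f (grid_max (X^~ w) h j) =
   (geom_weight r h k)%:E * \int[P]_w f (grid_max (X^~ w) h j))%E.
Proof.
move=> h0 mf f0.
have mM := grid_max_measurable fF lX j h0.
pose J := `]k%:R * h, k.+1%:R * h]%classic : set R.
pose phi (z : R * R) : \bar R := ((\1_J z.1)%:E * f z.2)%E.
have mphi : measurable_fun setT phi.
  apply: emeasurable_funM; last exact: measurableT_comp mf measurable_snd.
  apply/measurable_EFinP; apply: measurableT_comp measurable_fst.
  by apply: measurable_indic; exact: measurable_itv.
have phi0 z : (0 <= phi z)%E by rewrite mule_ge0// lee_fin.
have := @independent_pair_integral _ _ _ T R R R P e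
  (fun w => grid_max (X^~ w) h j) (fun w => grid_max (X^~ w) h j) phi
  measurable_exp_horizon mM mM _ mphi phi0.
have ms : measurable (slice h k) := measurable_slice h k.
have JE w : \1_J (e w) = \1_(slice h k) w :> R.
  by rewrite !indicE sliceE; congr (nat_of_bool _)%:R; apply/idP/idP; rewrite !inE.
have -> : (\int[P]_w phi (e w, grid_max (X^~ w) h j) =
    \int[P]_(w in slice h k) f (grid_max (X^~ w) h j))%E.
  rewrite [RHS]integral_mkcond; apply: eq_integral => w _.
  rewrite /phi JE indicE patchE; have [ws|ws] := boolP (w \in slice h k).
    by rewrite mul1e.
  by rewrite mul0e.
move=> ->; last first.
  move=> A B mA mB; apply: exp_horizon_indep => //.
  by have := grid_max_path_measurable j h0 measurableT mB; rewrite setTI.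
have int0 : (0 <= \int[P]_w f (grid_max (X^~ w) h j))%E by apply: integral_ge0.
transitivity (\int[P]_w ((\1_(slice h k) w)%:E * \int[P]_w f (grid_max (X^~ w) h j)))%E.
  apply: eq_integral => w _; rewrite /phi/= -JE ge0_integralZl//.
  by apply: measurableT_comp mf mM.
rewrite ge0_integralZr//; last first.
  by apply/measurable_EFinP; exact: measurable_indic.
by rewrite integral_indic// setIT /= probability_slice.
Qed.

Definition horizon_sup (w : T) : R := run_sup X e w.

Lemma horizon_supE w : horizon_sup w = path_sup (X^~ w) (e w).
Proof. by []. Qed.

Lemma horizon_sup_ge0 w : 0 <= horizon_sup w.
Proof. by apply: path_sup_ge0; [exact: (levy_cadlag lX)|exact: (levy_X0 lX)]. Qed.

(** [e] may be negative on a null set. Truncating it at 0 matches the default value of [horizon_sup]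
    there, so convergence holds at every [w] and measurability needs no completion. *)
Let gm (n : nat) (w : T) := grid_max (X^~ w) (mesh n) (ceiln (Num.max (e w) 0 / mesh n)).

Let mgm n : measurable_fun setT (gm n).
Proof.
have mc : measurable_fun setT (fun w => ceiln (Num.max (e w) 0 / mesh n)).
  move=> _ B mB; rewrite setTI.
  rewrite (_ : _ @^-1` B = \bigcup_(k in B) [set w | ceiln (Num.max (e w) 0 / mesh n) = k]).
    apply: bigcup_measurable => k _.
    have mt t : measurable [set w | Num.max (e w) 0 / mesh n <= t].
      have mf : measurable_fun setT (fun w => Num.max (e w) 0 / mesh n).
        apply: measurable_funM; last exact: measurable_cst.
        by apply: measurable_maxr => //; exact: measurable_exp_horizon.
      have := mf measurableT `]-oo, t]%classic (measurable_itv _).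
      by congr measurable; apply/seteqP; split => w /=; rewrite in_itv/=; [case|split].
    have ge0 w : 0 <= Num.max (e w) 0 / mesh n.
      by rewrite divr_ge0 ?le_max ?lexx ?orbT// ltW// mesh_gt0.
    case: k => [|k].
      rewrite (_ : [set w | _] = [set w | Num.max (e w) 0 / mesh n <= 0])//.
      apply/seteqP; split => w /=; first by move=> c0; rewrite -(ceiln_ler 0) ?c0.
      by rewrite -(ceiln_ler 0)// leqn0 => /eqP.
    rewrite (_ : [set w | _] = [set w | Num.max (e w) 0 / mesh n <= k.+1%:R] `\`
        [set w | Num.max (e w) 0 / mesh n <= k%:R]).
      exact: measurableD.
    apply/seteqP; split => w /=; rewrite -!ceiln_ler//.
      by move=> ->; rewrite ltnn; split.
    by move=> [h1 /negP]; rewrite -ltnNge => h2; apply/eqP; rewrite eqn_leq h1.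
  apply/seteqP; split => [w Bw|w [k Bk /= ck]]; last by rewrite /= ck.
  by exists (ceiln (Num.max (e w) 0 / mesh n)).
move=> _ B mB; rewrite setTI.
rewrite (_ : _ @^-1` B = \bigcup_k ([set w | ceiln (Num.max (e w) 0 / mesh n) = k] `&`
   (fun w => grid_max (X^~ w) (mesh n) k) @^-1` B)).
  apply: bigcupT_measurable => k; apply: measurableI.
    by have := mc measurableT [set k] I; rewrite setTI.
  rewrite -[X in measurable X]setTI.
  exact: (grid_max_measurable fF lX k (mesh_gt0 n)).
apply/seteqP; split => [w Bw|w [k _ [/= ck Bk]]]; last by rewrite /= /gm ck.
by exists (ceiln (Num.max (e w) 0 / mesh n)).
Qed.

Let cvg_gm w : gm n w @[n --> \oo] --> horizon_sup w.
Proof.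
rewrite /gm horizon_supE; have [e0|e0] := leP 0 (e w).
  by apply: cvg_grid_max => //; [exact: (levy_cadlag lX)|exact: (levy_X0 lX)].
rewrite /path_sup set_itv_ge ?image_set0 ?sup0; last by rewrite -leNgt bnd_simp.
have c0 n : ceiln (0 / @mesh R n) = 0%N by apply/eqP; rewrite -leqn0 mul0r ceiln_ler.
under eq_fun do rewrite c0 /=.
exact: cvg_cst.
Qed.

Lemma measurable_horizon_sup : measurable_fun setT horizon_sup.
Proof. by apply: (@measurable_fun_cvg _ _ _ _ gm) => // w _; exact: cvg_gm. Qed.

Variable q : R -> R.
Hypotheses (cq : continuous q) (q0 : forall y, 0 <= q y)
  (ndq : {homo q : x y / x <= y}).

Let mq y : measurable_fun setT (fun w => (q (y + horizon_sup w))%:E).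
Proof.
apply/measurable_EFinP; apply: measurableT_comp; first exact: continuous_measurable_fun.
by apply: measurable_funD => //; exact: measurable_horizon_sup.
Qed.

Let mqM (y : R) : measurable_fun setT (fun m : R => (q (y + m))%:E).
Proof.
apply/measurable_EFinP; apply: measurableT_comp; first exact: continuous_measurable_fun.
exact: measurable_funD.
Qed.

Lemma horizon_integral_pos (f : T -> \bar R) : measurable_fun setT f ->
  (forall w, 0 <= f w)%E ->
  (\int[P]_w f w = \int[P]_(w in [set w | (0 < e w)%R]) f w)%E.
Proof.
move=> mf f0; rewrite -[X in integral _ X](setUv [set w | 0 < e w]).
rewrite ge0_integral_setU//; last 3 first.
- exact: measurableC.
- by rewrite setUv.
- exact/disj_setPCl.
rewrite [X in (_ + X)%E](_ : _ = 0%E) ?adde0//.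
apply: null_set_integral => //; first exact: measurableC.
  exact: measurable_funTS.
exact: exp_horizon_gt0.
Qed.

(** On slice [k] the grid times up to [k h] all precede [e], so their maximum is at most the
    supremum over [[0, e]]. *)
Lemma grid_value_le h y : 0 < h ->
  (grid_value P X q r h y <= \int[P]_w (q (y + horizon_sup w)%R)%:E)%E.
Proof.
move=> h0; rewrite horizon_integral_pos//; last by move=> w; rewrite lee_fin.
rewrite -(bigcup_slice h0) ge0_integral_bigcup//; last 4 first.
- by move=> k; exact: measurable_slice.
- exact: measurable_funTS.
- by move=> w _; rewrite lee_fin.
- exact: trivIset_slice.
apply: lee_nneseries => [k _ _|k _].
  by rewrite mule_ge0 ?lee_fin ?geom_weight_ge0 ?(ltW h0)// run_value_ge0.
rewrite (run_valueE fF lX cq q0)// -(@slice_integral h k k (fun m => (q (y + m))%:E))//.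
  apply: ge0_le_integral => //.
  - exact: measurable_slice.
  - by move=> w _; rewrite lee_fin.
  - apply: measurable_funTS.
    exact: (measurableT_comp (mqM y) (grid_max_measurable fF lX k h0)).
  - exact: measurable_funTS.
  - move=> w /andP[kh hk]; rewrite lee_fin ndq// lerD2l.
    have kh0 : 0 <= k%:R * h by rewrite mulr_ge0// ltW.
    apply: grid_max_pred_le_path_sup => //; last exact: ltW.
    + exact: (levy_cadlag lX).
    + exact: (levy_X0 lX).
    + exact: le_trans (ltW kh).
by move=> m; rewrite lee_fin.
Qed.

(** On slice [k] the maximum [gm] runs to index [k + 1], one more than in [grid_value]. Shifting the
    index costs the term [k = 0] and the factor [e^{- r mesh}], which tends to 1. *)
Lemma grid_value_ge n y :
  ((expR (- (r * mesh n)))%:E * \int[P]_(w in [set w | (0 < e w)%R]) (q (y + gm n w)%R)%:E <=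
   grid_value P X q r (mesh n) y)%E.
Proof.
have h0 := @mesh_gt0 R n.
have mqg : measurable_fun setT (fun w => (q (y + gm n w))%:E).
  exact: (measurableT_comp (mqM y) (mgm n)).
rewrite -(bigcup_slice h0) ge0_integral_bigcup//; last 4 first.
- by move=> k; exact: measurable_slice.
- exact: measurable_funTS.
- by move=> w _; rewrite lee_fin.
- exact: trivIset_slice.
rewrite -nneseriesZl; last by move=> k _; apply: integral_ge0 => w _; rewrite lee_fin.
rewrite grid_value_recl// -[leLHS]add0e.
apply: leeD; first by rewrite mule_ge0 ?lee_fin ?geom_weight_ge0 ?(ltW h0).
apply: lee_nneseries => [k _ _|k _].
  by rewrite mule_ge0 ?lee_fin ?expR_ge0//; apply: integral_ge0 => w _; rewrite lee_fin.
rewrite (run_valueE fF lX cq q0)//.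
have -> : (\int[P]_(w in slice (mesh n) k) (q (y + gm n w)%R)%:E =
   \int[P]_(w in slice (mesh n) k) (q (y + grid_max (X^~ w) (mesh n) k.+1)%R)%:E)%E.
  apply: eq_integral => w; rewrite inE => sw; rewrite /gm.
  have ew : 0 < e w.
    by case/andP: sw => + _; apply: le_lt_trans; rewrite mulr_ge0// ltW.
  by rewrite (max_idPl (ltW ew)) (slice_ceiln h0 sw).
rewrite (@slice_integral (mesh n) k k.+1 (fun m => (q (y + m))%:E))//; last first.
  by move=> m; rewrite lee_fin.
by rewrite muleA -EFinM /geom_weight mulrCA -exprS.
Qed.

(** At a stopping time rounded up to the mesh, both the discount and the position vary with [n],
    hence the sequences [a] and [y]. The bound is Fatou's lemma on top of [grid_value_ge]. *)
Lemma grid_value_liminf (a : nat -> R) (y : nat -> R) (a' y' : R) :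
  (forall n, 0 <= a n) -> a n @[n --> \oo] --> a' -> y n @[n --> \oo] --> y' ->
  (a'%:E * \int[P]_w (q (y' + horizon_sup w)%R)%:E <=
   limn_einf (fun n => (a n)%:E * grid_value P X q r (mesh n) (y n)))%E.
Proof.
move=> a0 ca cy.
have a'0 : 0 <= a'.
  rewrite -(cvg_lim _ ca)//; apply: limr_ge; last exact: nearW.
  by apply/cvg_ex; exists a'.
pose f n w := ((a n * (expR (- (r * mesh n)) * q (y n + gm n w)))%:E)%E.
have f0 n w : (0 <= f n w)%E by rewrite lee_fin !mulr_ge0 ?expR_ge0.
have mf n : measurable_fun setT (f n).
  apply/measurable_EFinP; apply: measurable_funM => //; apply: measurable_funM => //.
  by apply/measurable_EFinP; exact: (measurableT_comp (mqM (y n)) (mgm n)).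
have mpos : measurable [set w | 0 < e w] := measurable_tail 0.
have cf w : f n w @[n --> \oo] --> (a' * q (y' + horizon_sup w))%:E.
  apply: cvg_EFin; first exact: nearW.
  apply: cvgM => //; rewrite -[X in _ --> X]mul1r; apply: cvgM.
    rewrite -[X in _ --> X]expR0; apply: continuous_cvg; first exact: continuous_expR.
    rewrite -[X in _ --> X]oppr0; apply: cvgN.
    by rewrite -(mulr0 r); apply: cvgMr; exact: cvg_mesh.
  apply: continuous_cvg; first exact: cq.
  by apply: cvgD => //; exact: cvg_gm.
rewrite horizon_integral_pos//; last by move=> w; rewrite lee_fin.
rewrite -ge0_integralZl//; last 2 first.
- exact: measurable_funTS.
- by move=> w _; rewrite lee_fin.
apply: (@le_trans _ _ (\int[P]_(w in [set w | (0 < e w)%R]) limn_einf (f^~ w))%E).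
  rewrite le_eqVlt; apply/orP; left; apply/eqP; apply: eq_integral => w _.
  by rewrite -EFinM (cvg_limn_einf_sup (cf w)).1.
apply: le_trans (fatou _ _ _ _) _ => //.
- by move=> n; exact: measurable_funTS.
apply: le_limn_einf => n.
rewrite /f; under eq_integral do rewrite EFinM.
rewrite ge0_integralZl//; last 3 first.
- apply: measurable_funTS; apply/measurable_EFinP; apply: measurable_funM => //.
  by apply/measurable_EFinP; exact: (measurableT_comp (mqM (y n)) (mgm n)).
- by move=> w _; rewrite lee_fin mulr_ge0 ?expR_ge0.
- by rewrite lee_fin.
rewrite lee_wpmul2l ?lee_fin//.
under eq_integral do rewrite EFinM.
rewrite ge0_integralZl//; last 2 first.
- apply: measurable_funTS; exact: (measurableT_comp (mqM (y n)) (mgm n)).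
- by move=> w _; rewrite lee_fin.
exact: grid_value_ge.
Qed.

End exponential_horizon.

(** * Excessive and harmonic stopped values *)

Section stopped_value.
Context d (T : measurableType d) (R : realType) (P : probability T R)
  (F : R -> set (set T)) (X : R -> T -> R).
Hypotheses (fF : is_filtration F) (lX : levy_process P F X).

Definition stopped (r : R) (f : R -> R) (x : R) (theta : T -> \bar R) (w : T) : R :=
  if theta w is t%:E then expR (- (r * t)) * f (x + X t w) else 0.

Lemma cvg_grid_stopped (r : R) (f : R -> R) x theta w : continuous f ->
  stopping_time F theta ->
  grid_stopped X r (mesh n) x (EFin \o f) theta w @[n --> \oo] -->
    (stopped r f x theta w)%:E.
Proof.
move=> cf [th0 _]; rewrite /grid_stopped /stopped.
case Et : (theta w) => [t| |]; [|exact: cvg_cst|exact: cvg_cst].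
have t0 : 0 <= t by have := th0 w; rewrite Et.
rewrite EFinM; apply: cvg_EFin; first exact: nearW.
apply: cvgM.
  apply: continuous_cvg; first exact: continuous_expR.
  by apply: cvgN; apply: cvgMr; exact: cvg_grid_ceil.
apply: continuous_cvg; first exact: cf.
apply: cvgD; first exact: cvg_cst.
by apply: (cvg_cadlag_grid (levy_cadlag lX w)).
Qed.

Lemma measurable_stopped (r : R) (f : R -> R) x theta : continuous f ->
  stopping_time F theta -> measurable_fun setT (stopped r f x theta).
Proof.
move=> cf sth; apply/measurable_EFinP.
apply: (@emeasurable_fun_cvg _ _ _ _
  (fun n => grid_stopped X r (mesh n) x (EFin \o f) theta)); last first.
  by move=> w _; exact: cvg_grid_stopped.
move=> n; apply: (measurable_grid_stopped fF lX) => //; first exact: mesh_gt0.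
by apply/measurable_EFinP; exact: continuous_measurable_fun.
Qed.

Variables (r : R) (e : T -> R).
Hypotheses (r0 : 0 < r) (eX : exp_indep P X r e).
Variables (q v : R -> R).
Hypotheses (cq : continuous q) (q0 : forall y, 0 <= q y)
  (ndq : {homo q : x y / x <= y}) (cv : continuous v)
  (vE : forall y, (\int[P]_w (q (y + horizon_sup X e w)%R)%:E)%E = (v y)%:E).

Lemma horizon_value_ge0 y : 0 <= v y.
Proof. by rewrite -lee_fin -vE; apply: integral_ge0 => w _; rewrite lee_fin. Qed.

Lemma horizon_value_nd : {homo v : x y / x <= y}.
Proof.
move=> y z yz; rewrite -lee_fin -!vE.
have mq y' : measurable_fun setT (fun w => (q (y' + horizon_sup X e w))%:E).
  apply/measurable_EFinP; apply: measurableT_comp; first exact: continuous_measurable_fun.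
  by apply: measurable_funD => //; exact: (measurable_horizon_sup fF lX eX).
by apply: ge0_le_integral => // w _; rewrite lee_fin// ndq// lerD2r.
Qed.

Let grid_le n y : (grid_value P X q r (mesh n) y <= (v y)%:E)%E.
Proof. by rewrite -vE; apply: (grid_value_le fF lX) => //; exact: mesh_gt0. Qed.

Let grid_ge0 n y : (0 <= grid_value P X q r (mesh n) y)%E.
Proof. by apply: grid_value_ge0 => //; exact/ltW/mesh_gt0. Qed.

Let mgrid n : measurable_fun setT (grid_value P X q r (mesh n)).
Proof. by apply: (measurable_grid_value fF lX) => //; exact/ltW/mesh_gt0. Qed.

Lemma stopped_ge0 x theta w : 0 <= stopped r v x theta w.
Proof.
by rewrite /stopped; case: (theta w) => // t; rewrite mulr_ge0 ?expR_ge0// horizon_value_ge0.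
Qed.

(** On each grid optional stopping bounds the stopped [grid_value] by its initial value, at most
    [v x]; the lower limit of the stopped values is at least the stopped [v], so Fatou's lemma
    concludes. *)
Lemma stopped_excessive x theta : stopping_time F theta ->
  (\int[P]_w (stopped r v x theta w)%:E <= (v x)%:E)%E.
Proof.
move=> sth.
apply: (@fatou_le _ _ _ P (fun n => grid_stopped X r (mesh n) x
   (grid_value P X q r (mesh n)) theta)).
- by move=> n; apply: (measurable_grid_stopped fF lX) => //; exact: mesh_gt0.
- by move=> n w; apply: grid_stopped_ge0.
- by apply/measurable_EFinP; exact: measurable_stopped.
- by move=> w; rewrite lee_fin stopped_ge0.
- move=> w; rewrite /grid_stopped /stopped.
  case Et : (theta w) => [t| |].
  + have t0 : 0 <= t by have := sth.1 w; rewrite Et.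
    rewrite EFinM -vE.
    apply: (grid_value_liminf fF lX r0 eX cq q0
      (a := fun n => expR (- (r * grid_ceil (mesh n) t)))
      (y := fun n => x + X (grid_ceil (mesh n) t) w)).
    * by move=> n; exact: expR_ge0.
    * apply: continuous_cvg; first exact: continuous_expR.
      by apply: cvgN; apply: cvgMr; exact: cvg_grid_ceil.
    * by apply: cvgD; [exact: cvg_cst|exact: (cvg_cadlag_grid (levy_cadlag lX w))].
  + by apply: limn_einf_ge; exact: nearW.
  + by apply: limn_einf_ge; exact: nearW.
- move=> n; apply: le_trans (grid_le n x).
  apply: (grid_stopped_le fF lX) => //; first exact: mesh_gt0.
  move=> y.
  by apply: (grid_value_excessive fF lX) => //; exact: mesh_gt0.
Qed.

(** The missing inequality is a chain: [v x] is at most the lower limit of [grid_value] at [x]; this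
    is at most the mean of the stopped [grid_value], harmonic below [b]; that is at most the mean of
    [v] at the rounded time, which converges by domination by [D]. *)
Lemma stopped_harmonic x b theta (D : T -> \bar R) : stopping_time F theta ->
  (forall y, y < b -> q y = 0) ->
  (forall w t, 0 <= t -> (t%:E < theta w)%E -> x + X t w < b) ->
  P.-integrable setT D ->
  (forall w t, 0 <= t -> ((expR (- (r * t)) * v (x + X t w))%:E <= D w)%E) ->
  (\int[P]_w (stopped r v x theta w)%:E = (v x)%:E)%E.
Proof.
move=> sth qb thb iD vD.
apply/eqP; rewrite eq_le stopped_excessive//=.
pose f n := grid_stopped X r (mesh n) x (EFin \o v) theta.
have mv : measurable_fun setT (EFin \o v).
  by apply/measurable_EFinP; exact: continuous_measurable_fun.
have f0 n w : (0 <= f n w)%E.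
  by apply: grid_stopped_ge0 => y; rewrite lee_fin horizon_value_ge0.
have mf n : measurable_fun setT (f n).
  by apply: (measurable_grid_stopped fF lX) => //; exact: mesh_gt0.
have D0 w : (0 <= D w)%E.
  by apply: le_trans (vD w 0 (lexx 0)); rewrite lee_fin mulr_ge0 ?expR_ge0 ?horizon_value_ge0.
have [_ _ cf] : [/\ P.-integrable setT (fun w => (stopped r v x theta w)%:E),
    (\int[P]_w `|f n w - (stopped r v x theta w)%:E|)%E @[n --> \oo] --> 0%E &
    (\int[P]_w f n w)%E @[n --> \oo] --> (\int[P]_w (stopped r v x theta w)%:E)%E].
  apply: (@dominated_convergence _ _ _ _ _ measurableT f _ D) => //.
  - by apply/measurable_EFinP; exact: measurable_stopped.
  - by apply: aeW => w _; exact: cvg_grid_stopped.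
  - apply: aeW => w n _; rewrite gee0_abs// /f /grid_stopped.
    case Et : (theta w) => [t| |] //.
    have t0 : 0 <= t by have := sth.1 w; rewrite Et.
    rewrite -EFinM; apply: vD.
    by apply: le_trans (grid_ceil_ge (mesh_gt0 n) t0).
have := @grid_value_liminf _ _ _ _ _ _ fF lX _ _ r0 eX _ cq q0 (cst 1) (cst x) 1 x.
rewrite mul1e vE => /(_ _ _ _)/le_trans; apply => //; try exact: cvg_cst.
rewrite -(cvg_limn_einf_sup cf).1; apply: le_limn_einf => n; rewrite mul1e.
apply: (@le_trans _ _ (\int[P]_w grid_stopped X r (mesh n) x
    (grid_value P X q r (mesh n)) theta w)%E).
  apply: (@grid_stopped_ge _ _ _ _ _ _ fF lX r (mesh n) x
    (grid_value P X q r (mesh n)) theta r0 (mesh_gt0 n) (mgrid n) (grid_ge0 n) sth b (v b)) => //.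
  - move=> y yb; apply: (grid_value_harmonic fF lX) => //; first exact: mesh_gt0.
    exact: qb.
  - move=> y yb; apply: le_trans (grid_le n y) _.
    by rewrite lee_fin horizon_value_nd// ltW.
apply: ge0_le_integral => //.
- by move=> w _; exact: grid_stopped_ge0.
- by apply: (measurable_grid_stopped fF lX) => //; exact: mesh_gt0.
- move=> w _; rewrite /f /grid_stopped; case: (theta w) => // t.
  by rewrite lee_wpmul2l// lee_fin expR_ge0.
Qed.

End stopped_value.

(** * Hitting times *)

Section running_sup.
Context d (T : measurableType d) (R : realType) (P : probability T R)
  (F : R -> set (set T)) (X : R -> T -> R).
Hypotheses (fF : is_filtration F) (lX : levy_process P F X).

(** What needs proof is measurability: right-continuity reduces the supremum over all times to the
    countably many grid times. *)
Lemma integrable_running_sup (r x : R) (G : R -> R) : continuous G ->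
  let Z w := ereal_sup
    [set (`|expR (- (r * t)) * G (x + X t w)|%R)%:E | t in [set t : R | (0 <= t)%R]] in
  (\int[P]_w Z w < +oo)%E -> P.-integrable setT Z.
Proof.
move=> cG Z intZ.
pose f t w := (`|expR (- (r * t)) * G (x + X t w)|%R)%:E.
pose Y (m : nat) w := esups (fun k : nat => f (k%:R * mesh m) w) 0%N.
have kh0 m k : 0 <= k%:R * mesh m :> R by rewrite mulr_ge0// ltW// mesh_gt0.
have ZY w : Z w = esups (fun m => Y m w) 0%N.
  apply/eqP; rewrite eq_le; apply/andP; split.
    apply: ge_ereal_sup => _ [t /= t0 <-].
    have c : f (grid_ceil (mesh m) t) w @[m --> \oo] --> f t w.
      apply: cvg_EFin; first exact: nearW.
      apply: cvg_norm; apply: cvgM.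
        apply: continuous_cvg; first exact: continuous_expR.
        by apply: cvgN; apply: cvgMr; exact: cvg_grid_ceil.
      apply: continuous_cvg; first exact: cG.
      by apply: cvgD; [exact: cvg_cst|exact: (cvg_cadlag_grid (levy_cadlag lX w))].
    rewrite -/(f t w) -(cvg_lim _ c)//; apply: lime_le.
      by apply/cvg_ex; exists (f t w).
    apply: nearW => m; apply: (@le_trans _ _ (Y m w)).
      by apply: ereal_sup_ubound; exists (ceiln (t / mesh m)).
    by apply: ereal_sup_ubound; exists m.
  apply: ge_ereal_sup => _ [m _ <-]; apply: ge_ereal_sup => _ [k _ <-].
  by apply: ereal_sup_ubound; exists (k%:R * mesh m) => //=; exact: kh0.
have mZ : measurable_fun setT Z.
  rewrite (_ : Z = fun w => esups (fun m => Y m w) 0%N); last exact/funext.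
  apply: measurable_fun_esups => m; apply: measurable_fun_esups => k.
  apply/measurable_EFinP; apply: measurableT_comp => //.
  apply: measurable_funM => //; apply: measurableT_comp; first exact: continuous_measurable_fun.
  by apply: measurable_funD => //; exact: (levy_measurable fF lX).
have Z0 w : (0 <= Z w)%E.
  apply: (@le_trans _ _ (f 0 w)); first by rewrite lee_fin.
  by apply: ereal_sup_ubound; exists 0 => //=.
apply/integrableP; split => //.
by under eq_integral do rewrite gee0_abs//.
Qed.

End running_sup.

Section hitting_time.
Context d (T : measurableType d) (R : realType) (P : probability T R)
  (F : R -> set (set T)) (X : R -> T -> R).
Hypotheses (fF : is_filtration F) (uF : usual_conditions P F) (lX : levy_process P F X).

Lemma hit_above_ge0 x b w : (0 <= hit_above X x b w)%E.
Proof. by apply: le_ereal_inf_tmp => _ [t [t0 _] <-]; rewrite lee_fin. Qed.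

Lemma hit_above_lt x b w t : 0 <= t -> (t%:E < hit_above X x b w)%E -> x + X t w < b.
Proof.
move=> t0; rewrite ltNge; apply: contraNlt => bt.
by apply: ereal_inf_lbound; exists t.
Qed.

(** The infimum is attained: times tending to it from the right carry the inequality to the limit by
    right-continuity. *)
Lemma hit_above_leP x b w t :
  (hit_above X x b w <= t%:E)%E <-> exists2 s, 0 <= s <= t & b <= x + X s w.
Proof.
split => [|[s /andP[s0 st] bs]]; last first.
  by apply: (@le_trans _ _ s%:E); [apply: ereal_inf_lbound; exists s|rewrite lee_fin].
have := hit_above_ge0 x b w; case Eh : (hit_above X x b w) => [s| |]//.
rewrite !lee_fin => s0 st; exists s; first by rewrite s0.
have ex n : exists2 u, s <= u < s + mesh n & b <= x + X u w.
  have : (hit_above X x b w < (s + mesh n)%:E)%E by rewrite Eh lte_fin ltrDl mesh_gt0.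
  move=> /ereal_inf_lt[_ [u [u0 bu] <-]]; rewrite lte_fin => us; exists u => //.
  rewrite us andbT -lee_fin -Eh.
  by apply: ereal_inf_lbound; exists u.
have [u uP] := choice (fun n => (let: ex_intro2 u h1 h2 := ex n in
  ex_intro (fun u => s <= u < s + mesh n /\ b <= x + X u w) u (conj h1 h2))).
have cu : u n @[n --> \oo] --> s.
  apply: (@squeeze_cvgr _ _ _ _ (cst s) (fun n => s + mesh n)).
  - by apply: nearW => n; have [/andP[-> /ltW ->] _] := uP n.
  - exact: cvg_cst.
  - by rewrite -[X in _ --> X]addr0; apply: cvgD; [exact: cvg_cst|exact: cvg_mesh].
have cX : x + X (u n) w @[n --> \oo] --> x + X s w.
  apply: cvgD; first exact: cvg_cst.
  apply: (@cvg_right_seq _ (X^~ w) s u) => //; first exact: (levy_cadlag lX w).1.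
  by move=> n; have [/andP[]] := uP n.
rewrite -(cvg_lim _ cX)//; apply: limr_ge; first by apply/cvg_ex; exists (x + X s w).
by apply: nearW => n; have [] := uP n.
Qed.

Lemma hit_above_level x b w t : hit_above X x b w = t%:E -> 0 <= t /\ b <= x + X t w.
Proof.
move=> h; have t0 : 0 <= t by rewrite -lee_fin -h hit_above_ge0.
split=> //; have /hit_above_leP[s /andP[s0 st] bs] : (hit_above X x b w <= t%:E)%E by rewrite h.
suff -> : t = s by [].
apply/eqP; rewrite eq_le st andbT -lee_fin -h.
by apply: ereal_inf_lbound; exists s.
Qed.

Variables (r : R) (e : T -> R).
Hypotheses (r0 : 0 < r) (eX : exp_indep P X r e).
Hypothesis no_atom : forall c, 0 < c -> P [set w | horizon_sup X e w = c] = 0%E.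

Let gpt (m k : nat) : R := k%:R * mesh m.

Let gpt_ge0 m k : 0 <= gpt m k.
Proof. by rewrite mulr_ge0// ltW// mesh_gt0. Qed.

(* [D c t eta]: the running supremum equals [c] at every time between [t + eta / 2] and
   [t + eta], expressed through countably many grid times. *)
Let D (c t eta : R) : set T :=
  (\bigcap_m \bigcap_k [set w | gpt m k < t + eta -> X (gpt m k) w <= c]) `&`
  (\bigcap_j \bigcup_m \bigcup_k
     [set w | gpt m k < t + eta / 2 /\ c - mesh j < X (gpt m k) w]).

Let D_path c t eta : <<s path_rectangle X >> (D c t eta).
Proof.
have mX m k B : measurable B ->
    @measurable _ (g_sigma_algebraType (path_rectangle X)) (X (gpt m k) @^-1` B).
  by move=> mB; apply: sub_sigma_algebra; exact: path_rectangle1.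
suff : @measurable _ (g_sigma_algebraType (path_rectangle X)) (D c t eta) by [].
apply: measurableI.
  apply: bigcapT_measurable => m; apply: bigcapT_measurable => k.
  have [h|h] := ltP (gpt m k) (t + eta).
    rewrite (_ : [set w | _] = X (gpt m k) @^-1` `]-oo, c]%classic); first exact: mX.
    by apply/seteqP; split => w /=; rewrite in_itv/=; [exact|].
  by rewrite (_ : [set w | _] = setT)//; apply/seteqP; split.
apply: bigcapT_measurable => j; apply: bigcupT_measurable => m.
apply: bigcupT_measurable => k.
have [h|h] := ltP (gpt m k) (t + eta / 2).
  rewrite (_ : [set w | _] = X (gpt m k) @^-1` `]c - mesh j, +oo[%classic); first exact: mX.
  by apply/seteqP; split => w /=; rewrite in_itv/= andbT; [case|split].
by rewrite (_ : [set w | _] = set0)//; apply/seteqP; split => // w [].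
Qed.

(** With positive probability [e] lies in [(t + eta / 2, t + eta)], and then on [D] the supremum up
    to [e] is exactly [c]. By independence [P (e in C) P (D) <= P (S = c) = 0]. *)
Let D_null c t eta : 0 < c -> 0 <= t -> 0 < eta -> measurable (D c t eta) /\ P (D c t eta) = 0%E.
Proof.
move=> c0 t0 eta0.
have mD : measurable (D c t eta).
  have : <<s path_rectangle X >> `<=` measurable.
    apply: smallest_sub; first exact: sigma_algebra_measurable.
    exact: (path_rectangle_measurable fF lX).
  by apply; exact: D_path.
split => //.
have th0 : 0 <= t + eta / 2 by rewrite addr_ge0// ltW// divr_gt0.
pose C := `]t + eta / 2, t + eta[%classic : set R.
have mC : measurable C by exact: measurable_itv.
have me := measurable_exp_horizon eX.
have mes (B : set R) : measurable B -> measurable (e @^-1` B).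
  by move=> mB; rewrite -[X in measurable X]setTI; exact: me.
have PC : (P (e @^-1` C) > 0)%E.
  (* [(t1, t2]] lies inside [C], and its probability is a difference of two exponential tails. *)
  pose t1 := t + eta / 2; pose t2 := t + eta * 3 / 4.
  have t10 : 0 <= t1 by [].
  have t20 : 0 <= t2 by rewrite addr_ge0// divr_ge0// mulr_ge0// ltW.
  have t12 : t1 < t2 by rewrite /t1 /t2; lra.
  have t2e : t2 < t + eta by rewrite /t2; lra.
  apply: (@lt_le_trans _ _ (P ([set w | t1 < e w] `\` [set w | t2 < e w]))).
    have mt s : measurable [set w | s < e w].
      have := mes `]s, +oo[%classic (measurable_itv _).
      by congr measurable; apply/seteqP; split => w /=; rewrite in_itv/= andbT.
    rewrite measureD//; last by rewrite -ge0_fin_numE// fin_num_measure.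
    rewrite (_ : _ `&` _ = [set w | t2 < e w]); last first.
      by apply/seteqP; split => w /=; [case|move=> h; split => //; exact: lt_trans h].
    rewrite /= !(exp_horizon_tail eX)// -EFinB lte_fin subr_gt0 ltr_expR ltrN2.
    by rewrite ltr_pM2l.
  apply: le_measure; rewrite ?inE//; last 2 first.
  - exact: mes.
  - move=> w /= [h1 /negP]; rewrite -leNgt => h2.
    by rewrite /C/= in_itv/= h1 (le_lt_trans h2).
  apply: measurableD.
    have := mes `]t1, +oo[%classic (measurable_itv _).
    by congr measurable; apply/seteqP; split => w /=; rewrite in_itv/= andbT.
  have := mes `]t2, +oo[%classic (measurable_itv _).
  by congr measurable; apply/seteqP; split => w /=; rewrite in_itv/= andbT.
have sub : e @^-1` C `&` D c t eta `<=` [set w | horizon_sup X e w = c].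
  move=> w []; rewrite /C/= in_itv/= => /andP[e1 e2] [d1 d2].
  have cl := levy_cadlag lX w.
  rewrite horizon_supE; apply/eqP; rewrite eq_le; apply/andP; split.
    apply: path_sup_le; first by rewrite (le_trans th0)// ltW.
    move=> s /andP[s0 se].
    have cs := cvg_cadlag_grid cl s0.
    rewrite -(cvg_lim _ cs)//; apply: limr_le; first by apply/cvg_ex; exists (X s w).
    have : \forall n \near \oo, grid_ceil (mesh n) s < t + eta.
      have /cvgr_lt := cvg_grid_ceil s0; apply.
      exact: le_lt_trans e2.
    apply: filterS => n hn; exact: (d1 n I (ceiln (s / mesh n)) I hn).
  rewrite leNgt; apply/negP => Sc.
  have [j hj] : exists n, mesh n < c - path_sup (X^~ w) (e w).
    by apply: mesh_lt; rewrite subr_gt0.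
  have [m _ [k _ [k1 k2]]] := d2 j I.
  have : X (gpt m k) w <= path_sup (X^~ w) (e w).
    by apply: path_sup_ge => //; rewrite gpt_ge0/= ltW// (lt_trans k1).
  apply/negP; rewrite -ltNge; apply: lt_trans k2.
  by rewrite ltrBrDl addrC -ltrBrDl.
have P0 : P (e @^-1` C `&` D c t eta) = 0%E.
  apply/eqP; rewrite eq_le measure_ge0 andbT -(no_atom c0).
  apply: le_measure; rewrite ?inE//; first by apply: measurableI => //; exact: mes.
  have := measurable_horizon_sup fF lX eX measurableT (measurable_set1 c).
  by rewrite setTI.
have := exp_horizon_indep fF lX eX (D_path c t eta) mC.
rewrite P0 => /esym/eqP; rewrite mule_eq0 => /orP[/eqP h|/eqP//].
by move: PC; rewrite h ltxx.
Qed.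

(** Over all [n] the intersection is the event that the entrance time into the open half-line
    [(c, +oo)] is at most [t]; grid times suffice by right-continuity. *)
Let B (c t : R) (n : nat) : set T :=
  \bigcup_m \bigcup_k [set w | gpt m k < t + mesh n /\ c < X (gpt m k) w].

Let mesh_le n m : (n <= m)%N -> mesh m <= mesh n :> R.
Proof. by move=> nm; rewrite lef_pV2 ?posrE ?ltr0n// ler_nat ltnS. Qed.

Let B_adapted c t s n : 0 <= t -> t + mesh n <= s -> F s (B c t n).
Proof.
move=> t0 ts; have s0 : 0 <= s by rewrite (le_trans _ ts)// addr_ge0// ltW// mesh_gt0.
suff : @measurable _ (g_sigma_algebraType (F s)) (B c t n).
  by case: (fF) => /(_ s s0) sF _ _; rewrite /measurable/= sigma_algebra_id.
apply: bigcupT_measurable => m; apply: bigcupT_measurable => k.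
have [h|h] := ltP (gpt m k) (t + mesh n); last first.
  by rewrite (_ : [set w | _] = set0)//; apply/seteqP; split => // w [].
apply: sub_sigma_algebra.
rewrite (_ : [set w | _] = X (gpt m k) @^-1` `]c, +oo[%classic); last first.
  by apply/seteqP; split => w /=; rewrite in_itv/= andbT; [case|split].
apply: (adapted_le fF (gpt_ge0 m k) _ (levy_adapted lX (gpt_ge0 m k))) => //.
by rewrite (le_trans _ ts)// ltW.
Qed.

(* The hitting time of [b, oo) is a.s. that of (b, oo), which is a stopping time because [F]
   is right-continuous: between the two the supremum of [x + X] is stuck at [b], and [x + S]
   has no atom there. *)
Lemma hit_above_stopping x b : stopping_time F (hit_above X x b).
Proof.
split => [w|t t0]; first exact: hit_above_ge0.
case: (fF) => /(_ t t0) [F0 FC FU] FM Fm.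
have FT : F t setT by rewrite -[setT]setD0; exact: FC.
have [bx|xb] := leP b x.
  rewrite (_ : [set w | _] = setT)//; apply/seteqP; split => // w _ /=.
  apply/hit_above_leP; exists 0; first by rewrite lexx.
  by rewrite (levy_X0 lX) addr0.
pose c := b - x; have c0 : 0 < c by rewrite subr_gt0.
pose A := [set w | (hit_above X x b w <= t%:E)%E].
pose Bo := \bigcap_n B c t n.
have cb w s : (c <= X s w) = (b <= x + X s w) by rewrite lerBlDl.
have Bodef N : Bo = \bigcap_n B c t (n + N)%N.
  apply/seteqP; split => w h n _; first exact: h.
  have [m _ [k _ [h1 h2]]] := h n I; exists m => //; exists k => //; split => //.
  by apply: lt_le_trans h1 _; rewrite lerD2l mesh_le// leq_addr.
have FBo : F t Bo.
  case: uF => rcF _; apply: (rcF t t0) => s ts.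
  have s0 : 0 <= s by rewrite (le_trans t0)// ltW.
  have [N hN] : exists n, mesh n < s - t by apply: mesh_lt; rewrite subr_gt0.
  rewrite (Bodef N).
  suff : @measurable _ (g_sigma_algebraType (F s)) (\bigcap_n B c t (n + N)%N).
    by case: (fF) => /(_ s s0) sF _ _; rewrite /measurable/= sigma_algebra_id.
  apply: bigcapT_measurable => n; apply: sub_sigma_algebra; apply: B_adapted => //.
  by rewrite -lerBrDl (le_trans _ (ltW hN))// mesh_le// leq_addl.
have BoA : Bo `<=` A.
  move=> w h; apply/lee_addgt0Pr => eps eps0.
  have [N hN] := mesh_lt eps0.
  have [m _ [k _ [h1 h2]]] := h N I.
  rewrite -EFinD; apply/hit_above_leP; exists (gpt m k).
    by rewrite gpt_ge0/= (le_trans (ltW h1))// lerD2l ltW.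
  by rewrite -cb ltW.
have AB : A `\` Bo `<=` \bigcup_n D c t (mesh n).
  move=> w [/hit_above_leP[s /andP[s0 st]]]; rewrite -cb => cs nB.
  have [n nBn] : exists n, ~ B c t n w.
    by apply/existsNP => h; apply: nB => n _; exact: h.
  exists n => //; split.
    move=> m _ k _ /= hk; rewrite leNgt; apply/negP => ck.
    by apply: nBn; exists m => //; exists k.
  move=> j _.
  (* The grid times required by the second half of [D] are [s] rounded up: since [s <= t] and
     [c <= X s], they eventually satisfy both constraints. *)
  have c1 : \forall m \near \oo, c - mesh j < X (grid_ceil (mesh m) s) w.
    have /cvgr_gt := cvg_cadlag_grid (levy_cadlag lX w) s0; apply.
    by rewrite ltrBlDr (le_lt_trans cs)// ltrDl mesh_gt0.
  have c2 : \forall m \near \oo, grid_ceil (mesh m) s < t + mesh n / 2.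
    have /cvgr_lt := cvg_grid_ceil s0; apply.
    by rewrite (le_lt_trans st)// ltrDl divr_gt0// mesh_gt0.
  have [m _ /(_ m (leqnn m)) [/= h1 h2]] : \forall m \near \oo,
      c - mesh j < X (grid_ceil (mesh m) s) w /\ grid_ceil (mesh m) s < t + mesh n / 2.
    by near=> m; split; near: m.
  by exists m => //; exists (ceiln (s / mesh m)).
(* Subsets of null events lie in [F 0] by the usual conditions, so no prior measurability of [A] is
   needed. *)
have FAB : F t (A `\` Bo).
  apply: (Fm 0 t (lexx 0) t0); case: uF => _; apply.
  have [M [mM PM DM]] : P.-negligible (\bigcup_n D c t (mesh n)).
    apply: negligible_bigcup => n; have [mD PD] := D_null c0 t0 (mesh_gt0 n).
    by exists (D c t (mesh n)); split.
  by exists M; split => //; exact: subset_trans DM.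
suff : @measurable _ (g_sigma_algebraType (F t)) A.
  by case: (fF) => /(_ t t0) sF _ _; rewrite /measurable/= sigma_algebra_id.
rewrite (_ : A = Bo `|` (A `\` Bo)); last by rewrite setDUK.
by apply: measurableU; exact: sub_sigma_algebra.
Unshelve. all: by end_near.
Qed.

End hitting_time.

(** * The general theory applied to the payoff of one player *)

Section one_sided.
Context d (T : measurableType d) (R : realType) (P : probability T R)
  (F : R -> set (set T)) (X : R -> T -> R).
Variables (r : R) (e : T -> R) (p s : R).
Hypotheses (fF : is_filtration F) (lX : levy_process P F X).
Hypotheses (r0 : 0 < r) (eX : exp_indep P X r e) (p01 : 0 <= p < 1) (s0 : 0 < s).
Hypothesis mgfS : forall z : R, z < s ->
  (\int[P]_w (expR (z * run_sup X e w))%:E)%E = (p + (1 - p) * (s / (s - z)))%:E.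

(** The branches agree at 0 because [K = E + c - C]; with [min] and [max] they merge into one
    continuous expression. *)
Lemma continuous_excessive_fun rho c : 0 < rho -> continuous (excessive_fun p s rho c).
Proof.
move=> rho0; have sr0 : 0 < s + rho by rewrite addr_gt0.
pose K := (1 - p) * (s^-1 + c * rho / (s + rho)).
pose C := c * ((p * rho + s) / (rho + s)).
have -> : excessive_fun p s rho c = fun y => K * expR (s * Num.min y 0) +
    (Num.max y 0 + cE p s + c - C * expR (- (rho * Num.max y 0))) - K.
  have KC : K = cE p s + c - C.
    by rewrite /K /C /cE; field; rewrite !gt_eqF// addrC.
  apply/funext => y; rewrite /excessive_fun; have [y0|y0] := leP y 0.
    by rewrite mulr0 oppr0 expR0 -/K KC; ring.
  by rewrite mulr0 expR0 -/C; ring.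
have cmin : continuous (fun y : R => Num.min y 0).
  apply: (@min_fun_continuous _ R R id (cst (0 : R))); last exact: cst_continuous.
  by move=> y; exact: cvg_id.
have cmax : continuous (fun y : R => Num.max y 0).
  apply: (@max_fun_continuous _ R R id (cst (0 : R))); last exact: cst_continuous.
  by move=> y; exact: cvg_id.
move=> y; apply: cvgB; last exact: cvg_cst.
apply: cvgD.
  apply: cvgM; first exact: cvg_cst.
  apply: continuous_comp; last exact: continuous_expR.
  by apply: cvgM; [exact: cvg_cst|exact: cmin].
apply: cvgB.
  by apply: cvgD; [apply: cvgD; [exact: cmax|exact: cvg_cst]|exact: cvg_cst].
apply: cvgM; first exact: cvg_cst.
apply: continuous_comp; last exact: continuous_expR.
by apply: cvgN; apply: cvgM; [exact: cvg_cst|exact: cmax].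
Qed.

Let laplaceS (k : nat) :
  (\int[P]_w (expR (- (k%:R * horizon_sup X e w)))%:E)%E = (p + (1 - p) * (s / (s + k%:R)))%:E.
Proof.
have := @mgfS (- k%:R); rewrite opprK => <-; last first.
  by rewrite (le_lt_trans _ s0)// oppr_le0.
by apply: eq_integral => w _; rewrite mulNr.
Qed.

Lemma horizon_sup_no_atom c : 0 < c -> P [set w | horizon_sup X e w = c] = 0%E.
Proof.
apply: (exponential_mixture_no_atom (measurable_horizon_sup fF lX eX) _ p01 s0 laplaceS).
exact: (horizon_sup_ge0 lX).
Qed.

Variables (rho c : R).
Hypotheses (rho0 : 0 < rho) (c0 : c <= 0) (crho : 0 <= 1 + c * rho).

Let q (b y : R) : R := game_payoff rho c (y - b).

Let v (b y : R) : R := excessive_fun p s rho c (y - b).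

Let cq b : continuous (q b).
Proof.
move=> y; apply: (@continuous_comp _ _ _ (fun y => y - b)); last exact: continuous_game_payoff.
by apply: cvgB; [exact: cvg_id|exact: cvg_cst].
Qed.

Let cv b : continuous (v b).
Proof.
move=> y; apply: (@continuous_comp _ _ _ (fun y => y - b)); last exact: continuous_excessive_fun.
by apply: cvgB; [exact: cvg_id|exact: cvg_cst].
Qed.

Let q0 b y : 0 <= q b y. Proof. exact: game_payoff_ge0. Qed.

Let ndq b : {homo q b : x y / x <= y}.
Proof. by move=> x y xy; apply: game_payoff_nd => //; rewrite lerD2r. Qed.

Let vE b y : (\int[P]_w (q b (y + horizon_sup X e w)%R)%:E)%E = (v b y)%:E.
Proof.
have mS := measurable_horizon_sup fF lX eX.
have := exponential_mixture mS (horizon_sup_ge0 lX e) s0 laplaceS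
  (q := fun z => q b (y + z)).
rewrite -game_payoff_mixture// /q addr0 => ->.
- by under eq_integral do rewrite (addrAC y).
- move=> z; have cyz : {for z, continuous (fun z : R => y + z)}.
    by apply: cvgD; [exact: cvg_cst|exact: cvg_id].
  exact: (@continuous_comp _ _ _ (fun z : R => y + z) (q b) z cyz (@cq b _)).
- by move=> z; exact: q0.
Qed.

Lemma side_ge0 b y : 0 <= v b y.
Proof. exact: (horizon_value_ge0 (q0 b) (vE b)). Qed.

Lemma side_excessive b x theta : stopping_time F theta ->
  (\int[P]_w (stopped X r (v b) x theta w)%:E <= (v b x)%:E)%E.
Proof.
exact: (stopped_excessive fF lX r0 eX (@cq b) (q0 b) (@ndq b) (@cv b) (vE b)).
Qed.

Lemma side_measurable b x theta : stopping_time F theta ->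
  measurable_fun setT (stopped X r (v b) x theta).
Proof. exact: (measurable_stopped fF lX). Qed.

(** Since [v] grows at most like [|y|], and [|y| <= K + |G y|], the discounted [v] along the path is
    dominated by a constant plus the running supremum for [G], which is integrable. *)
Lemma side_harmonic b x theta (G : R -> R) (K : R) : stopping_time F theta ->
  (forall w, theta w <= hit_above X x b w)%E ->
  continuous G -> (forall y, `|y| <= K + `|G y|) ->
  (\int[P]_w ereal_sup [set (`|expR (- (r * t)) * G (x + X t w)|%R)%:E
    | t in [set t : R | (0 <= t)%R]] < +oo)%E ->
  (\int[P]_w (stopped X r (v b) x theta w)%:E = (v b x)%:E)%E.
Proof.
move=> sth thb cG GK iG.
have [C HC] := @excessive_fun_bound R p s rho c s0 rho0.
pose C' := `|C| + `|b| + `|K|.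
have vG y : v b y <= C' + `|G y|.
  apply: le_trans (HC _) _; have h1 := ler_norm C; have h2 := ler_norm K.
  have h3 := GK y; have h4 := ler_normB y b; rewrite /C'.
  move: (`|C|) (`|b|) (`|K|) (`|G y|) (`|y|) (`|y - b|) h1 h2 h3 h4.
  by move=> *; lra.
have iZ := integrable_running_sup fF lX cG iG.
pose D w := (C'%:E + ereal_sup [set (`|expR (- (r * t)) * G (x + X t w)|%R)%:E
    | t in [set t : R | (0 <= t)%R]])%E.
have iD : P.-integrable setT D.
  exact: (integrableD measurableT (finite_measure_integrable_cst P C' measurableT) iZ).
have qb y : y < b -> q b y = 0 by move=> yb; rewrite /q game_payoff_le0// subr_le0 ltW.
have xb w t : 0 <= t -> (t%:E < theta w)%E -> x + X t w < b.
  by move=> t0 tth; apply: (hit_above_lt t0); apply: lt_le_trans (thb w).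
apply: (stopped_harmonic fF lX r0 eX (@cq b) (q0 b) (@ndq b) (@cv b) (vE b) sth qb xb iD).
move=> w t t0; apply: (@le_trans _ _ (C' + `|expR (- (r * t)) * G (x + X t w)|)%:E).
  rewrite lee_fin normrM (ger0_norm (expR_ge0 _)).
  apply: (@le_trans _ _ (expR (- (r * t)) * (C' + `|G (x + X t w)|))).
    by rewrite ler_wpM2l ?expR_ge0.
  rewrite mulrDr lerD2r ler_piMl ?addr_ge0//.
  by rewrite -[leRHS]expR0 ler_expR oppr_le0 mulr_ge0// ltW.
by rewrite EFinD leeD2l//; apply: ereal_sup_ubound; exists t.
Qed.

End one_sided.

(** * Passage from [X] to [-X] *)

Section reflection.
Context d (T : measurableType d) (R : realType) (P : probability T R)
  (F : R -> set (set T)) (X : R -> T -> R).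

Lemma levy_process_opp : levy_process P F X -> levy_process P F (fun t w => - X t w).
Proof.
have mN (B : set R) : measurable B -> measurable (-%R @^-1` B : set R).
  by move=> mB; rewrite -[X in measurable X]setTI; exact: oppr_measurable.
move=> [[X0 rc ll] [aX indep stat]]; split; split.
- by move=> w; rewrite X0 oppr0.
- by move=> w t t0; apply: cvgN; exact: (rc w t t0).
- by move=> w t t0; apply: is_cvgN; exact: ll.
- move=> t t0 B mB; rewrite (_ : _ @^-1` B = X t @^-1` (-%R @^-1` B))//.
  by apply: aX => //; exact: mN.
- move=> s t s0 st A B FA mB.
  have e w : B (- X t w - - X s w) = (-%R @^-1` B) (X t w - X s w).
    by rewrite /preimage/= opprB addrC opprK.
  rewrite (_ : [set w | B _] = [set w | (-%R @^-1` B) (X t w - X s w)]).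
    by apply: indep => //; exact: mN.
  by apply/funext => w; exact: e.
- move=> s t s0 st B mB.
  rewrite (_ : [set w | B (_ - _)] = [set w | (-%R @^-1` B) (X t w - X s w)]).
    by rewrite stat//; exact: mN.
  by apply/funext => w; rewrite /preimage/= opprB addrC opprK.
Qed.

Lemma exp_indep_opp r e : exp_indep P X r e -> exp_indep P (fun t w => - X t w) r e.
Proof.
have mN (B : set R) : measurable B -> measurable (-%R @^-1` B : set R).
  by move=> mB; rewrite -[X in measurable X]setTI; exact: oppr_measurable.
move=> [me te indep]; split => // n ts Bs C mBs mC.
by apply: (indep n ts (fun i => -%R @^-1` Bs i)) => // i; exact: mN.
Qed.

Lemma run_sup_opp e w : run_sup (fun t w => - X t w) e w = - run_inf X e w.
Proof. by rewrite /run_sup /run_inf /inf opprK -image_comp. Qed.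

Lemma hit_below_opp x a w : hit_below X x a w = hit_above (fun t w => - X t w) (- x) (- a) w.
Proof.
rewrite /hit_below /hit_above; congr (ereal_inf (_ @` _)).
by apply/funext => t /=; rewrite -opprD lerN2.
Qed.

End reflection.

(** * The saddle point *)

Section payoff.
Context d (T : measurableType d) (R : realType) (P : probability T R)
  (F : R -> set (set T)) (X : R -> T -> R).
Hypotheses (fF : is_filtration F) (lX : levy_process P F X).

Lemma stopping_time_mine (sigma tau : T -> \bar R) : stopping_time F sigma ->
  stopping_time F tau -> stopping_time F (fun w => Order.min (sigma w) (tau w)).
Proof.
move=> [s0 sm] [t0 tm]; split => [w|t t0']; first by rewrite le_min s0 t0.
have -> : [set w | (Order.min (sigma w) (tau w) <= t%:E)%E] =
   [set w | (sigma w <= t%:E)%E] `|` [set w | (tau w <= t%:E)%E].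
  by apply/seteqP; split => w /=; rewrite ge_min => /orP.
suff : @measurable _ (g_sigma_algebraType (F t))
    ([set w | (sigma w <= t%:E)%E] `|` [set w | (tau w <= t%:E)%E]).
  by case: fF => /(_ t t0') sF _ _; rewrite /measurable/= sigma_algebra_id.
by apply: measurableU; apply: sub_sigma_algebra; [exact: sm|exact: tm].
Qed.

(** Strict inequality means that some grid time separates the two, which makes the event a countable
    union. *)
Lemma measurable_stopping_lt (sigma tau : T -> \bar R) : stopping_time F sigma ->
  stopping_time F tau -> measurable [set w | (sigma w < tau w)%E].
Proof.
move=> ss st; have [s0 _] := ss; have [t0 _] := st.
have kh0 m k : 0 <= k%:R * mesh m :> R by rewrite mulr_ge0// ltW// mesh_gt0.
rewrite (_ : [set w | _] = \bigcup_m \bigcup_k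
  ([set w | (sigma w <= (k%:R * mesh m)%:E)%E] `\` [set w | (tau w <= (k%:R * mesh m)%:E)%E])).
  apply: bigcupT_measurable => m; apply: bigcupT_measurable => k.
  by apply: measurableD; exact: (stopping_time_measurable_le fF).
apply/seteqP; split => w /=; last first.
  move=> [m _ [k _ [/= h1 /negP]]]; rewrite -ltNge; exact: le_lt_trans.
have := s0 w; case Es : (sigma w) => [s| |]//; last by move=> _; rewrite ltNge leey.
rewrite lee_fin => s0' stau.
have [m hm] : exists m, ((s + mesh m)%:E < tau w)%E.
  move: stau; case Et : (tau w) => [t| |]// stau; last by exists 0%N; rewrite ltry.
  have [m hm] : exists m, mesh m < t - s by apply: mesh_lt; rewrite subr_gt0.
  by exists m; rewrite lte_fin -ltrBrDl.
exists m => //; exists (ceiln (s / mesh m)) => //; split => /=.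
  by rewrite Es lee_fin; exact: (grid_ceil_ge (mesh_gt0 m)).
apply/negP; rewrite -ltNge; apply: lt_trans hm.
by rewrite lte_fin; exact: (grid_ceil_lt (mesh_gt0 m)).
Qed.

Lemma dynkin_payoffE (r : R) (G1 G2 : R -> R) x (sigma tau : T -> \bar R) w :
  (0 <= sigma w)%E -> (0 <= tau w)%E ->
  dynkin_payoff X r G1 G2 x sigma tau w =
  if (tau w <= sigma w)%E then stopped X r G1 x tau w else stopped X r G2 x sigma w.
Proof.
move=> s0 t0; rewrite /dynkin_payoff /stopped leNgt.
have [st|ts] := ltP (sigma w) (tau w); rewrite ?andbF ?andbT /=; last first.
  by rewrite addr0; case: (tau w) t0.
by rewrite add0r; move: st s0; case: (sigma w) => [s| |]//; rewrite ltNge leey.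
Qed.

Let Z (r x : R) (G : R -> R) w := ereal_sup
  [set (`|expR (- (r * t)) * G (x + X t w)|%R)%:E | t in [set t : R | (0 <= t)%R]].

Lemma stopped_le_sup (r x : R) (G : R -> R) theta w : (0 <= theta w)%E ->
  ((`|stopped X r G x theta w|)%:E <= Z r x G w)%E.
Proof.
rewrite /stopped; case: (theta w) => [t t0| _|//].
  by apply: ereal_sup_ubound; exists t.
rewrite normr0; apply: (@le_trans _ _ (`|expR (- (r * 0)) * G (x + X 0 w)|)%:E).
  by rewrite lee_fin.
by apply: ereal_sup_ubound; exists 0 => //=.
Qed.

Lemma integrable_payoff (r x : R) (G1 G2 : R -> R) (sigma tau : T -> \bar R) :
  continuous G1 -> continuous G2 ->
  (\int[P]_w Z r x G1 w < +oo)%E -> (\int[P]_w Z r x G2 w < +oo)%E ->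
  stopping_time F sigma -> stopping_time F tau ->
  P.-integrable setT (EFin \o dynkin_payoff X r G1 G2 x sigma tau).
Proof.
move=> c1 c2 i1 i2 ss st.
have iZ1 := integrable_running_sup fF lX c1 i1.
have iZ2 := integrable_running_sup fF lX c2 i2.
have iZ := integrableD measurableT iZ1 iZ2.
have pE w := dynkin_payoffE r G1 G2 x (ss.1 w) (st.1 w).
have Z0 (G : R -> R) w : (0 <= Z r x G w)%E.
  apply: (@le_trans _ _ (`|expR (- (r * 0)) * G (x + X 0 w)|)%:E); first by rewrite lee_fin.
  by apply: ereal_sup_ubound; exists 0 => //=.
apply: (le_integrable measurableT _ _ iZ).
  apply/measurable_EFinP.
  rewrite (_ : dynkin_payoff _ _ _ _ _ _ _ = fun w => if (tau w <= sigma w)%E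
    then stopped X r G1 x tau w else stopped X r G2 x sigma w); last exact/funext.
  apply: measurable_fun_ite; [|exact: (measurable_stopped fF lX)..].
  rewrite (_ : [set w | _] = ~` [set w | (sigma w < tau w)%E]).
    by apply: measurableC; exact: measurable_stopping_lt.
  by apply/seteqP; split => w /=; rewrite leNgt => /negP.
move=> w _; rewrite [leRHS]gee0_abs; last by rewrite adde_ge0//; exact: Z0.
rewrite /= pE; case: ifP => _.
  by rewrite -[leLHS]adde0; apply: leeD; [exact: stopped_le_sup (st.1 w)|exact: Z0].
by rewrite -[leLHS]add0e; apply: leeD; [exact: Z0|exact: stopped_le_sup (ss.1 w)].
Qed.

End payoff.

Section dynkin_game.
Context d (T : measurableType d) (R : realType) (P : probability T R)
  (F : R -> set (set T)) (X : R -> T -> R) (r : R) (e : T -> R)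
  (delta piI piS rI rS : R).
Hypotheses (r0 : 0 < r) (fF : is_filtration F) (uF : usual_conditions P F)
  (lX : levy_process P F X) (eX : exp_indep P X r e) (d0 : 0 < delta).

Let G1 (y : R) := y - delta.
Let G2 (y : R) := y + delta.
Let X' (t : R) (w : T) := - X t w.

Hypotheses (iG1 : integrability_limit P X r G1) (iG2 : integrability_limit P X r G2)
  (hI : 0 <= piI < 1) (hS : 0 <= piS < 1) (rI0 : 0 < rI) (rS0 : 0 < rS).
Hypothesis mgfI : forall z : R, - rI < z ->
  (\int[P]_w (expR (z * run_inf X e w))%:E)%E =
  (piI + (1 - piI) * (rI / (rI + z)))%:E.
Hypothesis mgfS : forall z : R, z < rS ->
  (\int[P]_w (expR (z * run_sup X e w))%:E)%E =
  (piS + (1 - piS) * (rS / (rS - z)))%:E.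

Let lX' : levy_process P F X' := levy_process_opp lX.
Let eX' : exp_indep P X' r e := exp_indep_opp eX.

Let mgfI' (z : R) : z < rI ->
  (\int[P]_w (expR (z * run_sup X' e w))%:E)%E =
  (piI + (1 - piI) * (rI / (rI - z)))%:E.
Proof.
move=> zr; have := @mgfI (- z); rewrite ltrN2 => <-//.
by apply: eq_integral => w _; rewrite run_sup_opp mulrN mulNr.
Qed.

Lemma hit_above_stopping_time x b : stopping_time F (hit_above X x b).
Proof.
exact: (hit_above_stopping fF uF lX r0 eX (horizon_sup_no_atom fF lX eX hS rS0 mgfS)).
Qed.

Lemma hit_below_stopping_time x a : stopping_time F (hit_below X x a).
Proof.
have -> : hit_below X x a = hit_above X' (- x) (- a) by apply/funext => w; exact: hit_below_opp.
exact: (hit_above_stopping fF uF lX' r0 eX' (horizon_sup_no_atom fF lX' eX' hI rI0 mgfI')).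
Qed.

Let cG1 : continuous G1.
Proof. by move=> y; apply: cvgB; [exact: cvg_id|exact: cvg_cst]. Qed.

Let cG2 : continuous G2.
Proof. by move=> y; apply: cvgD; [exact: cvg_id|exact: cvg_cst]. Qed.

Variable u : R.
Hypotheses (u0 : 0 < u) (Hu : game_equation delta piI piS rI rS u).

Let xI := level_xI delta piI piS rI rS u.
Let xS := level_xS delta piI piS rI rS u.
Let V := value_fun delta piI piS rI rS u.
Let cS := - (cF_S piS rI rS * coef_AS piS piI rS rI u).
Let cI := - (cF_I piI rI rS * coef_AS piI piS rI rS u).
Let gS (y : R) := excessive_fun piS rS rI cS (y - xS).
Let gI (y : R) := excessive_fun piI rI rS cI (y - - xI).

Let VE x : V x = gS x - gI (- x).
Proof. by rewrite /V value_fun_split// /gS /gI opprK [- x + _]addrC. Qed.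

Let cS_le0 : cS <= 0.
Proof.
rewrite oppr_le0 mulr_ge0//; first by rewrite divr_ge0 ?ltW ?cF_S_den_gt0 ?addr_gt0.
by rewrite ltW// coef_AS_gt0.
Qed.

Let cI_le0 : cI <= 0.
Proof.
rewrite oppr_le0 mulr_ge0//; first by rewrite divr_ge0 ?ltW ?cF_I_den_gt0 ?addr_gt0.
by rewrite ltW// coef_AS_gt0.
Qed.

(** By [coef_AS_le] for the reflected data, [- F_S A_I <= E_I = (1 - pi_I) / r_I], so this slope is
    at least [pi_I]. *)
Let cS_slope : 0 <= 1 + cS * rI.
Proof.
have := coef_AS_le hS hI rS0 rI0 u0; rewrite cF_swap /cE ler_pdivlMr// => h.
have p0 : 0 <= piI by case/andP: hI.
by rewrite mulNr subr_ge0 (le_trans h)// lerBlDr lerDl.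
Qed.

Let cI_slope : 0 <= 1 + cI * rS.
Proof.
have := coef_AS_le hI hS rI0 rS0 u0; rewrite /cE ler_pdivlMr// => h.
have p0 : 0 <= piS by case/andP: hS.
by rewrite mulNr subr_ge0 (le_trans h)// lerBlDr lerDl.
Qed.

Let W x (theta : T -> \bar R) w := stopped X r gS x theta w - stopped X' r gI (- x) theta w.

Let WE x theta w : W x theta w = stopped X r V x theta w.
Proof.
rewrite /W /stopped; case: (theta w) => [t| |]; rewrite ?subr0//.
by rewrite VE mulrBr opprD.
Qed.

Let normG1 (y : R) : `|y| <= `|delta| + `|G1 y|.
Proof. by rewrite -{1}[y](subrK delta) addrC; exact: ler_normD. Qed.

(** The integrability assumed for [G1] along [X] also dominates the side of [-X], once it is read
    through [G1']. *)
Let G1' (y : R) := G1 (- y).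

Let normG1' (y : R) : `|y| <= `|delta| + `|G1' y|.
Proof. by rewrite -normrN; exact: normG1. Qed.

Let iG1' x : (\int[P]_w ereal_sup [set (`|expR (- (r * t)) * G1' (- x + X' t w)|%R)%:E
    | t in [set t : R | (0 <= t)%R]] < +oo)%E.
Proof.
have [+ _] := iG1 x; congr (_ < _)%E; apply: eq_integral => w _; congr ereal_sup.
by apply/seteqP; split => _ [t t0 <-]; exists t => //; rewrite /G1' /X' -opprD opprK.
Qed.

Let cG1' : continuous G1'.
Proof.
move=> y; apply: (@continuous_comp _ _ _ -%R G1); last exact: cG1.
by apply: cvgN; exact: cvg_id.
Qed.

Let excS x theta : stopping_time F theta ->
  (\int[P]_w (stopped X r gS x theta w)%:E <= (gS x)%:E)%E.
Proof. exact: (side_excessive fF lX r0 eX hS rS0 mgfS rI0 cS_le0 cS_slope). Qed.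

Let excI x theta : stopping_time F theta ->
  (\int[P]_w (stopped X' r gI x theta w)%:E <= (gI x)%:E)%E.
Proof. exact: (side_excessive fF lX' r0 eX' hI rI0 mgfI' rS0 cI_le0 cI_slope). Qed.

Let sS0 x theta w : 0 <= stopped X r gS x theta w.
Proof.
rewrite /stopped; case: (theta w) => // t; rewrite mulr_ge0 ?expR_ge0//.
exact: (side_ge0 fF lX eX hS rS0 mgfS rI0 cS_le0 cS_slope).
Qed.

Let sI0 x theta w : 0 <= stopped X' r gI x theta w.
Proof.
rewrite /stopped; case: (theta w) => // t; rewrite mulr_ge0 ?expR_ge0//.
exact: (side_ge0 fF lX' eX' hI rI0 mgfI' rS0 cI_le0 cI_slope).
Qed.

Let integrable_S x theta : stopping_time F theta ->
  P.-integrable setT (EFin \o stopped X r gS x theta).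
Proof.
move=> sth; apply/integrableP; split.
  by apply/measurable_EFinP; exact: (side_measurable _ _ fF lX rS0 _ rI0).
under eq_integral do rewrite /= ger0_norm ?sS0//.
by apply: le_lt_trans (excS x sth) _; rewrite ltry.
Qed.

Let integrable_I x theta : stopping_time F theta ->
  P.-integrable setT (EFin \o stopped X' r gI x theta).
Proof.
move=> sth; apply/integrableP; split.
  by apply/measurable_EFinP; exact: (side_measurable _ _ fF lX' rI0 _ rS0).
under eq_integral do rewrite /= ger0_norm ?sI0//.
by apply: le_lt_trans (excI x sth) _; rewrite ltry.
Qed.

Let integrable_W x theta : stopping_time F theta ->
  P.-integrable setT (EFin \o W x theta).
Proof.
move=> sth; apply: (integrableB measurableT (integrable_S x sth) (integrable_I (- x) sth)).
Qed.

Let int_W x theta : stopping_time F theta -> (\int[P]_w (W x theta w)%:E =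
  \int[P]_w (stopped X r gS x theta w)%:E - \int[P]_w (stopped X' r gI (- x) theta w)%:E)%E.
Proof.
by move=> sth; rewrite -(integralB measurableT (integrable_S x sth) (integrable_I (- x) sth)).
Qed.

Let W_super x theta : stopping_time F theta ->
  (forall w, theta w <= hit_below X x xI w)%E -> (\int[P]_w (W x theta w)%:E <= (V x)%:E)%E.
Proof.
move=> sth th; rewrite int_W// VE EFinB.
rewrite [X in (_ - X <= _)%E](side_harmonic fF lX' r0 eX' hI rI0 mgfI' rS0 cI_le0 cI_slope
  sth _ cG1' normG1' (iG1' x)); last by move=> w; rewrite -hit_below_opp.
by apply: leeB => //; exact: excS.
Qed.

Let W_sub x theta : stopping_time F theta ->
  (forall w, theta w <= hit_above X x xS w)%E -> ((V x)%:E <= \int[P]_w (W x theta w)%:E)%E.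
Proof.
move=> sth th; rewrite int_W// VE EFinB.
rewrite (side_harmonic fF lX r0 eX hS rS0 mgfS rI0 cS_le0 cS_slope
  sth th cG1 normG1 (iG1 x).1).
by apply: leeB => //; exact: excI.
Qed.

Lemma dynkin_M_le x tau : stopping_time F tau ->
  (dynkin_M P X r G1 G2 x (hit_below X x xI) tau <= (V x)%:E)%E.
Proof.
move=> st; have ss := hit_below_stopping_time x xI.
set sigma := hit_below X x xI in ss *.
pose theta w := Order.min (tau w) (sigma w).
have sth : stopping_time F theta by exact: stopping_time_mine.
apply: le_trans (W_super sth _); last by move=> w; rewrite ge_min lexx orbT.
apply: le_integral => //.
- exact: (integrable_payoff fF lX cG1 cG2 (iG1 x).1 (iG2 x).1).
- exact: integrable_W.
move=> w _; rewrite lee_fin WE (dynkin_payoffE _ _ _ _ _ (ss.1 w) (st.1 w)) /stopped /theta.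
have [ts|ts] := leP (tau w) (sigma w).
  case: (tau w) => // t; rewrite ler_wpM2l ?expR_ge0//.
  exact: value_fun_geG1.
have : sigma w = hit_above X' (- x) (- xI) w by exact: hit_below_opp.
case: (sigma w) => // t /esym/(hit_above_level lX')[t0].
rewrite /X' -opprD lerN2 => h; rewrite ler_wpM2l ?expR_ge0//.
by rewrite /V value_fun_le.
Qed.

Lemma dynkin_M_ge x sigma : stopping_time F sigma ->
  ((V x)%:E <= dynkin_M P X r G1 G2 x sigma (hit_above X x xS))%E.
Proof.
move=> ss; have st := hit_above_stopping_time x xS.
set tau := hit_above X x xS in st *.
pose theta w := Order.min (tau w) (sigma w).
have sth : stopping_time F theta by exact: stopping_time_mine.
apply: (le_trans (W_sub sth _)); first by move=> w; rewrite ge_min lexx.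
apply: le_integral => //.
- exact: integrable_W.
- exact: (integrable_payoff fF lX cG1 cG2 (iG1 x).1 (iG2 x).1).
move=> w _; rewrite lee_fin WE (dynkin_payoffE _ _ _ _ _ (ss.1 w) (st.1 w)) /stopped /theta.
have [ts|ts] := leP (tau w) (sigma w); last first.
  case: (sigma w) => // t; rewrite ler_wpM2l ?expR_ge0//.
  exact: value_fun_leG2.
have : tau w = hit_above X x xS w by [].
case: (tau w) => // t /esym/(hit_above_level lX)[t0 h]; rewrite ler_wpM2l ?expR_ge0//.
by rewrite /V value_fun_ge.
Qed.

Lemma dynkin_M_value x :
  dynkin_M P X r G1 G2 x (hit_below X x xI) (hit_above X x xS) = (V x)%:E.
Proof.
apply/eqP; rewrite eq_le dynkin_M_le ?dynkin_M_ge//.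
  exact: hit_below_stopping_time.
exact: hit_above_stopping_time.
Qed.

Lemma upper_value_eq x : upper_value P F X r G1 G2 x = (V x)%:E.
Proof.
apply/eqP; rewrite eq_le; apply/andP; split.
  apply: (@le_trans _ _ (ereal_sup
      [set dynkin_M P X r G1 G2 x (hit_below X x xI) tau | tau in stopping_time F])).
    apply: ereal_inf_lbound; exists (hit_below X x xI) => //.
    exact: hit_below_stopping_time.
  by apply: ge_ereal_sup => _ [tau st <-]; exact: dynkin_M_le.
apply: le_ereal_inf_tmp => _ [sigma ss <-].
apply: le_trans (dynkin_M_ge x ss) _; apply: ereal_sup_ubound.
by exists (hit_above X x xS) => //; exact: hit_above_stopping_time.
Qed.

Lemma lower_value_eq x : lower_value P F X r G1 G2 x = (V x)%:E.
Proof.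
apply/eqP; rewrite eq_le; apply/andP; split.
  apply: ge_ereal_sup => _ [tau st <-].
  apply: le_trans (dynkin_M_le x st); apply: ereal_inf_lbound.
  by exists (hit_below X x xI) => //; exact: hit_below_stopping_time.
apply: (@le_trans _ _ (ereal_inf
    [set dynkin_M P X r G1 G2 x sigma (hit_above X x xS) | sigma in stopping_time F])).
  by apply: le_ereal_inf_tmp => _ [sigma ss <-]; exact: dynkin_M_ge.
apply: ereal_sup_ubound; exists (hit_above X x xS) => //.
exact: hit_above_stopping_time.
Qed.

End dynkin_game.

Unset Implicit Arguments.

Theorem theorem2
  (d : measure_display) (T : measurableType d) (R : realType)
  (P : probability T R) (F : R -> set (set T)) (X : R -> T -> R)
  (r : R) (e : T -> R) (delta piI piS rI rS : R) :
  0 < r ->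
  is_filtration F -> usual_conditions P F -> levy_process P F X ->
  exp_indep P X r e ->
  0 < delta ->
  let G1 := fun y : R => y - delta in
  let G2 := fun y : R => y + delta in
  integrability_limit P X r G1 -> integrability_limit P X r G2 ->
  0 <= piI < 1 -> 0 <= piS < 1 -> 0 < rI -> 0 < rS ->
  (* -rI < 0 < rS are the two roots of Psi(z) = r, where E e^{z X_1} = e^{Psi(z)} *)
  (forall z : R,
     (\int[P]_w (expR (z * X 1 w))%:E)%E = (expR r)%:E <-> (z = - rI \/ z = rS)) ->
  (* laws of I and S via their moment generating functions *)
  (forall z : R, - rI < z ->
     (\int[P]_w (expR (z * run_inf X e w))%:E)%E =
     (piI + (1 - piI) * (rI / (rI + z)))%:E) ->
  (forall z : R, z < rS ->
     (\int[P]_w (expR (z * run_sup X e w))%:E)%E =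
     (piS + (1 - piS) * (rS / (rS - z)))%:E) ->
  (exists! u : R, 0 < u /\ game_equation delta piI piS rI rS u) /\
  (forall u : R, 0 < u -> game_equation delta piI piS rI rS u ->
    let xI := level_xI delta piI piS rI rS u in
    let xS := level_xS delta piI piS rI rS u in
    let V := value_fun delta piI piS rI rS u in
    xS - xI = u /\
    forall x : R,
      let sigma_star := hit_below X x xI in
      let tau_star := hit_above X x xS in
      [/\ stopping_time F sigma_star, stopping_time F tau_star,
          (forall sigma tau, stopping_time F sigma -> stopping_time F tau ->
             (dynkin_M P X r G1 G2 x sigma_star tau <=
              dynkin_M P X r G1 G2 x sigma_star tau_star <=
              dynkin_M P X r G1 G2 x sigma tau_star)%E),
          upper_value P F X r G1 G2 x = (V x)%:E &
          [/\ lower_value P F X r G1 G2 x = (V x)%:E &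
              dynkin_M P X r G1 G2 x sigma_star tau_star = (V x)%:E]]).
Proof.
move=> r0 fF uF lX eX d0 G1 G2 iG1 iG2 hI hS rI0 rS0 _ mgfI mgfS.
have upper u : 0 < u -> game_equation delta piI piS rI rS u -> forall x,
    upper_value P F X r G1 G2 x = (value_fun delta piI piS rI rS u x)%:E.
  move=> u0 Hu x.
  exact: (upper_value_eq r0 fF uF lX eX d0 iG1 iG2 hI hS rI0 rS0 mgfI mgfS u0 Hu).
split.
  have [u u0 Hu] := game_equation_solvable d0 hI hS rI0 rS0.
  exists u; split => // v [v0 Hv].
  (* The upper value involves neither [u] nor [v], so the two candidate functions coincide. *)
  apply: (value_fun_inj d0 hI hS rI0 rS0 u0 v0 Hu Hv) => x.
  by apply: EFin_inj; rewrite -(upper u u0 Hu) -(upper v v0 Hv).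
move=> u u0 Hu xI xS V; split; first exact/(game_equationE _ _ hI hS rI0 rS0).
move=> x sigma_star tau_star.
have ss : stopping_time F sigma_star.
  exact: (hit_below_stopping_time r0 fF uF lX eX hI rI0 mgfI).
have st : stopping_time F tau_star.
  exact: (hit_above_stopping_time r0 fF uF lX eX hS rS0 mgfS).
have M : dynkin_M P X r G1 G2 x sigma_star tau_star = (V x)%:E.
  exact: (dynkin_M_value r0 fF uF lX eX d0 iG1 iG2 hI hS rI0 rS0 mgfI mgfS u0 Hu).
split => //; last split => //.
- move=> sigma tau sst stt; rewrite M; apply/andP; split.
    exact: (dynkin_M_le r0 fF uF lX eX d0 iG1 iG2 hI hS rI0 rS0 mgfI mgfS u0 Hu).
  exact: (dynkin_M_ge r0 fF uF lX eX d0 iG1 iG2 hI hS rI0 rS0 mgfI mgfS u0 Hu).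
- exact: upper.
- exact: (lower_value_eq r0 fF uF lX eX d0 iG1 iG2 hI hS rI0 rS0 mgfI mgfS u0 Hu).
Qed.
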